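(* Assume the embedding property (E). Let $x\in\overline O$, $R_0>0$ and $u\in\mathrm{DG}_{D,x,R_0}(O)$. There is some $c>0$ such that for all $k\ge0$ and $R\in(0,R_0]$ we have the estimate $$\operatorname*{ess\,sup}_{O(x,R/2)}u^+\le k+c\left(R^{-d}\int_{O(x,R)}|(u-k)^+|^2\right)^{1/2}\left(R^{-d}\,|\{u>k\}\cap B(x,R)|\right)^{\frac{\theta-1}{2}}.$$ In addition, if $R<\mathrm{d}_D(x)$, then all $k\in\mathbb{R}$ are allowed in this estimate. Furthermore, if $A$ is real-valued and $u\in H^1_D(O;\mathbb{R})$ with $L_Du=0$ in $O(x,R)$, then $c>0$ depends only on $d$, ellipticity, $R_0$ and the constants in (E).
   Context: Setting. $d\ge2$, $O\subseteq\mathbb{R}^d$ is open, $D\subseteq\partial O$ is closed, $N:=\partial O\setminus D$. $B(x,r)$ is the open ball, $E(x,r):=E\cap B(x,r)$ for $E\subseteq\mathbb{R}^d$, $\partial O(x,r):=\partial(O(x,r))$, $\mathrm{d}_D(x)$ is the distance of $x$ to $D$ ($+\infty$ if $D=\varnothing$). For an open set $U$ and closed $F\subseteq\partial U$, $H^1_F(U)$ is the closure in $H^1(U)$ of $\{\varphi|_U:\varphi\in C_c^\infty(\mathbb{R}^d\setminus F)\}$; $H^1_D(O;\mathbb{R})$ denotes the real-valued functions in $H^1_D(O)$. $\{u>k\}$ is a subset of $O$, and $|\cdot|$ of a set is its Lebesgue measure. Operator. $A\in L^\infty(O;\mathbb{C}^{d\times d})$, $\Lambda:=\|A\|_\infty$,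 and there is $\lambda>0$ with $\mathrm{Re}\int_OA\nabla u\cdot\overline{\nabla u}\ge\lambda\|\nabla u\|_{L^2(O)}^2$ for all $u\in H^1_D(O)$; ''ellipticity'' refers to $\lambda,\Lambda$. ''$L_Du=0$ in $O(x,r)$'' means $\int_{O(x,r)}A\nabla u\cdot\overline{\nabla\varphi}=0$ for all $\varphi\in H^1_{\partial O(x,r)\setminus N(x,r)}(O(x,r))$. Property (E). If $d\ge3$: there is $c_E>0$ with $\|u\|_{L^{2^*}(O)}\le c_E\|u\|_{H^1(O)}$ for all $u\in H^1_D(O)$, where $2^*=2d/(d-2)$. If $d=2$: there are $q\in(2,\infty)$ and $c_E>0$ with $\|u\|_{L^q(O)}\le c_E\|u\|_{H^1(O)}^{1-2/q}\|u\|_{L^2(O)}^{2/q}$ for all $u\in H^1_D(O)$. De Giorgi class. For $x\in\overline O$ and $R>0$, $\mathrm{DG}_{D,x,R}(O)$ is the set of all $u\in H^1_D(O;\mathbb{R})$ for which there exists a constant $c>0$ such that for all $r\in(0,R)$ and $k\in[0,\infty)$, and for both choices of sign, $$\int_{O(x,r)}|\nabla(u\mp k)^\pm|^2\le\frac{c}{(R-r)^2}\int_{O(x,R)}|(u\mp k)^\pm|^2.$$ In addition, if $R<\mathrm{d}_D(x)$, then both estimates are required for all $k\in\mathbb{R}$. Exponent. $\theta:=\frac12+\sqrt{\frac14+\frac2\delta}>1$ with $\delta:=\frac{2q}{q-2}$ if $d=2$ and $\delta:=d$ if $d\ge3$.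
   Formalization: Membership in the De Giorgi class is taken to mean its inequalities for every outer radius R in (0,R_0] with one constant c (with only R_0 the claim fails); when R<d_D(x), the bound for negative k is for ess sup u, not u^+, since it fails for u^+ (u=-1, k=-1/2). *)

(* Defs.v *)
From HB Require Import structures.
From mathcomp Require Import all_boot all_order all_algebra.
From mathcomp Require Import all_classical all_reals all_analysis measurable_realfun ess_sup_inf.
From mathcomp Require Import complex.

Set Implicit Arguments.
Unset Strict Implicit.
Unset Printing Implicit Defensive.

Import Order.TTheory GRing.Theory Num.Theory.
Import numFieldNormedType.Exports.

Local Notation normc := ComplexField.Normc.normc.

Local Open Scope classical_set_scope.
Local Open Scope ring_scope.

Definition borel_rV_display : measure_display.
Proof. exact. Qed.

Section borel_rV.
Context (R : realType) (n : nat).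

Let borel_rV : set_system 'rV[R]_n := <<s open >>.

HB.instance Definition _ := @isMeasurable.Build borel_rV_display 'rV[R]_n
  borel_rV (@sigma_algebra0 _ setT open) (@sigma_algebraC _ open)
  (@sigma_algebra_bigcup _ setT open).

End borel_rV.

Section lebesgue_rV_step.
Context (R : realType) (n : nat).

Definition cons_rV (p : measurableTypeR R * 'rV[R]_n) : 'rV[R]_n.+1 :=
  \row_j oapp (p.2 ord0) p.1 (unlift ord0 j).

Lemma open_measurable_rV (m : nat) (U : set 'rV[R]_m) : open U -> measurable U.
Proof. by move=> oU; apply: sub_sigma_algebra. Qed.

Lemma measurable_cons_rV : measurable_fun setT cons_rV.
Proof.
apply: (measurability (open : set_system 'rV[R]_n.+1)) => // _ [U oU <-].
rewrite setTI.
pose rat_rV (v : 'rV[rat]_n) : 'rV[R]_n := map_mx ratr v.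
pose box (i : rat * 'rV[rat]_n * nat) : set (measurableTypeR R * 'rV[R]_n) :=
  ball (ratr i.1.1 : R) i.2.+1%:R^-1 `*` ball (rat_rV i.1.2) i.2.+1%:R^-1.
have -> : cons_rV @^-1` U =
    \bigcup_i (if `[< box i `<=` cons_rV @^-1` U >] then box i else set0).
  apply/seteqP; split => [p Up|p [i _]]; last by case: asboolP => // + pi; exact.
  have /nbhs_ballP[e /= e0 eU] : nbhs (cons_rV p) U by exact: open_nbhs_nbhs.
  have [k _ kP] := near_infty_natSinv_lt (PosNum (divr_gt0 e0 (ltr0n _ 2))).
  have ke : k.+1%:R^-1 < e / 2 by exact: (kP k (leqnn k)).
  have k0 : 0 < k.+1%:R^-1 :> R by rewrite invr_gt0.
  have rat_near (x : R) : exists q : rat, `|ratr q - x| < k.+1%:R^-1.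
    have [|q] := @rat_in_itvoo R (x - k.+1%:R^-1) (x + k.+1%:R^-1).
      by rewrite ltrD2l gtrN.
    by rewrite in_itv/= => qP; exists q; rewrite ltr_distl.
  have [q0 Hq0] := rat_near (p.1 : R).
  have /choice[q Hq] := fun j => rat_near (p.2 ord0 j).
  exists (q0, \row_j q j, k) => //; case: asboolP => [_|].
    split => /=; first exact: Hq0.
    by split => // i j; rewrite ord1 !mxE; exact: Hq.
  case=> -[y w] [/= yP wP]; apply: eU; split => // i j.
  rewrite ord1 !mxE /ball/= distrC; case: (unlift ord0 j) => [l|] /=.
    rewrite (le_lt_trans (ler_distD (ratr (q l)) _ _))// (splitr e) ltrD//.
      rewrite distrC (lt_trans _ ke)//.
      by have [_ /(_ ord0 l)] := wP; rewrite !mxE.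
    exact: lt_trans (Hq l) ke.
  rewrite (le_lt_trans (ler_distD (ratr q0) _ _))// (splitr e) ltrD//.
    by rewrite distrC (lt_trans _ ke).
  exact: lt_trans Hq0 ke.
apply: countable_bigcupT_measurable => // i; case: asboolP => // _.
apply: measurableX.
  exact: measurable_ball.
by apply: open_measurable_rV; apply: ball_open; rewrite invr_gt0.
Qed.

Lemma measurable_uncons_rV : measurable_fun setT
  (fun v : 'rV[R]_n.+1 => (v ord0 ord0 : measurableTypeR R,
                           \row_j v ord0 (lift ord0 j))).
Proof.
have mcont (m : nat) (f : 'rV[R]_n.+1 -> 'rV[R]_m) : continuous f ->
    measurable_fun setT f.
  move=> /continuousP cf.
  apply: (measurability (open : set_system 'rV[R]_m)) => // _ [U oU <-].
  by rewrite setTI; apply: open_measurable_rV; exact: cf.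
apply: measurable_fun_pair.
  apply: (measurability _ (RGenOpens.measurableE R)) => // _ [_ [a [b ->]] <-].
  rewrite setTI; apply: open_measurable_rV; apply: open_comp.
    by move=> v _; exact: coord_continuous.
  exact: interval_open.
apply: mcont => v s /= /nbhs_ballP[e e0 es].
apply/nbhs_ballP; exists e => //= w [_ vw]; apply: es; split => // i j.
by rewrite !mxE; exact: vw.
Qed.

End lebesgue_rV_step.

Section lebesgue_rV_cons.
Context (R : realType) (n : nat).
Variable m : {sigma_finite_measure set 'rV[R]_n -> \bar R}.

Definition lebesgue_rV_cons : set 'rV[R]_n.+1 -> \bar R :=
  pushforward (lebesgue_measure \x m)%E (@cons_rV R n).

Let preim A : measurable A -> measurable (@cons_rV R n @^-1` A).
Proof. by move=> mA; rewrite -[X in measurable X]setTI; exact: measurable_cons_rV. Qed.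

Let lebesgue_rV_cons0 : lebesgue_rV_cons set0 = 0%E.
Proof. by rewrite /lebesgue_rV_cons /pushforward preimage_set0 measure0. Qed.

Let lebesgue_rV_cons_ge0 A : (0 <= lebesgue_rV_cons A)%E.
Proof. by apply: integral_ge0 => x _; exact: measure_ge0. Qed.

Let lebesgue_rV_cons_sigma_additive : semi_sigma_additive lebesgue_rV_cons.
Proof.
move=> F mF tF mUF; rewrite /lebesgue_rV_cons /pushforward preimage_bigcup.
apply: measure_semi_sigma_additive.
- by move=> k; exact: preim.
- apply/trivIsetP => /= i j _ _ ij; rewrite -preimage_setI.
  by move/trivIsetP : tF => /(_ _ _ _ _ ij) ->//; rewrite preimage_set0.
- by rewrite -preimage_bigcup; exact: preim.
Qed.

HB.instance Definition _ := isMeasure.Build _ _ _ lebesgue_rV_cons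
  lebesgue_rV_cons0 lebesgue_rV_cons_ge0 lebesgue_rV_cons_sigma_additive.

Let lebesgue_rV_cons_sigma_finite : sigma_finite setT lebesgue_rV_cons.
Proof.
have /sigma_finiteP[E [TE ndE Eoo]] := sigma_finiteT (@lebesgue_measure R).
have /sigma_finiteP[G [TG ndG Goo]] := sigma_finiteT m.
pose F k := E k `*` G k.
have UF : [set: measurableTypeR R * 'rV[R]_n] = \bigcup_k F k.
  rewrite -setXTT TE TG predeqE => -[y w]; split.
    move=> [/= [i _ Eiy] [j _ Gjw]]; exists (maxn i j) => //; split.
    - by move: y Eiy; exact/subsetPset/ndE/leq_maxl.
    - by move: w Gjw; exact/subsetPset/ndG/leq_maxr.
  by move=> [i _ []/= ? ?]; split; exists i.
have mF k : measurable (F k) /\ ((lebesgue_measure \x m) (F k) < +oo)%E.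
  have [? ?] := Eoo k; have [? ?] := Goo k; split; first exact: measurableX.
  by rewrite product_measure1E// lte_mul_pinfty// ge0_fin_numE.
pose g (v : 'rV[R]_n.+1) : measurableTypeR R * 'rV[R]_n :=
  (v ord0 ord0, \row_j v ord0 (lift ord0 j)).
have gK : cancel (@cons_rV R n) g.
  case=> x v; rewrite /g /cons_rV; congr (_, _); first by rewrite mxE unlift_none.
  by apply/rowP => j; rewrite !mxE liftK.
exists (fun k => g @^-1` F k); first by rewrite -preimage_bigcup -UF preimage_setT.
move=> k; have [mFk Fk] := mF k; split.
  by rewrite -[X in measurable X]setTI; exact: measurable_uncons_rV.
rewrite /lebesgue_rV_cons /pushforward -comp_preimage.
by rewrite (_ : g \o _ = id)//; apply/funext => p /=; rewrite gK.
Qed.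

HB.instance Definition _ := Measure_isSigmaFinite.Build _ _ _ lebesgue_rV_cons
  lebesgue_rV_cons_sigma_finite.

End lebesgue_rV_cons.

Fixpoint lebesgue_rV (R : realType) (n : nat) :
    {sigma_finite_measure set 'rV[R]_n -> \bar R} :=
  match n with
  | 0 => \d_(0 : 'rV[R]_0)
  | k.+1 => lebesgue_rV_cons (lebesgue_rV R k)
  end.

Section euclidean.
Context {R : realType} {d : nat}.
Implicit Types (x y : 'rV[R]_d) (A D U : set 'rV[R]_d).

(* The norm and balls that the library puts on ['rV[R]_d] are those of the
   maximum norm (with the same topology), hence [enorm] and [eball]. *)
Definition enorm x : R := Num.sqrt (\sum_j x ord0 j ^+ 2).

Definition eball x (r : R) : set 'rV[R]_d := [set y | enorm (y - x) < r].

Definition boundary A : set 'rV[R]_d := closure A `\` interior A.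

(* [+oo] when [D] is empty *)
Definition dist_to D x : \bar R := ereal_inf [set (enorm (x - y))%:E | y in D].

Definition cvnorm (v : 'cV[R[i]]_d) : R :=
  Num.sqrt (\sum_j normc (v j ord0) ^+ 2).

Definition cvdot (v w : 'cV[R[i]]_d) : R[i] :=
  \sum_j v j ord0 * conjc (w j ord0).

Definition opnorm (M : 'M[R[i]]_d) : R :=
  sup [set cvnorm (M *m v) | v in [set v | cvnorm v <= 1]].

(* Elements of L^p spaces are represented by functions defined on all of
   ['rV[R]_d], of which only the values on the set of integration matter. *)

Definition Lpnorm U (p : \bar R) (f : 'rV[R]_d -> R) : \bar R :=
  'N[lebesgue_rV R d]_p[(EFin \o f) \_ U].

(* The value [-oo] outside of [U] makes [ess_sup] ignore the complement. *)
Definition ess_sup_on U (f : 'rV[R]_d -> R) : \bar R :=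
  ess_sup (lebesgue_rV R d) (patch (fun=> -oo%E) U (EFin \o f)).

Definition cmeasurable_fun U (f : 'rV[R]_d -> R[i]) : Prop :=
  measurable_fun U (fun y => complex.Re (f y)) /\
  measurable_fun U (fun y => complex.Im (f y)).

Definition cintegral U (f : 'rV[R]_d -> R[i]) : R[i] :=
  Complex (\int[lebesgue_rV R d]_(y in U) complex.Re (f y))
          (\int[lebesgue_rV R d]_(y in U) complex.Im (f y)).

Definition locally_integrable_on U (f : 'rV[R]_d -> R[i]) : Prop :=
  cmeasurable_fun U f /\
  forall K : set 'rV[R]_d, compact K -> K `<=` U ->
    (\int[lebesgue_rV R d]_(y in K) (normc (f y))%:E < +oo)%E.

End euclidean.

Section sobolev.
Context {R : realType} {d : nat}.
Implicit Types (F U : set 'rV[R]_d) (u : 'rV[R]_d -> R[i]).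

Definition partial (j : 'I_d) (f : 'rV[R]_d -> R) : 'rV[R]_d -> R :=
  fun y => 'D_(delta_mx ord0 j) f y.

Definition smooth (f : 'rV[R]_d -> R) : Prop := forall s : seq 'I_d,
  continuous (foldr partial f s) /\
  forall j y, derivable (foldr partial f s) y (delta_mx ord0 j).

Definition cpartial (j : 'I_d) (f : 'rV[R]_d -> R[i]) (y : 'rV[R]_d) : R[i] :=
  Complex (partial j (fun z => complex.Re (f z)) y)
          (partial j (fun z => complex.Im (f z)) y).

(* C_c^oo(U), for U open *)
Definition test_function U (phi : 'rV[R]_d -> R[i]) : Prop :=
  let supp := closure [set y | phi y != 0] in
  [/\ smooth (fun y => complex.Re (phi y)),
      smooth (fun y => complex.Im (phi y)),
      compact supp & supp `<=` U].

Definition weak_gradient U u (g : 'rV[R]_d -> 'cV[R[i]]_d) : Prop :=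
  [/\ locally_integrable_on U u,
      forall j, locally_integrable_on U (fun y => g y j ord0) &
      forall phi j, test_function U phi ->
        cintegral U (fun y => u y * cpartial j phi y) =
        - cintegral U (fun y => g y j ord0 * phi y)].

(* Weak gradients are unique up to null sets; [grad U u] is 0 if there is none. *)
Definition grad U u : 'rV[R]_d -> 'cV[R[i]]_d :=
  xget (fun=> 0) [set g | weak_gradient U u g].

Definition L2norm U u : \bar R := Lpnorm U 2%:E (fun y => normc (u y)).

Definition L2norm_grad U u : \bar R :=
  Lpnorm U 2%:E (fun y => cvnorm (grad U u y)).

Definition H1norm U u : \bar R :=
  ((L2norm U u ^+ 2 + L2norm_grad U u ^+ 2) `^ 2^-1)%E.

Definition H1 U u : Prop :=
  (exists g, weak_gradient U u g) /\ (H1norm U u < +oo)%E.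

Definition H1_ F U u : Prop :=
  H1 U u /\
  forall e : R, 0 < e -> exists2 phi, test_function (~` F) phi &
    (H1norm U (fun y => (u y - phi y)%R) < e%:E)%E.

Definition H1real_ F U (u : 'rV[R]_d -> R) : Prop :=
  H1_ F U (fun y => (u y)%:C%C).

End sobolev.

Section operator.
Context {R : realType} {d : nat}.
Implicit Types (O D : set 'rV[R]_d) (A : 'rV[R]_d -> 'M[R[i]]_d).

Definition bounded_coefficients O A (Lambda : R) : Prop :=
  (forall i j, cmeasurable_fun O (fun y => A y i j)) /\
  ess_sup_on O (fun y => opnorm (A y)) = Lambda%:E.

Definition coercive D O A (lambda : R) : Prop :=
  forall u, H1_ D O u ->
    lambda * (\int[lebesgue_rV R d]_(y in O) (cvnorm (grad O u y) ^+ 2)) <=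
    complex.Re (cintegral O (fun y => cvdot (A y *m grad O u y) (grad O u y))).

Definition real_coefficients O A : Prop :=
  {ae lebesgue_rV R d, forall y, O y -> forall i j, complex.Im (A y i j) = 0}.

(* L_D u = 0 in the intersection of [O] and [eball x r] *)
Definition weak_solution D O A (x : 'rV[R]_d) (r : R) (u : 'rV[R]_d -> R[i]) :
    Prop :=
  let N := boundary O `\` D in
  let Or := O `&` eball x r in
  forall phi, H1_ (boundary Or `\` (N `&` eball x r)) Or phi ->
    cintegral Or (fun y => cvdot (A y *m grad O u y) (grad Or phi y)) = 0.

(* The Sobolev exponent for [3 <= d]; the exponent [q] occurs only if [d = 2]. *)
Definition embedding D O (q cE : R) : Prop :=
  0 < cE /\
  if d == 2%N then
    2 < q /\ forall u, H1_ D O u ->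
      (Lpnorm O q%:E (fun y => normc (u y)) <=
       cE%:E * H1norm O u `^ (1 - 2 / q) * L2norm O u `^ (2 / q))%E
  else
    forall u, H1_ D O u ->
      (Lpnorm O ((2 * d%:R) / (d%:R - 2))%:E (fun y => normc (u y)) <=
       cE%:E * H1norm O u)%E.

End operator.

Definition theta (R : realType) (d : nat) (q : R) : R :=
  let delta := if d == 2%N then (2 * q) / (q - 2) else d%:R in
  2^-1 + Num.sqrt (4^-1 + 2 / delta).

Section de_giorgi.
Context {R : realType} {d : nat}.
Implicit Types (O D : set 'rV[R]_d) (u w : 'rV[R]_d -> R).

Definition energy O U w : \bar R :=
  (\int[lebesgue_rV R d]_(y in U)
     (cvnorm (grad O (fun z => (w z)%:C%C) y) ^+ 2)%:E)%E.

Definition mass U w : \bar R :=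
  (\int[lebesgue_rV R d]_(y in U) (w y ^+ 2)%:E)%E.

(* The outer radius [s] is fixed and the inner radius [r] ranges over ]0, s[. *)
Definition caccioppoli D O (x : 'rV[R]_d) (s c : R) u : Prop :=
  forall r k : R, 0 < r < s -> 0 <= k \/ (s%:E < dist_to D x)%E ->
  (energy O (O `&` eball x r) ((u \- cst k)^\+)%R <=
     (c / (s - r) ^+ 2)%:E * mass (O `&` eball x s) ((u \- cst k)^\+)%R)%E /\
  (energy O (O `&` eball x r) ((u \+ cst k)^\-)%R <=
     (c / (s - r) ^+ 2)%:E * mass (O `&` eball x s) ((u \+ cst k)^\-)%R)%E.

(* The inequalities are required, with one constant, at every outer radius
   [s <= r0]. Requiring them at [s = r0] only would admit functions that are
   unbounded near [x]: a mild singularity at [x] is dominated on the right-hand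
   side, at every level [k], by a stronger one on the sphere of radius [r0]. *)
Definition DG D O (x : 'rV[R]_d) (r0 : R) u : Prop :=
  H1real_ D O u /\
  exists2 c : R, 0 < c & forall s, 0 < s <= r0 -> caccioppoli D O x s c u.

Definition bound_rhs O (x : 'rV[R]_d) (s q c : R) u (k : R) : \bar R :=
  (k%:E +
   c%:E * ((s ^- d)%:E * mass (O `&` eball x s) ((u \- cst k)^\+)%R) `^ 2^-1 *
   ((s ^- d)%:E *
      lebesgue_rV R d ([set y | O y /\ (k < u y)%R] `&` eball x s))
     `^ ((theta d q - 1) / 2))%E.

(* The left-hand side of the second bound is [u], not [u^\+]: for [k < 0] the
   bound with [u^\+] fails for [u = -1] near [x] and [k = - 1/2], and for
   [0 <= k] the two bounds are equivalent since the right-hand side is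
   nonnegative. *)
Definition local_bounds D O (x : 'rV[R]_d) (s q c : R) u : Prop :=
  (forall k, 0 <= k ->
     (ess_sup_on (O `&` eball x (s / 2)) (u^\+)%R <= bound_rhs O x s q c u k)%E) /\
  ((s%:E < dist_to D x)%E -> forall k,
     (ess_sup_on (O `&` eball x (s / 2)) u <= bound_rhs O x s q c u k)%E).

End de_giorgi.

(* Main.v *)
(* Write p for the Sobolev exponent (q if d = 2) and, for a level h and a radius
   r, let phi(h, r) be the integral of the square of (u - h)^+ over the part of O
   in B(x, r), and m(h, r) the measure of the set {u > h} in that ball. A
   Caccioppoli inequality bounds the gradient of (u - h)^+ in B(x, r) by
   (rho - r)^-2 phi(h, rho). Multiplying (u - h)^+ by a cut-off function gives an
   element of H^1_D(O), and the embedding followed by Hoelder's inequality on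
   {u > h} yields
     phi(h, r) <= K (rho - r)^-2 m(h, rho)^(1 - 2/p) phi(h, rho),
   while m(h, r) <= (h - h')^-2 phi(h', r) for h' < h. As
   1 - 2/p = theta (theta - 1), the product phi m^(theta - 1) at level h is
   bounded by its theta-th power at any lower level h', up to the factor
   (rho - r)^-2 (h - h')^(-2 (theta - 1)); iterating along levels increasing to
   k + H and radii decreasing to half the initial one shows that {u > k + H} is a
   null set in the smaller ball. After rescaling to the unit ball the threshold H
   is the second term of the bound.

   For weak solutions the Caccioppoli inequality comes from testing the equation
   with eta^2 (u - h)^+ and using coercivity for eta (u - h)^+. That truncations
   stay in H^1_D(O), with the expected gradient, is proved by composing smooth
   approximations of u with smooth approximations of t |-> max(t, 0). *)

From HB Require Import structures.
Require Import Defs.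
From mathcomp Require Import all_boot all_order all_algebra.
From mathcomp Require Import all_classical all_reals all_analysis.
From mathcomp Require Import measurable_realfun ess_sup_inf.
From mathcomp Require Import complex.
From mathcomp Require Import ring lra.

Set Implicit Arguments.
Unset Strict Implicit.
Unset Printing Implicit Defensive.

Import Order.TTheory GRing.Theory Num.Theory.
Import numFieldNormedType.Exports.

Local Open Scope classical_set_scope.
Local Open Scope ring_scope.

Local Notation normc := ComplexField.Normc.normc.

(** * Smooth functions and cut-offs *)

(** Four points shape the development. Coercivity is assumed for integrals over [O] only, not
    pointwise, so it can be applied only to a global element of the form space, whereas the equation
    is tested on the part of [O] in a ball, a form space with a Dirichlet part of its own. Cutting
    off is therefore proved for a general open subset and a general Dirichlet part, and the two
    integrals are compared only afterwards.

    The gradient in the definitions is chosen arbitrarily among all weak gradients. Every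
    computation with it rests on uniqueness almost everywhere, hence on the fundamental lemma and on
    integration by parts for a measure built one coordinate at a time.

    In the approximation of truncations the derivative of the smooth truncation multiplies a
    gradient that is merely square integrable, so closeness of the arguments in L^2 does not suffice
    at once; a bounded gradient is inserted in between.

    All constants are explicit functions of the data, so that the claim on weak solutions can fix
    its constant before the domain, the coefficients and the solution. *)

Section smooth_calculus.
Context {R : realType} {d : nat}.
Implicit Types (f g : 'rV[R]_d -> R) (j : 'I_d).

Local Notation e_ j := (delta_mx ord0 j : 'rV[R]_d).

Lemma smoothP f : smooth f <->
  [/\ continuous f, forall j y, derivable f y (e_ j) &
      forall j, smooth (partial j f)].
Proof.
split=> [sf|[cf df sf] s].
  split=> [|j y|j s]; first by have [] := sf [::].
    by have [_] := sf [::]; exact.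
  by have := sf (rcons s j); rewrite foldr_rcons.
elim/last_ind: s => [|s j _]; first by split.
by rewrite foldr_rcons; have := sf j s.
Qed.

(** Smoothness graded by order. The product and quotient rules involve the functions themselves
    besides their derivatives, so they are proved by induction on a finite order. *)
Fixpoint Csmooth (n : nat) f : Prop := continuous f /\
  if n is n'.+1 then (forall j y, derivable f y (e_ j)) /\
    forall j, Csmooth n' (partial j f) else True.

Lemma CsmoothW n f : Csmooth n.+1 f -> Csmooth n f.
Proof.
elim: n f => [|n IH] f; first by case.
by move=> [cf [df pf]]; split => //; split => // j; apply: IH.
Qed.

Lemma smooth_Csmooth f : smooth f <-> forall n, Csmooth n f.
Proof.
split=> [sf n|].
  elim: n f sf => [|n IH] f /smoothP[cf df sf] => //=.
  by split => //; split => // j; apply: IH.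
move=> + s; elim/last_ind: s f => [|s j IH] f Cf.
  by have [cf [df _]] := Cf 1%N.
rewrite foldr_rcons; apply: IH => n.
by have [_ [_]] := Cf n.+1; exact.
Qed.

Lemma partialD f g j y : derivable f y (e_ j) -> derivable g y (e_ j) ->
  partial j (fun z => f z + g z) y = partial j f y + partial j g y.
Proof. exact: deriveD. Qed.

Lemma partialM f g j y : derivable f y (e_ j) -> derivable g y (e_ j) ->
  partial j (fun z => f z * g z) y = f y * partial j g y + g y * partial j f y.
Proof. exact: deriveM. Qed.

Lemma CsmoothD n f g : Csmooth n f -> Csmooth n g ->
  Csmooth n (fun y => f y + g y).
Proof.
elim: n f g => [|n IH] f g.
  by move=> [cf _] [cg _]; split => // y; exact: (cvgD (cf y) (cg y)).
move=> [cf [df Cf]] [cg [dg Cg]].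
split; first by move=> y; exact: (cvgD (cf y) (cg y)).
split=> [j y|j]; first exact: derivableD.
rewrite (_ : partial j _ = fun y => partial j f y + partial j g y).
  by have := IH _ _ (Cf j) (Cg j).
by apply/funext => y; rewrite partialD.
Qed.

Lemma CsmoothM n f g : Csmooth n f -> Csmooth n g ->
  Csmooth n (fun y => f y * g y).
Proof.
elim: n f g => [|n IH] f g.
  by move=> [cf _] [cg _]; split => // y; exact: (cvgM (cf y) (cg y)).
move=> Cfn Cgn; have Cfn' := CsmoothW Cfn; have Cgn' := CsmoothW Cgn.
move: Cfn Cgn => [cf [df Cf]] [cg [dg Cg]].
split; first by move=> y; exact: (cvgM (cf y) (cg y)).
split=> [j y|j]; first exact: derivableM.
rewrite (_ : partial j _ =
    fun y => f y * partial j g y + g y * partial j f y).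
  by have := CsmoothD (IH _ _ Cfn' (Cg j)) (IH _ _ Cgn' (Cf j)).
by apply/funext => y; rewrite partialM.
Qed.

Lemma partialV f j y : f y != 0 -> derivable f y (e_ j) ->
  partial j (fun z => (f z)^-1) y = - ((f y)^-1 * (f y)^-1 * partial j f y).
Proof. by move=> f0 df; rewrite /partial deriveV// scaleNr -exprVn expr2. Qed.

Lemma partial_cst (c : R) j y : partial j (fun=> c) y = 0.
Proof. exact: derive_cst. Qed.

Lemma smooth_cst (c : R) : smooth (fun _ : 'rV[R]_d => c).
Proof.
apply/smooth_Csmooth => n; elim: n c => [|n IH] c.
  by split => // y; exact: cst_continuous.
split; first by move=> y; exact: cst_continuous.
split=> [j y|j]; first exact: derivable_cst.
rewrite (_ : partial j _ = fun=> 0) //.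
by apply/funext => y; rewrite partial_cst.
Qed.

Lemma smoothD f g : smooth f -> smooth g -> smooth (fun y => f y + g y).
Proof.
by rewrite !smooth_Csmooth => Cf Cg n; apply: CsmoothD.
Qed.

Lemma smoothM f g : smooth f -> smooth g -> smooth (fun y => f y * g y).
Proof.
by rewrite !smooth_Csmooth => Cf Cg n; apply: CsmoothM.
Qed.

Lemma smoothZ (c : R) f : smooth f -> smooth (fun y => c * f y).
Proof. by apply: smoothM; exact: smooth_cst. Qed.

Lemma smoothN f : smooth f -> smooth (fun y => - f y).
Proof.
move=> /(smoothZ (-1)); rewrite (_ : (fun y => -1 * f y) = (fun y => - f y))//.
by apply/funext => y; rewrite mulN1r.
Qed.

Lemma smoothB f g : smooth f -> smooth g -> smooth (fun y => f y - g y).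
Proof. by move=> sf /smoothN; exact: smoothD. Qed.

Lemma smooth_sum (I : Type) (r : seq I) (F : I -> 'rV[R]_d -> R) :
  (forall i, smooth (F i)) -> smooth (fun y => \sum_(i <- r) F i y).
Proof.
move=> sF; elim: r => [|i r IH].
  rewrite (_ : (fun y => _) = fun=> 0); first exact: smooth_cst.
  by apply/funext => y; rewrite big_nil.
rewrite (_ : (fun y => _) = fun y => F i y + \sum_(i <- r) F i y).
  exact: smoothD.
by apply/funext => y; rewrite big_cons.
Qed.

Lemma smoothV f : (forall y, f y != 0) -> smooth f -> smooth (fun y => (f y)^-1).
Proof.
move=> f0 /smooth_Csmooth Cf; apply/smooth_Csmooth => n.
have cVf : continuous (fun y => (f y)^-1).
  by move=> y; have [cf _] := Cf 0%N; exact: (cvgV (f0 y) (cf y)).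
(* The derivative is a polynomial in [f^-1] and the derivative of [f], so the induction closes. *)
elim: n => [//|n IH]; have [cf [df Cpf]] := Cf n.+1.
split => //; split=> [j y|j]; first exact: derivableV.
rewrite (_ : partial j _ = fun y => -1 * ((f y)^-1 * (f y)^-1 * partial j f y)).
  apply: CsmoothM; first by have /smooth_Csmooth := smooth_cst (-1); exact.
  by have := CsmoothM (CsmoothM IH IH) (Cpf j).
by apply/funext => y; rewrite partialV// mulN1r.
Qed.

Lemma partial_coord (i j : 'I_d) (y : 'rV[R]_d) :
  is_derive y (e_ j) (fun z : 'rV[R]_d => z ord0 i) (i == j)%:R.
Proof.
have H : (fun h : R => h^-1 *: (((fun z : 'rV[R]_d => z ord0 i) \o shift y)
     (h *: e_ j) - y ord0 i)) @ 0^' --> ((i == j)%:R : R).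
  apply: cvg_near_cst.
  near=> h; rewrite /= !mxE eqxx/= addrK.
  by rewrite /GRing.scale/= mulrA mulVf ?mul1r//; near: h; exact: nbhs_dnbhs_neq.
split; first by apply/cvg_ex; exists ((i == j)%:R).
exact: cvg_lim H.
Unshelve. all: by end_near. Qed.

Lemma smooth_coord (i : 'I_d) : smooth (fun y : 'rV[R]_d => y ord0 i).
Proof.
apply/smoothP; split=> [y|j y|j]; first exact: coord_continuous.
  by have [] := partial_coord i j y.
rewrite (_ : partial j _ = fun=> (i == j)%:R); first exact: smooth_cst.
by apply/funext => y; rewrite /partial; have [_ ->] := partial_coord i j y.
Qed.

Lemma derive_line f y v : 'D_v f y = 'D_1 (fun h : R => f (h *: v + y)) 0.
Proof.
rewrite /derive; f_equal; f_equal; apply/funext => h /=.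
by rewrite scale0r add0r /GRing.scale/= mulr1 addr0.
Qed.

Lemma is_derive_comp_R (G : R -> R) f (y v : 'rV[R]_d) (a : R) :
  is_derive (f y) 1 G a -> derivable f y v ->
  is_derive y v (fun z => G (f z)) (a * 'D_v f y).
Proof.
move=> dG df.
have dl : is_derive (0 : R) 1 (fun h : R => f (h *: v + y)) ('D_v f y).
  split; last by rewrite -derive_line.
  by move/derivable1P : df.
have dG' : is_derive ((fun h : R => f (h *: v + y)) 0) 1 G a.
  by rewrite /= scale0r add0r.
have := is_derive1_comp dG' dl => -[D1 D2].
split; first by apply/derivable1P.
by rewrite derive_line -D2.
Qed.

End smooth_calculus.

(** * The function exp(-1/t) and the family of its derivatives *)

Section psi.
Context {R : realType}.

(* The factors [t ^- m] make the family closed under differentiation, so that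
   smoothness follows by induction on the order of the derivatives. *)
Definition psi (m : nat) (t : R) : R :=
  if 0 < t then t ^- m * expR (- t^-1) else 0.

Lemma psi_ge0 m t : 0 <= psi m t.
Proof.
rewrite /psi; case: ifP => // t0.
by rewrite mulr_ge0 ?expR_ge0// invr_ge0 exprn_ge0// ltW.
Qed.

Lemma psi_le0 m t : t <= 0 -> psi m t = 0.
Proof. by rewrite /psi leNgt => /negbTE ->. Qed.

Lemma psi_gt0 t : 0 < t -> 0 < psi 0 t.
Proof. by rewrite /psi => ->; rewrite expr0 invr1 mul1r expR_gt0. Qed.

(** For positive [n], the [n]-th power of [s / n <= expR (s / n)]. *)
Lemma expR_ge_expn (n : nat) (s : R) : 0 <= s -> s ^+ n <= n%:R ^+ n * expR s.
Proof.
move=> s0; case: n => [|n]; first by rewrite !expr0 mul1r -[leLHS]expR0 ler_expR.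
have n0 : 0 < n.+1%:R :> R by [].
have h : s / n.+1%:R <= expR (s / n.+1%:R).
  by apply: le_trans (expR_ge1Dx _); rewrite lerDr.
have : (s / n.+1%:R) ^+ n.+1 <= expR (s / n.+1%:R) ^+ n.+1.
  by rewrite lerXn2r ?nnegrE ?expR_ge0// divr_ge0.
rewrite -expRM_natl mulrCA divff ?mulr1 ?gt_eqF// expr_div_n ler_pdivrMr ?exprn_gt0//.
by rewrite [leRHS]mulrC.
Qed.

(** The previous bound at [t^-1] with exponent [m + n]. For [n = 0] it bounds [psi m] uniformly, for
    [n = 1] it gives the limit 0 at the origin. *)
Lemma psi_bound m (n : nat) (t : R) : (0 < t) ->
  psi m t <= (m + n)%:R ^+ (m + n) * t ^+ n.
Proof.
move=> t0; rewrite /psi t0.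
have h := @expR_ge_expn (m + n) t^-1 _.
rewrite exprD !exprVn in h.
have {h} h := h (ltac:(by rewrite invr_ge0 ltW)).
rewrite -ler_pdivrMr ?exprn_gt0// mulrAC expRN ler_pdivrMr ?expR_gt0//.
Qed.

Lemma psi_recr m t : t^-1 * psi m t = psi m.+1 t.
Proof.
rewrite /psi; case: ifPn => t0; last by rewrite mulr0.
by rewrite mulrA exprS invfM.
Qed.

Lemma cvg_psi0 m : psi m h @[h --> (0 : R)^'] --> (0 : R).
Proof.
apply: (@cvg_to_0_linear _ _ ((m + 1)%:R ^+ (m + 1)) 1) => // h _.
rewrite ger0_norm ?psi_ge0//.
have [h0|h0] := ltP 0 h; last by rewrite psi_le0// mulr_ge0// exprn_ge0.
by rewrite (le_trans (psi_bound m 1 h0))// expr1 gtr0_norm.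
Qed.

(** Only the origin is delicate: there the difference quotient of [psi m] is [psi m.+1] itself,
    which tends to 0. *)
Lemma is_derive_psi m t :
  is_derive (t : R) (1 : R) (psi m) (psi m.+2 t - m%:R * psi m.+1 t).
Proof.
have [t0|t0|->] := ltgtP t 0.
- rewrite !psi_le0 ?ltW// mulr0 subr0.
  apply: (@near_eq_is_derive _ R _ (cst 0)) => //.
  near=> z; rewrite psi_le0//= ltW//; near: z.
  exact: lt_nbhsl.
- set F := (fun s : R => s ^- m * expR (- s^-1)).
  apply: (@near_eq_is_derive _ R _ F).
    near=> z; rewrite /psi /F ifT//; near: z; exact: lt_nbhsr.
  have tn0 : t != 0 by rewrite gt_eqF.
  have dX : is_derive (t : R) (1 : R) (fun s : R => s ^- m)
      (- m%:R * t ^- m.+1).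
    have D : is_derive (t : R) (1 : R) (fun s : R => s ^+ m) (m%:R * t ^+ m.-1).
      elim: (m) => [|k IH].
        rewrite mul0r (_ : (fun s : R => s ^+ 0) = cst 1)//; exact: is_derive_cst.
      rewrite (_ : (fun s : R => _) = id * (fun s : R => s ^+ k)); last first.
        by apply/funext => z; rewrite exprS.
      have [D1 D2] := is_deriveM (@is_derive_id _ _ t 1) IH.
      apply: DeriveDef; [exact: D1|rewrite D2].
      rewrite /GRing.scale/=; case: (k) => [|l]; first by rewrite !expr0; ring.
      by rewrite -[l.+2]addn1 natrD/= exprS; ring.
    have tm0 : (fun s : R => s ^+ m) t != 0 by rewrite expf_neq0.
    have [D1 D2] := @is_deriveV R (fun s => s ^+ m) t _ 1 tm0 D.
    apply: DeriveDef; [exact: D1|rewrite D2].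
    rewrite /GRing.scale/=; case: (m) => [|k]; first by rewrite mul0r mulr0 oppr0 mul0r.
    have tk0 : t ^+ k != 0 by rewrite expf_neq0.
    by rewrite /= !exprS; field; rewrite tn0 tk0.
  have dE : is_derive (t : R) (1 : R) (fun s : R => expR (- s^-1)) (t ^- 2 * expR (- t^-1)).
    have dV : is_derive (t : R) (1 : R) (fun s : R => - s^-1) (t ^- 2).
      have [D1 D2] := is_deriveN (@is_deriveV R id t 1 1 tn0 (@is_derive_id _ _ _ _)).
      apply: DeriveDef; [exact: D1|rewrite [LHS]D2].
      by rewrite /GRing.scale/= mulr1 opprK.
    have [D1 D2] := @is_derive1_comp _ expR (fun s : R => - s^-1) t _ _
      (is_derive_expR (- t^-1)) dV.
    by apply: DeriveDef; [exact: D1|rewrite [LHS]D2 mulrC].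
  have [D1 D2] := is_deriveM dX dE.
  apply: DeriveDef; [exact: D1|rewrite [LHS]D2].
  rewrite /psi t0 /GRing.scale/=.
  by rewrite !exprS !invfM expr0 invr1; ring.
- rewrite !psi_le0// mulr0 subr0.
  have H : (fun h : R => h^-1 *: ((psi m \o shift 0) (h *: 1) - psi m 0)) @ 0^'
      --> (0 : R).
    rewrite (_ : (fun h => _) = psi m.+1); first exact: cvg_psi0.
    apply/funext => h; rewrite -psi_recr/= (psi_le0 _ (lexx 0)) subr0 addr0.
    by rewrite /GRing.scale/= mulr1.
  split; first by apply/cvg_ex; exists 0.
  exact: cvg_lim H.
Unshelve. all: by end_near. Qed.

Lemma continuous_psi m : continuous (psi m).
Proof.
move=> t; have [D _] := is_derive_psi m t.
by apply: differentiable_continuous; apply/derivable1_diffP.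
Qed.

End psi.

Section psi_smooth.
Context {R : realType} {d : nat}.
Implicit Types (f g : 'rV[R]_d -> R) (j : 'I_d).

Local Notation e_ j := (delta_mx ord0 j : 'rV[R]_d).

Lemma partial_psi m f j y : derivable f y (e_ j) ->
  partial j (fun z => psi m (f z)) y =
  (psi m.+2 (f y) - m%:R * psi m.+1 (f y)) * partial j f y.
Proof.
by move=> df; have [_] := is_derive_comp_R (is_derive_psi m (f y)) df.
Qed.

Lemma smooth_psi m f : smooth f -> smooth (fun y => psi m (f y)).
Proof.
move=> sf; apply/smooth_Csmooth => n; elim: n m => [|n IH] m.
  split => // y; have /smoothP[cf _ _] := sf.
  exact: (continuous_comp (cf y) (@continuous_psi _ m (f y))).
have /smoothP[cf df spf] := sf.
split; first by move=> y;
  exact: (continuous_comp (cf y) (@continuous_psi _ m (f y))).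
split=> [j y|j].
  by have [] := is_derive_comp_R (is_derive_psi m (f y)) (df j y).
rewrite (_ : partial j _ = fun y =>
   (psi m.+2 (f y) + - m%:R * psi m.+1 (f y)) * partial j f y).
  apply: CsmoothM; last by have /smooth_Csmooth := spf j; exact.
  apply: CsmoothD; first exact: IH.
  apply: CsmoothM; last exact: IH.
  by have /smooth_Csmooth := @smooth_cst R d (- m%:R); exact.
by apply/funext => y; rewrite partial_psi// mulNr.
Qed.

End psi_smooth.

(** * Euclidean balls, bumps and cut-off functions *)

Section euclidean_balls.
Context {R : realType} {d : nat}.
Implicit Types (x y : 'rV[R]_d) (r : R).

Local Notation e_ j := (delta_mx ord0 j : 'rV[R]_d).

(** The square avoids the root in [enorm]: balls become sublevel sets of a polynomial, which is
    smooth everywhere. *)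
Definition sqdist x y : R := \sum_j (y ord0 j - x ord0 j) ^+ 2.

Lemma sqdist_ge0 x y : 0 <= sqdist x y.
Proof. by apply: sumr_ge0 => j _; exact: sqr_ge0. Qed.

Lemma enorm_sqdist x y : enorm (y - x) = Num.sqrt (sqdist x y).
Proof. by congr Num.sqrt; apply: eq_bigr => j _; rewrite !mxE. Qed.

Lemma eballE x r : 0 < r -> eball x r = [set y | sqdist x y < r ^+ 2].
Proof.
move=> r0; apply/seteqP; split => y; rewrite /eball /= enorm_sqdist => h.
  by rewrite -(sqr_sqrtr (sqdist_ge0 x y)) ltrXn2r// ?sqrtr_ge0// ltW.
by rewrite -[ltRHS]gtr0_norm// -sqrtr_sqr ltr_sqrt// exprn_gt0.
Qed.

Definition cball x r : set 'rV[R]_d := [set y | sqdist x y <= r ^+ 2].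

Lemma coord_sqdist x y j : (y ord0 j - x ord0 j) ^+ 2 <= sqdist x y.
Proof.
rewrite /sqdist (bigD1 j)//= lerDl; apply: sumr_ge0 => i _; exact: sqr_ge0.
Qed.

Lemma coord_le_cball x y r j : 0 <= r -> cball x r y ->
  `|y ord0 j - x ord0 j| <= r.
Proof.
move=> r0 /(le_trans (coord_sqdist x y j)).
by rewrite -real_normK ?num_real// ler_pXn2r ?nnegrE.
Qed.

Lemma smooth_sqdist x : smooth (sqdist x).
Proof.
apply: smooth_sum => j.
rewrite (_ : (fun y => _) = fun y => (y ord0 j - x ord0 j) * (y ord0 j - x ord0 j)).
  by apply: smoothM; apply: smoothB; [exact: smooth_coord|exact: smooth_cst|
    exact: smooth_coord|exact: smooth_cst].
by apply/funext => y; rewrite expr2.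
Qed.

Lemma continuous_sqdist x : continuous (sqdist x).
Proof. by have /smoothP[] := smooth_sqdist x. Qed.

Lemma eball_open x r : open (eball x r).
Proof.
have [r0|r0] := ltP 0 r; last first.
  rewrite (_ : eball x r = set0); first exact: open0.
  apply/seteqP; split => // y; rewrite /eball/= enorm_sqdist => h.
  by have := lt_le_trans h r0; rewrite ltNge sqrtr_ge0.
rewrite eballE//; apply: (@open_comp _ _ (sqdist x) [set t | t < r ^+ 2]).
  by move=> y _; exact: continuous_sqdist.
exact: open_lt.
Qed.

Lemma cball_closed x r : closed (cball x r).
Proof.
apply: (@closed_comp _ _ (sqdist x) [set t | t <= r ^+ 2]).
  by move=> y _; exact: continuous_sqdist.
exact: closed_le.
Qed.

Lemma cball_compact x r : 0 <= r -> compact (cball x r).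
Proof.
move=> r0; apply: bounded_closed_compact; last exact: cball_closed.
exists (`|x| + r); split; first exact: num_real.
move=> M xM y yB; apply: (le_trans _ (ltW xM)).
rewrite -[leLHS]/(`|y|) -(subrK x y) (le_trans (ler_normD _ _))// addrC lerD2l.
rewrite [leLHS]/Num.norm/= mx_normrE; apply: bigmax_le => // -[i j] _.
by rewrite !mxE ord1; exact: coord_le_cball.
Qed.

Lemma subset_eball_cball x r : eball x r `<=` cball x r.
Proof.
have [r0|r0] := ltP 0 r; first by rewrite eballE// => y /ltW.
move=> y; rewrite /eball/= enorm_sqdist => h.
by have := lt_le_trans h r0; rewrite ltNge sqrtr_ge0.
Qed.

Lemma subset_cball_eball x r r' : 0 <= r < r' -> cball x r `<=` eball x r'.
Proof.
move=> /andP[r0 rr']; rewrite eballE ?(le_lt_trans r0)// => y /= h.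
by rewrite (le_lt_trans h)// ltrXn2r// (le_trans r0)// ltW.
Qed.

Lemma subset_eball x r r' : r <= r' -> eball x r `<=` eball x r'.
Proof. by move=> rr' y /lt_le_trans; exact. Qed.

Lemma dist_to_eball (D : set 'rV[R]_d) x r : (r%:E < dist_to D x)%E ->
  eball x r `&` D = set0.
Proof.
move=> rD; apply/seteqP; split => // y [yB Dy].
have : (dist_to D x <= (enorm (x - y))%:E)%E by apply: ereal_inf_lbound; exists y.
move=> /(lt_le_trans rD); rewrite lte_fin enorm_sqdist.
have -> : sqdist y x = sqdist x y.
  by apply: eq_bigr => j _; rewrite -sqrrN opprB.
by rewrite -enorm_sqdist ltNge ltW.
Qed.

Lemma partial_sqdist x j y : partial j (sqdist x) y = 2 * (y ord0 j - x ord0 j).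
Proof.
have H i : is_derive y (e_ j) (fun y : 'rV[R]_d => (y ord0 i - x ord0 i) ^+ 2)
   (2 * (y ord0 i - x ord0 i) * (i == j)%:R).
  have D : is_derive y (e_ j) (fun y : 'rV[R]_d => y ord0 i - x ord0 i) (i == j)%:R.
    have [D1 D2] := is_deriveB (partial_coord i j y) (is_derive_cst (x ord0 i) y (e_ j)).
    by apply: DeriveDef; [exact: D1|rewrite D2 subr0].
  have [D1 D2] := is_deriveM D D.
  have E : (fun y : 'rV[R]_d => (y ord0 i - x ord0 i) ^+ 2) =
    (fun y : 'rV[R]_d => y ord0 i - x ord0 i) * (fun y : 'rV[R]_d => y ord0 i - x ord0 i).
    by apply/funext => z; rewrite expr2.
  rewrite E; apply: DeriveDef; first exact: D1.
  by rewrite D2 /GRing.scale/=; ring.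
have [_] := is_derive_sum H.
rewrite /partial (_ : sqdist x = \sum_(i < d) (fun y : 'rV[R]_d => (y ord0 i - x ord0 i) ^+ 2)).
  move=> ->; rewrite (bigD1 j)//= eqxx mulr1 big1 ?addr0// => i ij.
  by rewrite (negbTE ij) mulr0.
by apply/funext => z; rewrite fct_sumE.
Qed.

Definition bump x r y : R := psi 0 (r ^+ 2 - sqdist x y).

Lemma smooth_bump x r : smooth (bump x r).
Proof.
by apply: smooth_psi; apply: smoothB; [exact: smooth_cst|exact: smooth_sqdist].
Qed.

Lemma bump_ge0 x r y : 0 <= bump x r y. Proof. exact: psi_ge0. Qed.

Lemma bump_gt0 x r y : 0 < r -> (0 < bump x r y) = (sqdist x y < r ^+ 2).
Proof.
move=> r0; have [h|h] := ltP (sqdist x y); first by rewrite psi_gt0// subr_gt0.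
by rewrite /bump psi_le0 ?ltxx// subr_le0.
Qed.

(** Affine in the squared distance, with value 1 on the sphere of radius [r] and 0 on that of radius
    [r']. *)
Definition cutoff_arg x r r' y : R := (r' ^+ 2 - sqdist x y) / (r' ^+ 2 - r ^+ 2).

(** The usual smooth step [f(t) / (f(t) + f(1 - t))] with [f(t) = exp(-1/t)]. *)
Definition cutoff x r r' y : R :=
  psi 0 (cutoff_arg x r r' y) *
  (psi 0 (cutoff_arg x r r' y) + psi 0 (1 - cutoff_arg x r r' y))^-1.

(** One of [t] and [1 - t] is at least 1/2. The lower bound is uniform, so the denominator of
    [cutoff] costs only a constant in the estimate of its gradient. *)
Lemma psi_half_sum (t : R) : expR (- 2) <= psi 0 t + psi 0 (1 - t).
Proof.
have H (u : R) : 2^-1 <= u -> expR (- 2) <= psi 0 u.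
  move=> hu; have u0 : 0 < u by rewrite (lt_le_trans _ hu)// invr_gt0.
  rewrite /psi u0 expr0 invr1 mul1r ler_expR lerN2.
  by rewrite -(invrK 2) lef_pV2 ?posrE.
have [t2|t2] := leP 2^-1 t.
  by rewrite (le_trans (H _ t2))// lerDl psi_ge0.
have /H : 2^-1 <= 1 - t by rewrite lerBrDr -lerBrDl {1}(splitr 1) div1r addrK ltW.
by move/le_trans; apply; rewrite lerDr psi_ge0.
Qed.

Lemma psi_sum_gt0 (t : R) : 0 < psi 0 t + psi 0 (1 - t).
Proof. by rewrite (lt_le_trans _ (psi_half_sum t))// expR_gt0. Qed.

Lemma smooth_cutoff_arg x r r' : smooth (cutoff_arg x r r').
Proof.
apply: smoothM; last exact: smooth_cst.
by apply: smoothB; [exact: smooth_cst|exact: smooth_sqdist].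
Qed.

Lemma smooth_cutoff x r r' : smooth (cutoff x r r').
Proof.
have sp := smooth_cutoff_arg x r r'.
apply: smoothM; first exact: smooth_psi.
apply: smoothV; first by move=> y; rewrite gt_eqF// psi_sum_gt0.
apply: smoothD; first exact: smooth_psi.
by apply: smooth_psi; apply: smoothB => //; exact: smooth_cst.
Qed.

Lemma cutoff_ge0 x r r' y : 0 <= cutoff x r r' y.
Proof. by rewrite mulr_ge0 ?psi_ge0// invr_ge0 ltW// psi_sum_gt0. Qed.

Lemma cutoff_le1 x r r' y : cutoff x r r' y <= 1.
Proof. by rewrite ler_pdivrMr ?psi_sum_gt0// mul1r lerDl psi_ge0. Qed.

Section cutoff_lt.
Variables (x : 'rV[R]_d) (r r' : R).
Hypotheses (r0 : 0 < r) (rr' : r < r').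

Let sq_gt0 : 0 < r' ^+ 2 - r ^+ 2.
Proof. by rewrite subr_gt0 ltrXn2r// ltW// (lt_trans r0). Qed.

Lemma cutoff_eq1 y : eball x r y -> cutoff x r r' y = 1.
Proof.
rewrite eballE//= => /ltW yr.
have p1 : 1 <= cutoff_arg x r r' y.
  by rewrite ler_pdivlMr// mul1r lerD2l lerN2.
rewrite /cutoff (@psi_le0 _ 0 (1 - _)) ?subr_le0// addr0 divff// gt_eqF//.
by rewrite psi_gt0// (lt_le_trans _ p1).
Qed.

Lemma cutoff_arg_le0 y : r' ^+ 2 <= sqdist x y -> cutoff_arg x r r' y <= 0.
Proof.
by move=> h; rewrite /cutoff_arg pmulr_lle0 ?invr_gt0// subr_le0.
Qed.

Lemma cutoff_eq0 y : r' ^+ 2 <= sqdist x y -> cutoff x r r' y = 0.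
Proof. by move=> /cutoff_arg_le0 h; rewrite /cutoff psi_le0// mul0r. Qed.

(** The quotient rule, with [psi 2] as the derivative of [psi 0]; the two terms have the same sign
    because the arguments [t] and [1 - t] vary in opposite directions. *)
Lemma partial_cutoff j y : partial j (cutoff x r r') y =
  let t := cutoff_arg x r r' y in
  (psi 0 (1 - t) * psi 2 t + psi 0 t * psi 2 (1 - t)) /
  (psi 0 t + psi 0 (1 - t)) ^+ 2 *
  (- (2 * (y ord0 j - x ord0 j)) / (r' ^+ 2 - r ^+ 2)).
Proof.
have sp := smooth_cutoff_arg x r r'.
have sq : smooth (fun y => 1 - cutoff_arg x r r' y).
  by apply: smoothB => //; exact: smooth_cst.
have /smoothP[_ dp _] := sp; have /smoothP[_ dq _] := sq.
have /smoothP[_ da _] := smooth_psi 0 sp; have /smoothP[_ db _] := smooth_psi 0 sq.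
have s0 z : psi 0 (cutoff_arg x r r' z) + psi 0 (1 - cutoff_arg x r r' z) != 0.
  by rewrite gt_eqF// psi_sum_gt0.
have ds : derivable (fun z => psi 0 (cutoff_arg x r r' z) +
    psi 0 (1 - cutoff_arg x r r' z)) y (e_ j) by exact: derivableD.
have dV : derivable (fun z => (psi 0 (cutoff_arg x r r' z) +
    psi 0 (1 - cutoff_arg x r r' z))^-1) y (e_ j) by exact: derivableV.
rewrite (partialM (da j y) dV) (partialV (s0 y) ds).
rewrite (partialD (da j y) (db j y)) (partial_psi 0 (dp j y)).
rewrite (partial_psi 0 (dq j y)) !mul0r !subr0.
have dsq : derivable (sqdist x) y (e_ j).
  by have /smoothP[_ D _] := smooth_sqdist x; have := D j y.
have dc (c : R) : derivable (fun _ : 'rV[R]_d => c) y (e_ j) by exact: derivable_cst.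
have dcB (c : R) : derivable (fun z => c - sqdist x z) y (e_ j) by have := derivableB (dc c) dsq.
have Ep : partial j (cutoff_arg x r r') y =
    - (2 * (y ord0 j - x ord0 j)) / (r' ^+ 2 - r ^+ 2).
  rewrite (partialM (dcB _) (dc _)).
  rewrite partial_cst mulr0 add0r.
  have -> : partial j (fun z => r' ^+ 2 - sqdist x z) y =
     partial j (fun=> r' ^+ 2) y - partial j (sqdist x) y.
    by rewrite /partial (deriveB (dc _) dsq).
  by rewrite partial_cst sub0r partial_sqdist mulrC.
have -> : partial j (fun z => 1 - cutoff_arg x r r' z) y =
     - partial j (cutoff_arg x r r') y.
  by rewrite /partial (deriveB (dc _) (dp j y)) derive_cst sub0r.
rewrite Ep /=.
move: (s0 y); set a := psi 0 _; set b := psi 0 _ => ab0.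
set A := psi 2 _; set B := psi 2 _; set p := (- _ / _).
by field.
Qed.

Lemma partial_cutoff_eq0 j y : r' ^+ 2 <= sqdist x y ->
  partial j (cutoff x r r') y = 0.
Proof.
move=> /cutoff_arg_le0 h; rewrite partial_cutoff /= (psi_le0 2 h) (psi_le0 0 h).
by rewrite mulr0 mul0r add0r !mul0r.
Qed.

(** The slope of the step in its argument is at most [8 * expR 2], by [psi 2 <= 4] and
    [psi_half_sum]; the argument itself varies at rate at most [2 / (r' - r)] inside the ball of
    radius [r']. *)
Definition cutoff_const : R := 16 * expR 2.

Lemma partial_cutoff_bound j y :
  `|partial j (cutoff x r r') y| <= cutoff_const / (r' - r).
Proof.
have r'0 := lt_trans r0 rr'.
have c0 : 0 <= cutoff_const / (r' - r).
  by rewrite divr_ge0 ?subr_ge0 ?(ltW rr')// mulr_ge0// expR_ge0.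
have [h|/ltW h] := leP (r' ^+ 2) (sqdist x y).
  by rewrite partial_cutoff_eq0// normr0.
rewrite partial_cutoff /=; set t := cutoff_arg _ _ _ _.
have psi2 (m : R) : 0 <= psi 2 m <= 4.
  rewrite psi_ge0/=; have [m0|m0] := ltP 0 m; last by rewrite psi_le0.
  by have := psi_bound 2 0 m0; rewrite expr0 mulr1 addn0 -natrX.
rewrite normrM.
have -> : cutoff_const / (r' - r) = (8 * expR 2) * (2 / (r' - r)).
  by rewrite /cutoff_const; ring.
apply: ler_pM => //.
- have s0 := psi_sum_gt0 t; have s1 := psi_half_sum t.
  have a0 := @psi_ge0 R 0 t; have b0 := @psi_ge0 R 0 (1 - t).
  have /andP[A0 A4] := psi2 t; have /andP[B0 B4] := psi2 (1 - t).
  rewrite ger0_norm; last first.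
    by apply: divr_ge0; [apply: addr_ge0; apply: mulr_ge0|apply: exprn_ge0; exact: ltW].
  rewrite ler_pdivrMr ?exprn_gt0//.
  have E : 1 <= expR 2 * (psi 0 t + psi 0 (1 - t)).
    by rewrite -ler_pdivrMl ?expR_gt0// mulr1 -expRN.
  move: E s0 a0 b0 A0 A4 B0 B4 {s1}.
  set a := psi 0 t; set b := psi 0 (1 - t); set A := psi 2 t; set B := psi 2 (1 - t).
  set E := expR 2 => E1 s0 a0 b0 A0 A4 B0 B4.
  apply: (@le_trans _ _ (8 * (a + b))); first by nra.
  have -> : 8 * E * (a + b) ^+ 2 = (8 * (a + b)) * (E * (a + b)) by ring.
  by rewrite ler_peMr// mulr_ge0// ltW.
- rewrite normrM normrN normrM (ger0_norm (ler0n _ 2)) normfV (gtr0_norm sq_gt0).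
  rewrite -!mulrA ler_pM2l// ler_pdivrMr//.
  have hj := coord_le_cball j (ltW r'0) h.
  rewrite subr_sqr mulrA mulVf ?mul1r ?subr_eq0 ?gt_eqF//.
  by rewrite (le_trans hj)// lerDl ltW.
Qed.

Lemma sqr_partial_cutoff_le j y :
  partial j (cutoff x r r') y ^+ 2 <= (cutoff_const / (r' - r)) ^+ 2.
Proof.
rewrite -(real_normK (num_real (partial j _ y))).
have kb := partial_cutoff_bound j y.
by rewrite lerXn2r ?nnegrE// (le_trans _ kb).
Qed.

Lemma supp_cutoff : [set y | cutoff x r r' y != 0] `<=` cball x r'.
Proof.
move=> y /=; apply: contraNP; rewrite /cball/= => /negP; rewrite -ltNge => /ltW h.
by rewrite cutoff_eq0.
Qed.

End cutoff_lt.

End euclidean_balls.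

(** * Lebesgue measure on row vectors *)

Section rV_measure.
Context {R : realType}.

Lemma measurable_closed_rV {n} (K : set 'rV[R]_n) : closed K -> measurable K.
Proof.
move=> cK; rewrite -(setCK K); apply: measurableC.
by apply: open_measurable_rV; rewrite openC.
Qed.

Lemma compact_closed_rV {n} (K : set 'rV[R]_n) : compact K -> closed K.
Proof. by apply: compact_closed; exact: norm_hausdorff. Qed.

Lemma measurable_compact_rV {n} (K : set 'rV[R]_n) : compact K -> measurable K.
Proof. by move=> /compact_closed_rV; exact: measurable_closed_rV. Qed.

Lemma continuous_measurable_rV {n} (f : 'rV[R]_n -> R) : continuous f ->
  measurable_fun setT f.
Proof.
move=> cf; apply: (measurability _ (RGenOpens.measurableE R)) => // _ [_ [a [b ->]] <-].
rewrite setTI; apply: open_measurable_rV; apply: open_comp.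
  by move=> v _; exact: cf.
exact: interval_open.
Qed.

(** Cubes rather than balls: under [cons_rV] a cube is an interval times a cube, which suits
    induction on the dimension. *)
Definition cube n (M : R) : set 'rV[R]_n := [set y | forall j, `|y ord0 j| <= M].
Arguments cube n M : clear implicits.

Lemma cube_closed n M : closed (cube n M).
Proof.
rewrite (_ : cube n M = \bigcap_(j in [set: 'I_n])
    ((fun y : 'rV[R]_n => `|y ord0 j|) @^-1` [set t | t <= M])); last first.
  by apply/seteqP; split => y /= h j; [move=> _; exact: h|exact: h].
apply: closed_bigI => j _; apply: closed_comp; last exact: closed_le.
move=> y _; apply: (@continuous_comp _ _ _ (fun y : 'rV[R]_n => y ord0 j)).
  exact: coord_continuous.
exact: norm_continuous.
Qed.

Lemma compact_sub_cube n (K : set 'rV[R]_n) : compact K -> exists M, 0 <= M /\ K `<=` cube n M.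
Proof.
move=> /compact_bounded[M [_ MK]].
exists (`|M| + 1); split; first by rewrite addr_ge0.
move=> y Ky j; have := MK (`|M| + 1) _ y Ky.
rewrite (le_lt_trans (ler_norm M)) ?ltrDl// => /(_ isT).
apply: le_trans; rewrite [leRHS]/Num.norm/= mx_normrE.
exact: (@le_bigmax _ _ _ 0 (fun i : 'I_1 * 'I_n => `|y i.1 i.2|) (ord0, j)).
Qed.

Lemma cube_preimage n M : @cons_rV R n @^-1` cube n.+1 M = `[- M, M]%classic `*` cube n M.
Proof.
apply/seteqP; split => -[a v] /=.
  move=> h; split.
    by have := h ord0; rewrite mxE unlift_none /= in_itv/= ler_norml.
  by move=> j; have := h (lift ord0 j); rewrite mxE liftK.
case; rewrite in_itv/= -ler_norml => ha hv j.
by rewrite mxE; case: unliftP => [i _|_] /=; [exact: hv|].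
Qed.

Lemma cube_fin n M : (lebesgue_rV R n (cube n M) < +oo)%E.
Proof.
elim: n => [|n IH].
  by rewrite /= diracE; case: (_ \in _); rewrite ltry.
rewrite [X in (X < _)%E](_ : _ =
    (lebesgue_measure \x lebesgue_rV R n)%E (@cons_rV R n @^-1` cube n.+1 M))//.
rewrite cube_preimage product_measure1E//; last first.
  by apply: measurable_closed_rV; exact: cube_closed.
have fI : (@lebesgue_measure R `[(- M)%R, M%R]%classic < +oo)%E.
  by rewrite lebesgue_measure_itv/=; case: ifP => _; rewrite -?EFinD ltry.
apply: lte_mul_pinfty => //; rewrite ge0_fin_numE//; exact: fI.
Qed.

Lemma compact_fin n (K : set 'rV[R]_n) : compact K -> (lebesgue_rV R n K < +oo)%E.
Proof.
move=> cK; have [M [_ KM]] := compact_sub_cube cK.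
apply: le_lt_trans (cube_fin n M); apply: le_measure => //; rewrite inE.
  exact: measurable_compact_rV.
by apply: measurable_closed_rV; exact: cube_closed.
Qed.

Lemma cube_compact n M : compact (cube n M).
Proof.
apply: bounded_closed_compact; last exact: cube_closed.
exists `|M|; split; first exact: num_real.
move=> N MN y yM /=; rewrite [leLHS]/Num.norm/= mx_normrE.
have M0 : 0 <= N by rewrite ltW// (le_lt_trans _ MN).
apply: bigmax_le => // -[i j] _; rewrite ord1 (le_trans (yM j))//.
by rewrite ltW// (le_lt_trans _ MN)// ler_norm.
Qed.

Lemma integrable_continuous_vanish n (K : set 'rV[R]_n) (f : 'rV[R]_n -> R) :
  compact K -> continuous f -> (forall y, ~ K y -> f y = 0) ->
  (lebesgue_rV R n).-integrable setT (EFin \o f).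
Proof.
move=> cK cf f0.
rewrite (_ : EFin \o f = (EFin \o f) \_ K); last first.
  apply/funext => y; rewrite patchE; case: ifPn => //.
  by rewrite notin_setE /= => /f0 ->.
have mK := measurable_compact_rV cK.
apply/(integrable_mkcond _ mK).
apply: measurable_bounded_integrable => //.
- exact: compact_fin.
- by apply: measurable_funTS; exact: continuous_measurable_rV.
- have : compact (f @` K) by apply: continuous_compact => //; exact: continuous_subspaceT.
  move=> /compact_bounded; case=> M [Mr MP]; exists M; split => // N MN y Ky.
  by apply: MP => //; exists y.
Qed.

Lemma derive_int_R (F f : R -> R) (M : R) : (forall x : R, is_derive x (1 : R) F (f x)) ->
  continuous f -> 0 <= M -> (forall x, M < `|x| -> F x = 0) ->
  (forall x, M < `|x| -> f x = 0) ->
  (\int[lebesgue_measure]_x (f x)%:E)%E = 0%E.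
Proof.
move=> dF cf M0 F0 f0.
have cF : continuous F.
  move=> x; apply: differentiable_continuous; apply/derivable1_diffP.
  by have [] := dF x.
(* The added 1 puts the end points strictly outside the support and keeps the interval nondegenerate
   for [M = 0]. *)
rewrite (_ : (fun x => (f x)%:E) = (EFin \o f) \_ `[- (M + 1), M + 1]); last first.
  apply/funext => x; rewrite patchE; case: ifPn => //.
  rewrite notin_setE /= in_itv/= -ler_norml => /negP; rewrite -ltNge => h.
  by rewrite f0// (lt_trans _ h)// ltrDl.
rewrite -integral_mkcond.
rewrite (@continuous_FTC2 _ f F).
- have h : M < `|M + 1| by rewrite ger0_norm ?ltrDl// addr_ge0.
  by rewrite !F0 ?normrN// subee.
- by rewrite -subr_gt0 opprK addr_gt0// ltr_wpDl.
- exact: continuous_subspaceT.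
- split.
  + by move=> x _; have [] := dF x.
  + by apply: cvg_at_right_filter; exact: cF.
  + by apply: cvg_at_left_filter; exact: cF.
- by move=> x _; rewrite derive1E; have [_ ->] := dF x.
Qed.

Lemma cons_rV_line0 n (x h : R) (v : 'rV[R]_n) :
  cons_rV (h + x, v) = h *: delta_mx ord0 ord0 + cons_rV (x, v).
Proof.
apply/rowP => j; rewrite !mxE/=.
case: unliftP => [i ->|->] /=; first by rewrite mulr0 add0r.
by rewrite mulr1.
Qed.

Lemma cons_rV_lineS n (x h : R) (v : 'rV[R]_n) (j : 'I_n) :
  cons_rV (x, h *: delta_mx ord0 j + v) =
  h *: delta_mx ord0 (lift ord0 j) + cons_rV (x, v).
Proof.
apply/rowP => i; rewrite !mxE/=.
case: unliftP => [k ->|->] /=; first by rewrite !mxE (inj_eq lift_inj).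
by rewrite mulr0 add0r.
Qed.

Lemma partial_cons_rV n (f : 'rV[R]_n.+1 -> R) (x : R) (v : 'rV[R]_n) (k : 'I_n) :
  partial k (fun v => f (cons_rV (x, v))) v = partial (lift ord0 k) f (cons_rV (x, v)).
Proof.
rewrite /partial !derive_line; f_equal; apply/funext => h.
by rewrite cons_rV_lineS.
Qed.

Lemma derivable_cons_rV n (f : 'rV[R]_n.+1 -> R) (x : R) (v : 'rV[R]_n) (k : 'I_n) :
  derivable f (cons_rV (x, v)) (delta_mx ord0 (lift ord0 k)) ->
  derivable (fun v => f (cons_rV (x, v))) v (delta_mx ord0 k).
Proof.
rewrite /derivable.
set F := (fun h : R => _); set G := (fun h : R => _).
suff -> : F = G by [].
by apply/funext => h; rewrite /F /G/= cons_rV_lineS.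
Qed.

Lemma is_derive_cons_rV n (f : 'rV[R]_n.+1 -> R) (x : R) (v : 'rV[R]_n) :
  derivable f (cons_rV (x, v)) (delta_mx ord0 ord0) ->
  is_derive (x : R) (1 : R) (fun x : R => f (cons_rV (x, v)))
    (partial ord0 f (cons_rV (x, v))).
Proof.
move=> df; suff E : (fun h : R => h^-1 *: (((fun x : R => f (cons_rV (x, v))) \o shift x)
      (h *: (1 : R)) - f (cons_rV (x, v)))) =
    (fun h : R => h^-1 *: ((f \o shift (cons_rV (x, v))) (h *: delta_mx ord0 ord0)
      - f (cons_rV (x, v)))).
  split; first by rewrite /derivable E.
  by rewrite /partial /derive E.
by apply/funext => h; rewrite /= -cons_rV_line0 /GRing.scale/= mulr1.
Qed.

Lemma continuous_cons0 n (v : 'rV[R]_n) : continuous (fun x : R => cons_rV (x, v)).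
Proof.
move=> x s /= /nbhs_ballP[e e0 es].
apply/nbhs_ballP; exists e => // y xy; apply: es; split => // i j.
rewrite !mxE; case: unliftP => [k _|_] /=; [exact: ballxx|exact: xy].
Qed.

Lemma continuous_consS n (x : R) : continuous (fun v : 'rV[R]_n => cons_rV (x, v)).
Proof.
move=> v s /= /nbhs_ballP[e e0 es].
apply/nbhs_ballP; exists e => // w [_ vw]; apply: es; split => // i j.
rewrite ord1 !mxE; case: unliftP => [k _|_] /=; [exact: vw|exact: ballxx].
Qed.

Lemma partial_vanish n (f : 'rV[R]_n -> R) (K : set 'rV[R]_n) j :
  closed K -> (forall y, ~ K y -> f y = 0) -> forall y, ~ K y -> partial j f y = 0.
Proof.
move=> cK f0 y Ky; rewrite /partial -(derive_cst (0 : R) y (delta_mx ord0 j)).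
apply: near_eq_derive.
have : nbhs y (~` K) by apply: open_nbhs_nbhs; split => //; rewrite openC.
by apply: filterS => z /f0.
Qed.

(** Induction on the dimension with Fubini's theorem. If [j] is the first coordinate, integrating
    along it first gives 0 by the fundamental theorem of calculus; otherwise each slice at a fixed
    first coordinate falls under the induction hypothesis. *)
Lemma integral_partial_eq0 n (f : 'rV[R]_n -> R) (j : 'I_n) (M : R) :
  0 <= M -> continuous f -> (forall y, derivable f y (delta_mx ord0 j)) ->
  continuous (partial j f) -> (forall y, ~ cube n M y -> f y = 0) ->
  (\int[lebesgue_rV R n]_y (partial j f y)%:E)%E = 0%E.
Proof.
elim: n f j => [|n IH] f j M0 cf df cdf f0; first by case: j df cdf => [[]].
have p0 := @partial_vanish _ f _ j (@cube_closed n.+1 M) f0.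
have ip := integrable_continuous_vanish (@cube_compact n.+1 M) cdf p0.
have mp : measurable_fun setT (EFin \o partial j f).
  by apply/measurable_EFinP; exact: continuous_measurable_rV.
have mc := @measurable_cons_rV R n.
(* By definition the measure is this push-forward; naming it opens the way to the change of
   variables. *)
rewrite (@eq_measure_integral _ _ _ setT
  (pushforward (lebesgue_measure \x lebesgue_rV R n)%E (@cons_rV R n)))//.
have ipc : (lebesgue_measure \x lebesgue_rV R n)%E.-integrable setT
    ((EFin \o partial j f) \o @cons_rV R n).
  have /integrableP[_ ip2] := ip.
  apply/integrableP; split; first exact: measurableT_comp.
  rewrite (@eq_measure_integral _ _ _ setT
    (pushforward (lebesgue_measure \x lebesgue_rV R n)%E (@cons_rV R n))) in ip2 => //.
  rewrite ge0_integral_pushforward// in ip2.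
  exact: measurableT_comp.
rewrite integral_pushforward// preimage_setT.
case: (unliftP ord0 j) => [k|] Ej.
- rewrite -(integral12_prod_meas1 ipc).
  apply: integral0_eq => x _ /=.
  rewrite -[RHS](IH (fun v => f (cons_rV (x, v))) k M0).
  + apply: eq_integral => v _; congr EFin.
    by rewrite partial_cons_rV Ej.
  + by move=> v; apply: continuous_comp; [exact: continuous_consS|exact: cf].
  + by move=> v; apply: derivable_cons_rV; rewrite -Ej.
  + rewrite (_ : partial k _ = (fun v => partial j f (cons_rV (x, v)))).
      by move=> v; apply: continuous_comp; [exact: continuous_consS|exact: cdf].
    apply/funext => v.
    by rewrite partial_cons_rV Ej.
  + move=> v vM; apply: f0 => h; apply: vM => i.
    by have := h (lift ord0 i); rewrite mxE liftK.
- rewrite -(integral21_prod_meas1 ipc).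
  apply: integral0_eq => v _ /=.
  apply: (@derive_int_R (fun x => f (cons_rV (x, v))) _ M) => //.
  + by move=> x; rewrite Ej; apply: is_derive_cons_rV; rewrite -Ej.
  + by move=> x; apply: continuous_comp; [exact: continuous_cons0|exact: cdf].
  + move=> x xM; apply: f0 => /(_ ord0); rewrite mxE unlift_none /=.
    by rewrite leNgt xM.
  + move=> x xM; apply: p0 => /(_ ord0); rewrite mxE unlift_none /=.
    by rewrite leNgt xM.
Qed.

End rV_measure.

(** * Test functions and weak gradients *)

Section test_functions.
Context {R : realType} {d : nat}.
Implicit Types (U K : set 'rV[R]_d) (f h phi : 'rV[R]_d -> R).

Local Notation mu := (lebesgue_rV R d).
Local Notation e_ j := (delta_mx ord0 j : 'rV[R]_d).

Definition supp phi : set 'rV[R]_d := closure [set y | phi y != 0].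

(* [rtest], [lint], [wgrad] and [HD] (with its explicit gradient) are the
   real-valued counterparts of [test_function], [locally_integrable_on],
   [weak_gradient] and [H1_]. *)
Definition rtest U phi : Prop :=
  [/\ smooth phi, compact (supp phi) & supp phi `<=` U].

Definition lint U f : Prop := measurable_fun U f /\
  forall K, compact K -> K `<=` U -> (\int[mu]_(y in K) `|f y|%:E < +oo)%E.

Lemma supp_out phi y : ~ supp phi y -> phi y = 0.
Proof.
by move=> h; apply/eqP; apply: contrapT => /negP h'; apply: h; exact: subset_closure.
Qed.

Lemma supp_sub phi K : closed K -> (forall y, ~ K y -> phi y = 0) -> supp phi `<=` K.
Proof.
move=> /closure_id KE h; rewrite [X in _ `<=` X]KE; apply: closure_subset => y /=.
by apply: contraNP => /h ->.
Qed.

Lemma rtest_supp U phi K : compact K -> K `<=` U -> smooth phi ->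
  (forall y, ~ K y -> phi y = 0) -> rtest U phi.
Proof.
move=> cK KU sphi h; have sK := supp_sub (compact_closed_rV cK) h.
split => //; last exact: subset_trans KU.
apply: subclosed_compact cK sK; exact: closed_closure.
Qed.

Lemma rtest_cutoff x (r r' s : R) : 0 < r -> r < r' -> r' < s ->
  rtest (eball x s) (cutoff x r r').
Proof.
move=> r0 rr' r's; have r'0 : 0 <= r' by rewrite ltW// (lt_trans r0).
apply: (rtest_supp (K := cball x r')).
- exact: cball_compact.
- by apply: subset_cball_eball; rewrite r'0.
- exact: smooth_cutoff.
- by move=> y yK; apply: contrapT => /eqP e0; apply: yK; exact: (supp_cutoff r0 rr').
Qed.

Lemma rtest_continuous U phi : rtest U phi -> continuous phi.
Proof. by move=> [/smoothP[]]. Qed.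

Lemma rtest_partial U phi j : rtest U phi -> rtest U (partial j phi).
Proof.
move=> [sphi cphi sU]; apply: (@rtest_supp _ _ (supp phi)) => //.
  by have /smoothP[_ _] := sphi; exact.
by apply: partial_vanish; [exact: closed_closure|exact: supp_out].
Qed.

Lemma rtestMl U phi f : smooth f -> rtest U phi -> rtest U (fun y => f y * phi y).
Proof.
move=> sf [sphi cphi sU]; apply: (@rtest_supp _ _ (supp phi)) => //.
  exact: smoothM.
by move=> y /supp_out ->; rewrite mulr0.
Qed.

Lemma rtest_bounded U phi : rtest U phi -> exists M, forall y, `|phi y| <= M.
Proof.
move=> tphi; have [_ cphi _] := tphi.
have : compact (phi @` supp phi).
  by apply: continuous_compact => //; apply: continuous_subspaceT;
    exact: rtest_continuous tphi.
move=> /compact_bounded; case=> M [_ MP]; exists (`|M| + 1) => y.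
have M1 : M < `|M| + 1 by rewrite (le_lt_trans (ler_norm M))// ltrDl.
have [Ky|Ky] := pselect (supp phi y); first by apply: MP => //; exists y.
by rewrite supp_out// normr0 addr_ge0.
Qed.

Lemma integral_vanish U K (f : 'rV[R]_d -> \bar R) : K `<=` U ->
  (forall y, U y -> ~ K y -> f y = 0%E) ->
  (\int[mu]_(y in U) f y = \int[mu]_(y in K) f y)%E.
Proof.
move=> KU f0; rewrite integral_mkcond [RHS]integral_mkcond; congr integral.
apply/funext => y; rewrite !patchE; case: ifPn => yU.
  by case: ifPn => // yK; apply: f0; [exact: set_mem|apply: contraNnot yK => /mem_set].
case: ifPn => // yK; exfalso; move/negP : yU; apply; apply/mem_set.
by apply: KU; exact: set_mem.
Qed.

Lemma integrable_vanish U K (f : 'rV[R]_d -> \bar R) : measurable U ->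
  measurable K -> K `<=` U -> (forall y, U y -> ~ K y -> f y = 0%E) ->
  mu.-integrable K f -> mu.-integrable U f.
Proof.
move=> mU mK KU f0 iK; apply/(integrable_mkcond f mU).
move/(integrable_mkcond f mK) : iK.
rewrite (_ : f \_ U = f \_ K)//.
apply/funext => y; rewrite !patchE; case: ifPn => yU.
  by case: ifPn => // yK; apply: f0; [exact: set_mem|apply: contraNnot yK => /mem_set].
case: ifPn => // yK; exfalso; move/negP : yU; apply; apply/mem_set.
by apply: KU; exact: set_mem.
Qed.

Lemma lint_integrable_compact U K f : measurable U -> lint U f -> compact K -> K `<=` U ->
  mu.-integrable K (EFin \o f).
Proof.
move=> mU [mf fK] cK KU; apply/integrableP; split; last exact: fK.
by apply/measurable_EFinP; apply: measurable_funS mf.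
Qed.

Lemma lintM_integrable U f phi : measurable U -> lint U f -> rtest U phi ->
  mu.-integrable U (fun y => (f y * phi y)%:E).
Proof.
move=> mU lf tphi; have [_ cphi sU] := tphi.
have mK := measurable_compact_rV cphi.
apply: (integrable_vanish mU mK sU).
  by move=> y _ /supp_out ->; rewrite mulr0.
have fi := lint_integrable_compact mU lf cphi sU.
have := @integrableMl _ _ _ mu _ mK _ phi fi.
apply.
  apply: measurable_funTS; apply: continuous_measurable_rV; exact: rtest_continuous tphi.
have [M MP] := rtest_bounded tphi.
exists M; split; first exact: num_real.
by move=> N MN y _; exact: le_trans (MP y) (ltW MN).
Qed.

(** The integrand is the derivative of [f * phi], whose compact support lies in [U]; so the domain
    can be shrunk to the support and then enlarged to the whole space. *)
Lemma integral_partialM_eq0 U f phi j : smooth f -> rtest U phi ->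
  (\int[mu]_(y in U) (f y * partial j phi y + phi y * partial j f y)%:E = 0)%E.
Proof.
move=> sf tphi; have [sphi cphi sU] := tphi.
have tfp : rtest U (fun y => f y * phi y) by exact: rtestMl.
have [/smoothP[cfp dfp sdfp] cK KU] := tfp.
have /smoothP[cdfp _ _] := sdfp j.
have [M [M0 KM]] := compact_sub_cube cK.
have /smoothP[_ df _] := sf; have /smoothP[_ dphi _] := sphi.
have E y : f y * partial j phi y + phi y * partial j f y =
    partial j (fun y => f y * phi y) y by rewrite partialM.
under eq_integral do rewrite E.
rewrite (integral_vanish KU); last first.
  move=> y _ Ky; congr EFin; apply: (@partial_vanish _ _ _ (supp (fun y => f y * phi y))) => //.
    exact: closed_closure.
  exact: supp_out.
rewrite -(@integral_vanish setT) => //.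
  apply: (integral_partial_eq0 M0) => //.
  by move=> y h; apply: (supp_out (phi := fun y => f y * phi y)) => /KM.
move=> y _ Ky; congr EFin; apply: (@partial_vanish _ _ _ (supp (fun y => f y * phi y))) => //.
  exact: closed_closure.
exact: supp_out.
Qed.

End test_functions.

(** * A countable base of balls and smooth approximations of indicators *)

Section rational_balls.
Context {R : realType} {d : nat}.

Definition rball_center (i : 'rV[rat]_d * nat) : 'rV[R]_d := map_mx ratr i.1.
Definition rball_radius (i : 'rV[rat]_d * nat) : R := i.2.+1%:R^-1.

Lemma rball_radius_gt0 i : 0 < rball_radius i.
Proof. by rewrite invr_gt0. Qed.

(** Countability of the family is the point: exceptional null sets of single balls can be united,
    and an open set is exhausted by finite sums of bumps. *)
Lemma rball_cover (V : set 'rV[R]_d) y : open V -> V y -> exists i,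
  eball (rball_center i) (rball_radius i) y /\
  cball (rball_center i) (rball_radius i) `<=` V.
Proof.
move=> oV Vy; have /nbhs_ballP[e /= e0 eV] : nbhs y V by exact: open_nbhs_nbhs.
have [k _ kP] := near_infty_natSinv_lt (PosNum (divr_gt0 e0 (ltr0n _ 2))).
have ke : k.+1%:R^-1 < e / 2 by exact: (kP k (leqnn k)).
set r : R := k.+1%:R^-1; have r0 : 0 < r by rewrite invr_gt0.
(* With this precision in each coordinate the squared distance to the centre is at most
   [d * r ^ 2 / (d + 1) ^ 2], which is less than [r ^ 2]. *)
have dl0 : 0 < r / d.+1%:R by rewrite divr_gt0.
have rat_near (x : R) : exists q : rat, `|ratr q - x| < r / d.+1%:R.
  have [|q] := @rat_in_itvoo R (x - r / d.+1%:R) (x + r / d.+1%:R).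
    by rewrite ltrD2l gtrN.
  by rewrite in_itv/= => qP; exists q; rewrite ltr_distl.
have /choice[q Hq] := fun j => rat_near (y ord0 j).
exists (\row_j q j, k); rewrite /rball_center /rball_radius/=; split.
- rewrite eballE//= -/r.
  apply: (@le_lt_trans _ _ (\sum_(j < d) (r / d.+1%:R) ^+ 2)).
    apply: ler_sum => j _; rewrite !mxE -real_normK ?num_real// lerXn2r ?nnegrE//.
      exact: ltW.
    by rewrite distrC ltW.
  rewrite sumr_const card_ord -[_ *+ d]mulr_natr expr_div_n -mulrA gtr_pMr ?exprn_gt0//.
  rewrite -ltr_pdivlMl ?invr_gt0 ?exprn_gt0// invrK mulr1 -natrX ltr_nat.
  by rewrite -mulnn mulSn ltn_addr.
- move=> z zB; apply: eV; split => // i j; rewrite ord1 /ball/=.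
  have := coord_le_cball j (ltW r0) zB; rewrite !mxE => h.
  rewrite distrC -(subrK (ratr (q j)) (z ord0 j)) -addrA (le_lt_trans (ler_normD _ _))//.
  rewrite (splitr e) ltrD// ?(le_lt_trans h)//.
  apply: (lt_trans (Hq j)); rewrite (le_lt_trans _ ke)//.
  by rewrite ler_pdivrMr// ler_peMr// ?ler1n// ltW.
Qed.

(* For each point of [V], a positive quantity from some [n] on; hence the
   quotients [open_approx] below tend to the indicator of [V]. *)
Definition rbumps (V : set 'rV[R]_d) (n : nat) (y : 'rV[R]_d) : R :=
  \sum_(0 <= k < n) if unpickle k is Some i then
    if `[< cball (rball_center i) (rball_radius i) `<=` V >]
    then bump (rball_center i) (rball_radius i) y else 0 else 0.

Lemma smooth_rbumps V n : smooth (rbumps V n).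
Proof.
apply: smooth_sum => k.
case: (unpickle k) => [i|]; last exact: smooth_cst.
by case: asboolP => _; [exact: smooth_bump|exact: smooth_cst].
Qed.

Lemma rbumps_term_ge0 (V : set 'rV[R]_d) k y : 0 <= (if unpickle k is Some i then
    if `[< cball (rball_center i) (rball_radius i) `<=` V >]
    then bump (rball_center i) (rball_radius i) y else 0 else 0).
Proof. by case: (unpickle k) => // i; case: asboolP => // _; exact: bump_ge0. Qed.

Lemma rbumps_ge0 V n y : 0 <= rbumps V n y.
Proof. by apply: sumr_ge0 => k _; exact: rbumps_term_ge0. Qed.

Lemma rbumps_out V n y : ~ V y -> rbumps V n y = 0.
Proof.
move=> Vy; rewrite /rbumps big1// => k _; case: (unpickle k) => // i.
case: asboolP => // h; apply: contrapT => /eqP.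
have := bump_ge0 (rball_center i) (rball_radius i) y.
rewrite le_eqVlt => /orP[/eqP <-|]; first by rewrite eqxx.
by rewrite bump_gt0 ?rball_radius_gt0// => /ltW /h.
Qed.

Lemma rbumps_in V y : open V -> V y -> exists2 b, 0 < b &
  exists N, forall n, (N <= n)%N -> b <= rbumps V n y.
Proof.
move=> oV /(rball_cover oV)[i [yi iV]].
exists (bump (rball_center i) (rball_radius i) y).
  rewrite bump_gt0 ?rball_radius_gt0//.
  by rewrite eballE ?rball_radius_gt0 in yi.
exists (pickle i).+1 => n hn; rewrite /rbumps big_mkord (bigD1 (Ordinal hn))//=.
rewrite pickleK asboolT// lerDl; apply: sumr_ge0 => k _; exact: rbumps_term_ge0.
Qed.

Definition open_approx V n y : R := rbumps V n y / (rbumps V n y + n.+1%:R^-1).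

Lemma open_approx_den V n y : 0 < rbumps V n y + n.+1%:R^-1.
Proof. by rewrite ltr_wpDl ?rbumps_ge0// invr_gt0. Qed.

Lemma smooth_open_approx V n : smooth (open_approx V n).
Proof.
apply: smoothM; first exact: smooth_rbumps.
apply: smoothV; first by move=> y; rewrite gt_eqF ?open_approx_den.
by apply: smoothD; [exact: smooth_rbumps|exact: smooth_cst].
Qed.

Lemma open_approx_out V n y : ~ V y -> open_approx V n y = 0.
Proof. by move=> Vy; rewrite /open_approx rbumps_out// mul0r. Qed.

Lemma open_approx_ge0 V n y : 0 <= open_approx V n y.
Proof. by rewrite divr_ge0 ?rbumps_ge0// ltW// open_approx_den. Qed.

Lemma open_approx_le1 V n y : open_approx V n y <= 1.
Proof. by rewrite ler_pdivrMr ?open_approx_den// mul1r lerDl invr_ge0. Qed.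

(** At a point of [V] the bump sum [S] is eventually at least some [b > 0], and then [S / (S + e)]
    is at least [1 - e / b] with [e = 1 / (n + 1)]. *)
Lemma cvg_open_approx V y : open V -> open_approx V n y @[n --> \oo] --> (\1_V y : R).
Proof.
move=> oV; rewrite indicE; have [Vy|Vy] := pselect (V y); last first.
  rewrite memNset//=; apply: cvg_near_cst; apply: nearW => n.
  by rewrite open_approx_out.
rewrite mem_set//=; have [b b0 [N bN]] := rbumps_in oV Vy.
have H : 1 - b^-1 * (n.+1%:R^-1 : R) @[n --> \oo] --> (1 : R).
  rewrite -[X in _ --> X]subr0 -(mulr0 b^-1).
  apply: cvgB; first exact: cvg_cst.
  by apply: cvgMr; exact: cvg_harmonic.
suff S : \forall n \near \oo, 1 - b^-1 * (n.+1%:R^-1 : R) <= open_approx V n y <= 1.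
  have C1 : (fun=> 1 : R) @ \oo --> (1 : R) by exact: cvg_cst.
  exact: (squeeze_cvgr S H C1).
near=> n; rewrite open_approx_le1 andbT.
have bn : b <= rbumps V n y by apply: bN; near: n; exact: nbhs_infty_ge.
rewrite ler_pdivlMr ?open_approx_den//.
set S := rbumps V n y; set e : R := n.+1%:R^-1.
have e0 : 0 <= e by rewrite invr_ge0.
have bS : 1 <= b^-1 * S by rewrite -ler_pdivrMl ?invr_gt0// invrK mulr1.
have be0 : 0 <= b^-1 * e by rewrite mulr_ge0// invr_ge0 ltW.
have -> : (1 - b^-1 * e) * (S + e) = S + e * (1 - b^-1 * S) - (b^-1 * e) * e by ring.
rewrite lerBlDr; apply: (@le_trans _ _ S); last by rewrite lerDl mulr_ge0.
by rewrite gerDl mulr_ge0_le0// subr_le0.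
Unshelve. all: by end_near. Qed.

End rational_balls.

(** * The fundamental lemma of the calculus of variations *)

Section fundamental_lemma.
Context {R : realType} {d : nat}.
Implicit Types (U V : set 'rV[R]_d) (h : 'rV[R]_d -> R).

Local Notation mu := (lebesgue_rV R d).

(* The sets on which [h] integrates to 0 form a Dynkin system, and it contains
   the open sets by dominated convergence of [open_approx]. *)
Lemma fundamental_lemma_ball U h x r : open U -> lint U h ->
  (forall phi, rtest U phi -> (\int[mu]_(y in U) (h y * phi y)%:E = 0)%E) ->
  0 < r -> cball x r `<=` U ->
  {ae mu, forall y, eball x r y -> h y = 0}.
Proof.
move=> oU lh hphi r0 BU; set D := eball x r.
have mU := open_measurable_rV oU.
have cB := @cball_compact _ _ x r (ltW r0).
have mD : measurable D by apply: open_measurable_rV; exact: eball_open.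
have iB := lint_integrable_compact mU lh cB BU.
have DB : D `<=` cball x r by exact: subset_eball_cball.
have iD : mu.-integrable D (EFin \o h).
  by apply: integrableS iB => //; exact: measurable_compact_rV.
have mh : measurable_fun D h by apply/measurable_EFinP; exact: measurable_int iD.
have HV V : open V -> V `<=` D -> (\int[mu]_(y in V) (h y)%:E = 0)%E.
  move=> oV VD; have mV := open_measurable_rV oV.
  have tV n : rtest U (open_approx V n).
    apply: (rtest_supp cB BU) => [|y By]; first exact: smooth_open_approx.
    by rewrite open_approx_out// => /VD /DB.
  have mf n : measurable_fun D (fun y => (h y * open_approx V n y)%:E).
    apply/measurable_EFinP; apply: measurable_funM => //.
    apply: measurable_funTS; apply: continuous_measurable_rV.
    exact: rtest_continuous (tV n).
  have mV1 : measurable_fun D (fun y => (h y * \1_V y)%:E).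
    by apply/measurable_EFinP; apply: measurable_funM.
  have cvV : {ae mu, forall y, D y ->
      (h y * open_approx V n y)%:E @[n --> \oo] --> (h y * \1_V y)%:E}.
    apply: nearW => y _; apply: cvg_EFin; first exact: nearW.
    by apply: cvgMr; exact: cvg_open_approx.
  have bV : {ae mu, forall y, forall n, D y ->
      (`|(h y * open_approx V n y)%:E| <= `|h y|%:E)%E}.
    apply: nearW => y n _; rewrite lee_fin normrM (ger0_norm (open_approx_ge0 _ _ _)).
    by rewrite ler_piMr// open_approx_le1.
  have [_ _] := dominated_convergence mD mf mV1 cvV (integrable_norm iD) bV.
  rewrite (_ : (fun n => _) = cst 0%E); last first.
    apply/funext => n /=; rewrite -[RHS](hphi _ (tV n)).
    apply/esym/integral_vanish; first exact: subset_trans BU.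
    by move=> y _ Dy; rewrite open_approx_out ?mulr0// => /VD.
  move=> H.
  have {H} : (\int[mu]_(y in D) (h y * \1_V y)%:E = 0)%E.
    apply/esym; apply: (@cvg_unique _ (@ereal_hausdorff R) _ _ _ _ _ H).
    exact: cvg_cst.
  move=> <-; apply/esym; rewrite (integral_vanish VD); last first.
    by move=> y _ Vy; rewrite indicE memNset// mulr0.
  by apply: eq_integral => y yV; rewrite indicE yV mulr1.
have HE (E : set 'rV[R]_d) : measurable E -> (\int[mu]_(y in E `&` D) (h y)%:E = 0)%E.
  move=> mE; pose P : set_system 'rV[R]_d :=
    fun E => (\int[mu]_(y in E `&` D) (h y)%:E = 0)%E.
  refine (@dynkin_induction borel_rV_display 'rV[R]_d (@open 'rV[R]_d) P
    _ _ _ _ _ _ E mE) => //; rewrite /P.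
  - exact: openI.
  - by rewrite setTI; apply: HV => //; exact: eball_open.
  - move=> V oV; apply: HV; last exact: subIsetr.
    by apply: openI => //; exact: eball_open.
  - move=> S mS S0.
    have : (\int[mu]_(y in D) (h y)%:E = 0)%E by apply: HV => //; exact: eball_open.
    rewrite -{1}(setUIDK D S) integral_setU//; last 4 first.
    + exact: measurableI.
    + exact: measurableD.
    + rewrite setUIDK; exact/measurable_EFinP.
    + by rewrite disj_set2E setDE setIACA setICr setI0.
    by rewrite setIC S0 add0e setDE setIC.
  - move=> F mF tF F0; rewrite setI_bigcupl integral_bigcup.
    + by rewrite eseries0// => n _ _; exact: F0.
    + exact: trivIset_setIr.
    + by move=> k; exact: measurableI.
    + rewrite -setI_bigcupl; apply: integrableS iD => //.
      apply: measurableI => //; exact: bigcup_measurable.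
have : ae_eq mu D (EFin \o h) (cst 0%E).
  apply: integral_ae_eq => //.
  move=> E ED mE; rewrite integral0.
  by have := HE E mE; rewrite (setIidl ED).
by apply: filterS => y /[apply] -[].
Qed.

(** [U] is the union of the rational balls whose closures it contains, and countably many null sets
    have a null union. *)
Lemma fundamental_lemma U h : open U -> lint U h ->
  (forall phi, rtest U phi -> (\int[mu]_(y in U) (h y * phi y)%:E = 0)%E) ->
  {ae mu, forall y, U y -> h y = 0}.
Proof.
move=> oU lh hphi.
have H : {ae mu, forall y, forall k, if unpickle k is Some i then
   cball (rball_center i) (rball_radius i) `<=` U ->
   eball (rball_center i) (rball_radius i) y -> h y = 0 else True}.
  apply: ae_foralln => k; case: (unpickle k) => [i|]; last exact: nearW.
  have [iU|iU] := pselect (cball (@rball_center R d i) (rball_radius i) `<=` U).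
    have := fundamental_lemma_ball oU lh hphi (rball_radius_gt0 i) iU.
    by apply: filterS => y + _.
  by apply: nearW => y /iU.
apply: filterS H => y H /(rball_cover oU)[i [yi iU]].
by have := H (pickle i); rewrite pickleK; exact.
Qed.

End fundamental_lemma.

(** * Weak gradients of real functions *)

Section weak_gradients.
Context {R : realType} {d : nat}.
Implicit Types (U K : set 'rV[R]_d) (u v f phi : 'rV[R]_d -> R)
  (g h : 'I_d -> 'rV[R]_d -> R).

Local Notation mu := (lebesgue_rV R d).
Local Notation e_ j := (delta_mx ord0 j : 'rV[R]_d).

Definition wgrad U u g : Prop :=
  [/\ lint U u, forall j, lint U (g j) & forall phi j, rtest U phi ->
    \int[mu]_(y in U) (u y * partial j phi y) = - \int[mu]_(y in U) (g j y * phi y)].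

Lemma lintB U f f' : measurable U -> lint U f -> lint U f' ->
  lint U (fun y => f y - f' y).
Proof.
move=> mU lf lf'; split; first by apply: measurable_funB; [exact: lf.1|exact: lf'.1].
move=> K cK KU.
have /integrable_abse/integrableP[_] := integrableB (measurable_compact_rV cK)
  (lint_integrable_compact mU lf cK KU) (lint_integrable_compact mU lf' cK KU).
by under eq_integral do rewrite abse_id.
Qed.

Lemma lint_continuous U f : continuous f -> lint U f.
Proof.
move=> cf; split; first by apply: measurable_funTS; exact: continuous_measurable_rV.
move=> K cK _; have mK := measurable_compact_rV cK.
have : mu.-integrable K (EFin \o f).
  apply: measurable_bounded_integrable => //; first exact: compact_fin.
    by apply: measurable_funTS; exact: continuous_measurable_rV.
  have : compact (f @` K) by apply: continuous_compact => //; exact: continuous_subspaceT.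
  move=> /compact_bounded; case=> M [Mr MP]; exists M; split => // N MN y Ky.
  by apply: MP => //; exists y.
by move=> /integrableP[].
Qed.

Lemma lint_L2 U f : measurable U -> measurable_fun U f ->
  (mass U f < +oo)%E -> lint U f.
Proof.
move=> mU mf f2; split => // K cK KU; have mK := measurable_compact_rV cK.
have mfK : measurable_fun K f by exact: measurable_funS mf.
apply: (@le_lt_trans _ _ (\int[mu]_(y in K) (1 + (f y ^+ 2)%:E))%E).
  apply: ge0_le_integral => //.
  - by apply/measurable_EFinP; exact: measurableT_comp.
  - by apply/measurable_EFinP; apply: measurable_funD => //; exact: measurable_funX.
  - move=> y _; rewrite -EFinD lee_fin.
    rewrite -(real_normK (num_real (f y))).
    by have := sqr_ge0 (`|f y| - 1); have := normr_ge0 (f y); nra.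
rewrite ge0_integralD//; last 2 first.
- by move=> y _; rewrite lee_fin sqr_ge0.
- by apply/measurable_EFinP; exact: measurable_funX.
apply: lte_add_pinfty.
  by rewrite integral_cst// mul1e; exact: compact_fin.
apply: le_lt_trans f2; apply: ge0_subset_integral => //.
  by apply/measurable_EFinP; exact: measurable_funX.
by move=> y _; rewrite lee_fin sqr_ge0.
Qed.

Lemma wgradB U u v g h : open U -> wgrad U u g -> wgrad U v h ->
  wgrad U (fun y => u y - v y) (fun j y => g j y - h j y).
Proof.
move=> oU [lu lg Hu] [lv lh Hv]; have mU := open_measurable_rV oU.
split => [|j|phi j tphi]; [exact: lintB|exact: lintB|].
have tp := rtest_partial j tphi.
under eq_Rintegral do rewrite mulrBl.
rewrite RintegralB//; [|exact: lintM_integrable..].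
under [in RHS]eq_Rintegral do rewrite mulrBl.
rewrite RintegralB//; [|exact: lintM_integrable..].
by rewrite Hu// Hv// opprB opprK addrC.
Qed.

Lemma eq_wgrad U u v g h : (forall y, u y = v y) -> (forall j y, g j y = h j y) ->
  wgrad U u g -> wgrad U v h.
Proof.
move=> uv gh; have -> : v = u by apply/funext => y.
suff -> : h = g by [].
by apply/funext => j; apply/funext => y.
Qed.

Lemma wgrad_smooth U f : open U -> smooth f -> wgrad U f (fun j => partial j f).
Proof.
move=> oU sf; have mU := open_measurable_rV oU; have /smoothP[cf df spf] := sf.
have cpf j : continuous (partial j f) by have /smoothP[] := spf j.
split=> [|j|phi j tphi]; [exact: lint_continuous|exact: lint_continuous|].
have tp := rtest_partial j tphi.
apply/eqP; rewrite -subr_eq0 opprK -RintegralD//; last 2 first.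
- by apply: lintM_integrable => //; exact: lint_continuous.
- by apply: lintM_integrable => //; exact: lint_continuous.
rewrite /Rintegral; under eq_integral do rewrite [partial j f _ * _]mulrC.
by rewrite integral_partialM_eq0.
Qed.

(** The difference of the two gradients integrates to 0 against every test function. *)
Lemma wgrad_unique U u g h : open U -> wgrad U u g -> wgrad U u h ->
  forall j, {ae mu, forall y, U y -> g j y = h j y}.
Proof.
move=> oU wg wh j; have mU := open_measurable_rV oU.
have [lu lg Hg] := wg; have [_ lh Hh] := wh.
have H : {ae mu, forall y, U y -> g j y - h j y = 0}.
  apply: fundamental_lemma => //; first exact: lintB.
  move=> phi tphi.
  have ig := lintM_integrable mU (lg j) tphi.
  have ih := lintM_integrable mU (lh j) tphi.
  under eq_integral do rewrite mulrBl EFinB.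
  rewrite integralB_EFin//.
  rewrite -(fineK (integrable_fin_num mU ig)) -(fineK (integrable_fin_num mU ih)).
  have : \int[mu]_(y in U) (g j y * phi y) = \int[mu]_(y in U) (h j y * phi y).
    by apply: oppr_inj; rewrite -Hg// -Hh.
  by rewrite /Rintegral => ->; rewrite subee.
by apply: filterS H => y + Uy => /(_ Uy)/eqP; rewrite subr_eq0 => /eqP.
Qed.

Lemma Rintegral_vanish U K f : K `<=` U -> (forall y, U y -> ~ K y -> f y = 0) ->
  \int[mu]_(y in U) f y = \int[mu]_(y in K) f y.
Proof.
move=> KU f0; rewrite /Rintegral; congr fine; apply: integral_vanish => // y Uy Ky.
by rewrite f0.
Qed.

End weak_gradients.

(** * Weak gradients of complex functions through real and imaginary parts *)

Section complex_gradients.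
Context {R : realType} {d : nat}.
Implicit Types (U K : set 'rV[R]_d) (u : 'rV[R]_d -> R[i])
  (G : 'rV[R]_d -> 'cV[R[i]]_d).

Local Notation mu := (lebesgue_rV R d).
Local Notation Re := complex.Re.
Local Notation Im := complex.Im.

Lemma Re_mulc (z w : R[i]) : Re (z * w) = Re z * Re w - Im z * Im w.
Proof. by case: z w => a b []. Qed.

Lemma Im_mulc (z w : R[i]) : Im (z * w) = Re z * Im w + Im z * Re w.
Proof. by case: z w => a b []. Qed.

Lemma sqr_normc (z : R[i]) : normc z ^+ 2 = Re z ^+ 2 + Im z ^+ 2.
Proof. by case: z => a b /=; rewrite sqr_sqrtr// addr_ge0// sqr_ge0. Qed.

Lemma normc_ge0 (z : R[i]) : 0 <= normc z.
Proof. by case: z => a b; exact: sqrtr_ge0. Qed.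

Lemma normcR (a : R) : normc (a%:C)%C = `|a|.
Proof. by rewrite /= expr0n/= addr0 sqrtr_sqr. Qed.

Lemma norm_Re_le (z : R[i]) : `|Re z| <= normc z.
Proof.
case: z => a b /=; rewrite -sqrtr_sqr ler_wsqrtr// lerDl; exact: sqr_ge0.
Qed.

Lemma norm_Im_le (z : R[i]) : `|Im z| <= normc z.
Proof.
case: z => a b /=; rewrite -sqrtr_sqr ler_wsqrtr// lerDr; exact: sqr_ge0.
Qed.

Lemma normc_le_ReIm (z : R[i]) : normc z <= `|Re z| + `|Im z|.
Proof.
case: z => a b /=; rewrite -[leRHS]ger0_norm ?addr_ge0// -sqrtr_sqr ler_wsqrtr//.
rewrite -(real_normK (num_real a)) -(real_normK (num_real b)).
have := normr_ge0 a; have := normr_ge0 b; nra.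
Qed.

Lemma measurable_sqrtr : measurable_fun setT (@Num.sqrt R).
Proof. by apply: continuous_measurable_fun; exact: sqrt_continuous. Qed.

Lemma measurable_normc U (u : 'rV[R]_d -> R[i]) : measurable U -> cmeasurable_fun U u ->
  measurable_fun U (fun y => normc (u y)).
Proof.
move=> mU [mr mi].
rewrite (_ : (fun y => _) = Num.sqrt \o (fun y => Re (u y) ^+ 2 + Im (u y) ^+ 2)).
  apply: measurableT_comp; first exact: measurable_sqrtr.
  by apply: measurable_funD; exact: measurable_funX.
by apply/funext => y /=; case: (u y).
Qed.

Lemma locally_integrable_onP U u : measurable U -> locally_integrable_on U u <->
  lint U (fun y => Re (u y)) /\ lint U (fun y => Im (u y)).
Proof.
move=> mU; split.
  move=> [[mr mi] uK]; split; split => // K cK KU; have mK := measurable_compact_rV cK.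
  - apply: le_lt_trans (uK K cK KU); apply: ge0_le_integral => //.
    + by apply/measurable_EFinP; apply: measurableT_comp => //; exact: measurable_funS mr.
    + apply/measurable_EFinP; apply: measurable_normc => //.
      by split; [exact: measurable_funS mr|exact: measurable_funS mi].
    + by move=> y _; rewrite lee_fin norm_Re_le.
  - apply: le_lt_trans (uK K cK KU); apply: ge0_le_integral => //.
    + by apply/measurable_EFinP; apply: measurableT_comp => //; exact: measurable_funS mi.
    + apply/measurable_EFinP; apply: measurable_normc => //.
      by split; [exact: measurable_funS mr|exact: measurable_funS mi].
    + by move=> y _; rewrite lee_fin norm_Im_le.
move=> [[mr rK] [mi iK]]; split => // K cK KU; have mK := measurable_compact_rV cK.
have mrK : measurable_fun K (fun y => `|Re (u y)|).
  by apply: measurableT_comp => //; exact: measurable_funS mr.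
have miK : measurable_fun K (fun y => `|Im (u y)|).
  by apply: measurableT_comp => //; exact: measurable_funS mi.
apply: (@le_lt_trans _ _ (\int[mu]_(y in K) (`|Re (u y)|%:E + `|Im (u y)|%:E))%E).
  apply: ge0_le_integral => //.
  - by move=> y _; rewrite lee_fin normc_ge0.
  - apply/measurable_EFinP; apply: measurable_normc => //.
    by split; [exact: measurable_funS mr|exact: measurable_funS mi].
  - by apply/measurable_EFinP; apply: measurable_funD.
  - by move=> y _; rewrite -EFinD lee_fin normc_le_ReIm.
rewrite ge0_integralD//; [|by apply/measurable_EFinP..].
by apply: lte_add_pinfty; [exact: rK|exact: iK].
Qed.

Lemma real_test_function U (phi : 'rV[R]_d -> R) : rtest U phi ->
  test_function U (fun y => (phi y)%:C%C).
Proof.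
move=> [sphi cphi sU].
have E : [set y | (phi y)%:C%C != 0 :> R[i]] = [set y | phi y != 0].
  by apply/seteqP; split => y /=; rewrite -(inj_eq (@complexI R)).
rewrite /test_function E; split => //.
exact: smooth_cst.
Qed.

Lemma test_function_Re U (phi : 'rV[R]_d -> R[i]) : test_function U phi ->
  rtest U (fun y => Re (phi y)).
Proof.
move=> [sr si cphi sU]; apply: (rtest_supp cphi sU) => // y h.
suff -> : phi y = 0 by [].
by apply/eqP; apply: contrapT => /negP h'; apply: h; exact: subset_closure.
Qed.

Lemma test_function_Im U (phi : 'rV[R]_d -> R[i]) : test_function U phi ->
  rtest U (fun y => Im (phi y)).
Proof.
move=> [sr si cphi sU]; apply: (rtest_supp cphi sU) => // y h.
suff -> : phi y = 0 by [].
by apply/eqP; apply: contrapT => /negP h'; apply: h; exact: subset_closure.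
Qed.

(** A real test function separates the identity into its real and imaginary parts; conversely the
    identity is linear in the test function, whose two parts are real test functions. *)
Lemma weak_gradientP U u G : open U -> weak_gradient U u G <->
  wgrad U (fun y => Re (u y)) (fun j y => Re (G y j ord0)) /\
  wgrad U (fun y => Im (u y)) (fun j y => Im (G y j ord0)).
Proof.
move=> oU; have mU := open_measurable_rV oU; split.
  move=> [/(locally_integrable_onP _ mU)[lr li] lG HG].
  have lGr j : lint U (fun y => Re (G y j ord0)).
    by have /(locally_integrable_onP _ mU)[] := lG j.
  have lGi j : lint U (fun y => Im (G y j ord0)).
    by have /(locally_integrable_onP _ mU)[] := lG j.
  split; split => // phi j tphi.
  - have /(congr1 (@complex.Re R)) := HG _ j (real_test_function tphi).
    rewrite /cintegral /=.
    under eq_Rintegral => y _ do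
      rewrite Re_mulc /= partial_cst mulr0 subr0.
    move=> ->; congr (- _); apply: eq_Rintegral => y _.
    by rewrite Re_mulc /= mulr0 subr0.
  - have /(congr1 (@complex.Im R)) := HG _ j (real_test_function tphi).
    rewrite /cintegral /=.
    under eq_Rintegral => y _ do
      rewrite Im_mulc /= partial_cst mulr0 add0r.
    move=> ->; congr (- _); apply: eq_Rintegral => y _.
    by rewrite Im_mulc /= mulr0 add0r.
move=> [[lr lGr Hr] [li lGi Hi]]; split.
- exact/locally_integrable_onP.
- by move=> j; apply/locally_integrable_onP.
move=> phi j tphi; have ta := test_function_Re tphi; have tb := test_function_Im tphi.
have tpa := rtest_partial j ta; have tpb := rtest_partial j tb.
rewrite /cintegral; apply/eqP; rewrite eq_complex /=; apply/andP; split; apply/eqP.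
- under eq_Rintegral do rewrite Re_mulc /=.
  rewrite RintegralB//; [|exact: lintM_integrable..].
  under [in RHS]eq_Rintegral do rewrite Re_mulc /=.
  rewrite RintegralB//; [|exact: (lintM_integrable mU)..].
  by rewrite Hr// Hi// opprB opprK addrC.
- under eq_Rintegral do rewrite Im_mulc /=.
  rewrite RintegralD//; [|exact: lintM_integrable..].
  under [in RHS]eq_Rintegral do rewrite Im_mulc /=.
  rewrite RintegralD//; [|exact: (lintM_integrable mU)..].
  by rewrite Hr// Hi// opprD.
Qed.

Lemma weak_gradient_unique U u G G' : open U -> weak_gradient U u G ->
  weak_gradient U u G' -> {ae mu, forall y, U y -> G y = G' y}.
Proof.
move=> oU /(weak_gradientP _ _ oU)[Gr Gi] /(weak_gradientP _ _ oU)[Gr' Gi'].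
have H : {ae mu, forall y, forall j : 'I_d, U y -> G y j ord0 = G' y j ord0}.
  have K (P : 'I_d -> 'rV[R]_d -> Prop) : (forall j, {ae mu, forall y, P j y}) ->
      {ae mu, forall y, forall j, P j y}.
    by move=> HP; apply: filter_forall.
  apply: K => j; have := wgrad_unique oU Gr Gr' j; have := wgrad_unique oU Gi Gi' j.
  apply: filterS2 => y hi hr Uy; apply/eqP; rewrite eq_complex.
  by rewrite hi// hr// !eqxx.
by apply: filterS H => y H Uy; apply/colP => j; exact: H.
Qed.

Lemma grad_weak_gradient U u G : weak_gradient U u G -> weak_gradient U u (grad U u).
Proof. by move=> wG; apply: (@xgetPex _ (fun=> 0) (fun g => weak_gradient U u g)); exists G. Qed.

(** [grad] is some weak gradient, picked by choice; only through this comparison do its values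
    become known. *)
Lemma grad_ae U u G : open U -> weak_gradient U u G ->
  {ae mu, forall y, U y -> grad U u y = G y}.
Proof.
by move=> oU wG; exact: (weak_gradient_unique oU (grad_weak_gradient wG) wG).
Qed.

End complex_gradients.

(** * Sobolev norms and the passage from complex to real form spaces *)

Section norms.
Context {R : realType} {d : nat}.
Implicit Types (U K F : set 'rV[R]_d) (w : 'rV[R]_d -> R[i])
  (u v f phi : 'rV[R]_d -> R) (g : 'I_d -> 'rV[R]_d -> R)
  (G : 'rV[R]_d -> 'cV[R[i]]_d).

Local Notation mu := (lebesgue_rV R d).
Local Notation Re := complex.Re.
Local Notation Im := complex.Im.

Lemma mass_ge0 U f : (0 <= mass U f)%E.
Proof. by apply: integral_ge0 => y _; rewrite lee_fin sqr_ge0. Qed.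

Lemma LpnormE U (p : R) f : p != 0 ->
  Lpnorm U p%:E f = ((\int[mu]_(y in U) (`|f y| `^ p)%:E) `^ p^-1)%E.
Proof.
move=> p0; rewrite /Lpnorm unlock; congr poweR; rewrite [RHS]integral_mkcond.
apply: eq_integral => y _; rewrite !patchE; case: ifPn => //= _.
by rewrite normr0 powR0.
Qed.

Lemma sqr_half_poweR (x : \bar R) : (0 <= x)%E -> ((x `^ 2^-1) ^+ 2 = x)%E.
Proof.
case: x => [r| |] //; last by rewrite poweRyr// invr_eq0.
rewrite lee_fin => r0; rewrite poweR_EFin -EFin_expe; congr EFin.
by rewrite -powR_mulrn ?powR_ge0// -powRrM mulVf// powRr1.
Qed.

Lemma Lpnorm2_sqr U f : (Lpnorm U 2%:E f ^+ 2 = mass U f)%E.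
Proof.
rewrite LpnormE// sqr_half_poweR; last first.
  by apply: integral_ge0 => y _; rewrite lee_fin powR_ge0.
apply: eq_integral => y _; congr EFin.
by rewrite (powR_mulrn 2)// real_normK// num_real.
Qed.

(** The square of [H1norm]: additive in function and gradient, so that comparing norms means
    comparing integrals. *)
Definition H1sq U w : \bar R :=
  (\int[mu]_(y in U) (normc (w y) ^+ 2)%:E +
   \int[mu]_(y in U) (cvnorm (grad U w y) ^+ 2)%:E)%E.

Lemma H1sq_ge0 U w : (0 <= H1sq U w)%E.
Proof. by apply: adde_ge0; exact: mass_ge0. Qed.

Lemma H1normE U w : H1norm U w = (H1sq U w `^ 2^-1)%E.
Proof. by rewrite /H1norm /L2norm /L2norm_grad !Lpnorm2_sqr. Qed.

Lemma H1norm_sqr U w : (H1norm U w ^+ 2 = H1sq U w)%E.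
Proof. by rewrite H1normE sqr_half_poweR// H1sq_ge0. Qed.

Lemma H1norm_ge0 U w : (0 <= H1norm U w)%E.
Proof. by rewrite H1normE poweR_ge0. Qed.

Lemma H1norm_ltP U w (e : R) : 0 < e ->
  (H1norm U w < e%:E)%E = (H1sq U w < (e ^+ 2)%:E)%E.
Proof.
by move=> e0; rewrite -H1norm_sqr EFin_expe lte_sqr ?H1norm_ge0// lee_fin ltW.
Qed.

Lemma H1norm_lty U w : (H1norm U w < +oo)%E = (H1sq U w < +oo)%E.
Proof.
rewrite H1normE; have := H1sq_ge0 U w; case: (H1sq U w) => [r| |]// _.
  by rewrite poweR_EFin !ltry.
by rewrite poweRyr ?invr_eq0.
Qed.

Lemma sqr_cvnorm (z : 'cV[R[i]]_d) : cvnorm z ^+ 2 = \sum_j normc (z j ord0) ^+ 2.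
Proof. by rewrite sqr_sqrtr//; apply: sumr_ge0 => j _; exact: sqr_ge0. Qed.

Lemma measurable_sqr_cvnorm U G : measurable U ->
  (forall j, cmeasurable_fun U (fun y => G y j ord0)) ->
  measurable_fun U (fun y => cvnorm (G y) ^+ 2).
Proof.
move=> mU mG; under eq_fun do rewrite sqr_cvnorm.
apply: measurable_sum => j; apply: measurable_funX; exact: measurable_normc.
Qed.

Lemma measurable_grad U w G j : weak_gradient U w G ->
  cmeasurable_fun U (fun y => grad U w y j ord0).
Proof. by move=> /grad_weak_gradient[_ /(_ j)[]]. Qed.

Lemma mass_Re_le U w : measurable U -> cmeasurable_fun U w ->
  (mass U (fun y => Re (w y)) <= H1sq U w)%E.
Proof.
move=> mU mw; have [mr mi] := mw.
apply: (@le_trans _ _ (\int[mu]_(y in U) (normc (w y) ^+ 2)%:E)%E).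
  apply: ge0_le_integral => //.
  - by move=> y _; rewrite lee_fin sqr_ge0.
  - by apply/measurable_EFinP; exact: measurable_funX.
  - by apply/measurable_EFinP; apply: measurable_funX; exact: measurable_normc.
  - by move=> y _; rewrite lee_fin sqr_normc lerDl sqr_ge0.
by rewrite leeDl//; exact: mass_ge0.
Qed.

Lemma mass_Re_grad_le U w G j : open U -> weak_gradient U w G ->
  (mass U (fun y => Re (G y j ord0)) <= H1sq U w)%E.
Proof.
move=> oU wG; have mU := open_measurable_rV oU.
have [_ /(_ j)[[mr mi] _] _] := wG.
apply: (@le_trans _ _ (\int[mu]_(y in U) (cvnorm (grad U w y) ^+ 2)%:E)%E); last first.
  by rewrite leeDr//; exact: mass_ge0.
apply: ae_ge0_le_integral => //.
- by move=> y _; rewrite lee_fin sqr_ge0.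
- by apply/measurable_EFinP; exact: measurable_funX.
- by move=> y _; rewrite lee_fin sqr_ge0.
- apply/measurable_EFinP; apply: measurable_sqr_cvnorm => // k.
  exact: measurable_grad wG.
apply: filterS (grad_ae oU wG) => y + Uy => /(_ Uy) ->.
rewrite lee_fin sqr_cvnorm (bigD1 j)//= sqr_normc -addrA lerDl addr_ge0 ?sqr_ge0//.
by apply: sumr_ge0 => k _; exact: sqr_ge0.
Qed.

Definition HD F U u g : Prop :=
  [/\ wgrad U u g, (mass U u < +oo)%E, forall j, (mass U (g j) < +oo)%E &
   forall e : R, 0 < e -> exists phi, [/\ rtest (~` F) phi,
     (mass U (fun y => u y - phi y)%R < e%:E)%E &
     forall j, (mass U (fun y => g j y - partial j phi y)%R < e%:E)%E]].

Definition cgrad g : 'rV[R]_d -> 'cV[R[i]]_d := fun y => \col_j (g j y)%:C%C.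

Lemma wgrad_cst0 U : open U -> wgrad U (fun=> 0) (fun _ _ => 0).
Proof.
move=> oU; have := wgrad_smooth oU (smooth_cst (0 : R)).
rewrite (_ : (fun j => partial j _) = fun _ _ => 0)//.
by apply/funext => j; apply/funext => y; rewrite partial_cst.
Qed.

Lemma real_weak_gradient U u g : open U -> wgrad U u g ->
  weak_gradient U (fun y => (u y)%:C%C) (cgrad g).
Proof.
move=> oU wg; apply/(weak_gradientP _ _ oU); split => /=.
  by apply: (eq_wgrad _ _ wg) => // j y; rewrite mxE.
by apply: (eq_wgrad _ _ (wgrad_cst0 oU)) => // j y; rewrite mxE.
Qed.

Lemma sqr_cvnorm_cgrad g y : cvnorm (cgrad g y) ^+ 2 = \sum_j g j y ^+ 2.
Proof.
rewrite sqr_cvnorm; apply: eq_bigr => j _.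
by rewrite mxE normcR real_normK// num_real.
Qed.

Lemma H1sq_real U u g : open U -> wgrad U u g ->
  H1sq U (fun y => (u y)%:C%C) = (mass U u + \sum_j mass U (g j))%E.
Proof.
move=> oU wg; have mU := open_measurable_rV oU; congr (_ + _)%E.
  by apply: eq_integral => y _; rewrite normcR real_normK// num_real.
have [_ lg _] := wg; have wG := real_weak_gradient oU wg.
rewrite -ge0_integral_sum//; last 2 first.
- by move=> j; apply/measurable_EFinP; apply: measurable_funX; have [] := lg j.
- by move=> j y _; rewrite lee_fin sqr_ge0.
apply: ge0_ae_eq_integral => //.
- apply/measurable_EFinP; apply: measurable_sqr_cvnorm => // k.
  exact: measurable_grad wG.
- apply: emeasurable_sum => j; apply/measurable_EFinP; apply: measurable_funX.
  by have [] := lg j.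
- by move=> y _; rewrite lee_fin sqr_ge0.
- by move=> y _; apply: sume_ge0 => j _; rewrite lee_fin sqr_ge0.
apply: filterS (grad_ae oU wG) => y + Uy => /(_ Uy) ->.
by rewrite sumEFin sqr_cvnorm_cgrad.
Qed.

(** The real part of a complex approximation of a real function approximates it at least as well,
    for the function and for each partial derivative. *)
Lemma H1real_HD F U u : open U -> H1real_ F U u -> exists g, HD F U u g.
Proof.
move=> oU [[[G wG] H1u] Ha]; have mU := open_measurable_rV oU.
have [wr wi] := (weak_gradientP _ _ oU).1 wG.
exists (fun j y => Re (G y j ord0)); split => //.
- rewrite H1norm_lty in H1u; apply: le_lt_trans H1u.
  by have [[mu0 _] _ _] := wG; exact: (mass_Re_le mU mu0).
- by move=> j; rewrite H1norm_lty in H1u; apply: le_lt_trans H1u; exact: mass_Re_grad_le.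
move=> e e0; have se0 : 0 < Num.sqrt e by rewrite sqrtr_gt0.
have [phi tphi] := Ha _ se0; rewrite H1norm_ltP// sqr_sqrtr ?ltW// => He.
have ta := test_function_Re tphi; have tb := test_function_Im tphi.
exists (fun y => Re (phi y)).
have [sa _ _] := ta; have [sb _ _] := tb.
have wa := wgradB oU wr (wgrad_smooth oU sa).
have wb := wgradB oU wi (wgrad_smooth oU sb).
pose G1 y : 'cV[R[i]]_d := \col_j
  (Complex (Re (G y j ord0) - partial j (fun y => Re (phi y)) y)
    (Im (G y j ord0) - partial j (fun y => Im (phi y)) y)).
have wG1 : weak_gradient U (fun y => (u y)%:C%C - phi y) G1.
  apply/(weak_gradientP _ _ oU); split.
  - by apply: (eq_wgrad _ _ wa) => [y|k y]; [case: (phi y)|rewrite mxE].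
  - by apply: (eq_wgrad _ _ wb) => [y|k y]; [case: (phi y)|rewrite mxE].
split => //.
- apply: le_lt_trans He.
  rewrite (_ : (fun y => u y - _) = (fun y => Re ((u y)%:C%C - phi y))); last first.
    by apply/funext => y; case: (phi y).
  by apply: mass_Re_le => //; have [[]] := wG1.
- move=> j; apply: le_lt_trans He; have := mass_Re_grad_le j oU wG1.
  by apply: le_trans; rewrite le_eqVlt; apply/orP; left; apply/eqP;
    apply: eq_integral => y _; rewrite mxE.
Qed.

Lemma HD_H1real F U u g : open U -> HD F U u g -> H1real_ F U u.
Proof.
move=> oU [wg fu fg Ha]; split.
  split; first by exists (cgrad g); exact: real_weak_gradient.
  rewrite H1norm_lty (H1sq_real oU wg) lte_add_pinfty//.
  by apply/lte_sum_pinfty => j _; exact: fg.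
(* The function and its [d] derivatives contribute [d + 1] errors; dividing by [d + 2] makes their
   sum strictly smaller than [e ^ 2]. *)
move=> e e0; have c0 : 0 < e ^+ 2 / d.+2%:R by rewrite divr_gt0// exprn_gt0.
have [phi [tphi H0 H1]] := Ha _ c0.
exists (fun y => (phi y)%:C%C); first exact: real_test_function.
have [sphi _ _] := tphi.
rewrite (_ : (fun y => _) = fun y => (u y - phi y)%:C%C); last first.
  by apply/funext => y; rewrite rmorphB.
rewrite H1norm_ltP// (H1sq_real oU (wgradB oU wg (wgrad_smooth oU sphi))).
apply: (@le_lt_trans _ _ (((e ^+ 2 / d.+2%:R)%:E +
   \sum_(j < d) (e ^+ 2 / d.+2%:R)%:E)%E)).
  apply: leeD; first exact: ltW.
  by apply: lee_sum => j _; apply: ltW; exact: H1.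
rewrite sumEFin sumr_const card_ord -EFinD lte_fin -mulrS -[_ *+ d.+1]mulr_natr.
rewrite -mulrA gtr_pMr ?exprn_gt0// mulrC ltr_pdivrMr// mul1r ltr_nat.
by [].
Qed.

End norms.

(** * Truncation of Sobolev functions *)

Section truncation_R.
Context {R : realType}.

(* [t * expR (- ((n + 1) t)^-1)] for positive [t]: smooth approximations of
   [max t 0] with derivatives [dtrunc n] between 0 and 1. *)
Definition trunc (n : nat) (t : R) : R := t * psi 0 (n.+1%:R * t).
Definition dtrunc (n : nat) (t : R) : R :=
  psi 0 (n.+1%:R * t) + psi 1 (n.+1%:R * t).

Lemma psi_mulr m (t : R) : t * psi m.+1 t = psi m t.
Proof.
have [->|t0] := eqVneq t 0; first by rewrite mul0r psi_le0.
by rewrite -psi_recr mulrA divff// mul1r.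
Qed.

Lemma is_derive_psi_scale m n (t : R) :
  is_derive (t : R) (1 : R) (fun t => psi m (n.+1%:R * t))
    (n.+1%:R * (psi m.+2 (n.+1%:R * t) - m%:R * psi m.+1 (n.+1%:R * t))).
Proof.
have dl : is_derive (t : R) (1 : R) (fun t : R => n.+1%:R * t) n.+1%:R.
  have [D1 D2] := is_deriveZ n.+1%:R (@is_derive_id R R t 1).
  by apply: DeriveDef; [exact: D1|rewrite [LHS]D2 /GRing.scale/= mulr1].
have [D1 D2] := @is_derive1_comp _ (psi m) (fun t : R => n.+1%:R * t) t _ _
   (is_derive_psi m _) dl.
by apply: DeriveDef; [exact: D1|rewrite [LHS]D2 mulrC].
Qed.

Lemma is_derive_trunc n (t : R) : is_derive (t : R) (1 : R) (trunc n) (dtrunc n t).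
Proof.
have [D1 D2] := is_deriveM (@is_derive_id R R t 1) (is_derive_psi_scale 0 n t).
apply: DeriveDef; [exact: D1|rewrite [LHS]D2 /GRing.scale/= mulr1 /dtrunc].
by rewrite mul0r subr0 addrC -(psi_mulr 1); ring.
Qed.

Lemma is_derive_dtrunc n (t : R) :
  is_derive (t : R) (1 : R) (dtrunc n) (n.+1%:R * psi 3 (n.+1%:R * t)).
Proof.
have [D1 D2] := is_deriveD (is_derive_psi_scale 0 n t) (is_derive_psi_scale 1 n t).
apply: DeriveDef; [exact: D1|rewrite [LHS]D2].
by ring.
Qed.

Lemma lipschitz_derive (f df : R -> R) (L : R) :
  (forall x : R, is_derive (x : R) (1 : R) f (df x)) ->
  (forall x, `|df x| <= L) -> forall a b, `|f a - f b| <= L * `|a - b|.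
Proof.
move=> Df dL.
have cf : continuous f.
  move=> x; apply: differentiable_continuous; apply/derivable1_diffP.
  by have [] := Df x.
suff H a b : a <= b -> `|f b - f a| <= L * `|b - a|.
  move=> a b; have [ab|/ltW ab] := leP a b; last exact: H.
  by rewrite distrC [`|a - b|]distrC; exact: H.
move=> ab; have [c _ ->] := @MVT_segment _ f df a b ab (fun x _ => Df x)
  (continuous_subspaceT cf).
by rewrite normrM ler_wpM2r.
Qed.

Lemma dtrunc_ge0 n (t : R) : 0 <= dtrunc n t.
Proof. by rewrite addr_ge0 ?psi_ge0. Qed.

(** For [s = (n + 1) * t > 0] this says [1 + s^-1 <= expR s^-1]. *)
Lemma dtrunc_le1 n (t : R) : dtrunc n t <= 1.
Proof.
rewrite /dtrunc; set s := n.+1%:R * t.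
have [s0|s0] := ltP 0 s; last by rewrite !psi_le0// addr0.
rewrite /psi s0 expr0 invr1 mul1r -[X in X + _]mul1r -mulrDl expRN expr1.
by rewrite ler_pdivrMr ?expR_gt0// mul1r expR_ge1Dx.
Qed.

Lemma trunc_le0 n (t : R) : t <= 0 -> trunc n t = 0.
Proof. by move=> t0; rewrite /trunc psi_le0 ?mulr0// mulr_ge0_le0. Qed.

Lemma lipschitz_trunc n (a b : R) : `|trunc n a - trunc n b| <= `|a - b|.
Proof.
rewrite -[leRHS]mul1r; apply: (@lipschitz_derive _ (dtrunc n)) => x.
  exact: is_derive_trunc.
by rewrite ger0_norm ?dtrunc_ge0// dtrunc_le1.
Qed.

Definition dtrunc_lip (n : nat) : R := n.+1%:R * 3%:R ^+ 3.

Lemma dtrunc_lip_gt0 n : 0 < dtrunc_lip n.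
Proof. by rewrite mulr_gt0// exprn_gt0. Qed.

Lemma lipschitz_dtrunc n (a b : R) :
  `|dtrunc n a - dtrunc n b| <= dtrunc_lip n * `|a - b|.
Proof.
apply: (@lipschitz_derive _ (fun t => n.+1%:R * psi 3 (n.+1%:R * t))) => x.
  exact: is_derive_dtrunc.
rewrite ger0_norm ?mulr_ge0 ?psi_ge0// ler_wpM2l//.
have [x0|x0] := ltP 0 (n.+1%:R * x); last by rewrite psi_le0// exprn_ge0.
by have := psi_bound 3 0 x0; rewrite addn0 expr0 mulr1.
Qed.

(** For positive [t] the error is [t * (1 - expR (- s))] with [s = 1 / ((n + 1) * t)], and
    [1 - expR (- s) <= s] makes it uniformly small even for large [t]. *)
Lemma trunc_approx_max n (t : R) : `|Num.max t 0 - trunc n t| <= n.+1%:R^-1.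
Proof.
have [t0|t0] := ltP 0 t; last by rewrite trunc_le0// subrr normr0.
have nt0 : 0 < n.+1%:R * t by rewrite mulr_gt0.
rewrite /trunc /psi nt0 expr0 invr1 mul1r -{1}[t]mulr1 -mulrBr.
rewrite normrM gtr0_norm// ger0_norm; last first.
  by rewrite subr_ge0 -[leRHS]expR0 ler_expR oppr_le0 invr_ge0 ltW.
apply: (@le_trans _ _ (t * (n.+1%:R * t)^-1)).
  rewrite ler_pM2l// lerBlDl -lerBlDr; exact: expR_ge1Dx.
by rewrite invfM mulrCA divff ?mulr1// gt_eqF.
Qed.

(** The limit is 0 at [t = 0], in accordance with the strict inequality in [gpos]. *)
Lemma cvg_dtrunc (t : R) : dtrunc n t @[n --> \oo] --> ((0 < t)%R%:R : R).
Proof.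
have [t0|t0] := ltP 0 t; last first.
  apply: cvg_near_cst; apply: nearW => n.
  by rewrite /dtrunc !psi_le0 ?addr0// mulr_ge0_le0.
have H : 1 - t^-1 * (n.+1%:R^-1 : R) @[n --> \oo] --> (1 : R).
  rewrite -[X in _ --> X]subr0 -(mulr0 t^-1).
  apply: cvgB; first exact: cvg_cst.
  by apply: cvgMr; exact: cvg_harmonic.
suff S : \forall n \near \oo, 1 - t^-1 * (n.+1%:R^-1 : R) <= dtrunc n t <= 1.
  have C1 : (fun=> 1 : R) @ \oo --> (1 : R) by exact: cvg_cst.
  exact: (squeeze_cvgr S H C1).
near=> n; rewrite dtrunc_le1 andbT.
have nt0 : 0 < n.+1%:R * t by rewrite mulr_gt0.
rewrite /dtrunc {1}/psi nt0 expr0 invr1 mul1r.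
apply: (@le_trans _ _ (expR (- (n.+1%:R * t)^-1))); last by rewrite lerDl psi_ge0.
by rewrite invfM [t^-1 * _]mulrC; exact: expR_ge1Dx.
Unshelve. all: by end_near. Qed.

End truncation_R.

Lemma sqrrD_le2 (R : realDomainType) (a b : R) : (a + b) ^+ 2 <= 2 * (a ^+ 2 + b ^+ 2).
Proof. by have := sqr_ge0 (a - b); nra. Qed.

Lemma lee_EFinM2l (R : realDomainType) (c : R) (x y : \bar R) : 0 <= c ->
  (x <= y -> c%:E * x <= c%:E * y)%E.
Proof. by move=> c0 xy; rewrite lee_wpmul2l// lee_fin. Qed.

(** * Comparison of integrals of squares *)

Section mass_inequalities.
Context {R : realType} {d : nat}.
Implicit Types (S U : set 'rV[R]_d) (f a b : 'rV[R]_d -> R).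

Local Notation mu := (lebesgue_rV R d).

Lemma measurable_sqE U f : measurable_fun U f ->
  measurable_fun U (fun y => (f y ^+ 2)%:E).
Proof. by move=> mf; apply/measurable_EFinP; exact: measurable_funX. Qed.

Lemma mass_mono S f a : measurable S -> measurable_fun S f -> measurable_fun S a ->
  (forall y, S y -> f y ^+ 2 <= a y ^+ 2) -> (mass S f <= mass S a)%E.
Proof.
move=> mS mf ma fa; apply: ge0_le_integral => //.
- by move=> y _; rewrite lee_fin sqr_ge0.
- exact: measurable_sqE.
- exact: measurable_sqE.
Qed.

Lemma mass_subset S U f : measurable S -> measurable U -> S `<=` U ->
  measurable_fun U f -> (mass S f <= mass U f)%E.
Proof.
move=> mS mU SU mf; apply: ge0_subset_integral => //.
  exact: measurable_sqE.
by move=> y _; rewrite lee_fin sqr_ge0.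
Qed.

(** Four summands are what the splitting of the gradient error in [trunc_approx] produces. *)
Lemma mass_le4 S f a b (e h : 'rV[R]_d -> R) (c : R) : 0 <= c -> measurable S ->
  measurable_fun S f -> measurable_fun S a -> measurable_fun S b ->
  measurable_fun S e -> measurable_fun S h ->
  (forall y, S y -> f y ^+ 2 <= c * (a y ^+ 2 + b y ^+ 2 + e y ^+ 2 + h y ^+ 2)) ->
  (mass S f <= c%:E * (mass S a + mass S b + mass S e + mass S h))%E.
Proof.
move=> c0 mS mf ma mb me mh fa.
have sq0 (k : 'rV[R]_d -> R) y : S y -> (0 <= (k y ^+ 2)%:E)%E by rewrite lee_fin sqr_ge0.
rewrite /mass.
rewrite -(ge0_integralD _ mS (@sq0 a) (measurable_sqE ma) (@sq0 b) (measurable_sqE mb)).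
have mab := emeasurable_funD (measurable_sqE ma) (measurable_sqE mb).
rewrite -(ge0_integralD _ mS _ mab (@sq0 e) (measurable_sqE me)); last first.
  by move=> y _; rewrite adde_ge0// lee_fin sqr_ge0.
have mabe := emeasurable_funD mab (measurable_sqE me).
rewrite -(ge0_integralD _ mS _ mabe (@sq0 h) (measurable_sqE mh)); last first.
  by move=> y _; rewrite !adde_ge0// lee_fin sqr_ge0.
have mabeh := emeasurable_funD mabe (measurable_sqE mh).
rewrite -ge0_integralZl_EFin//; last first.
  by move=> y _; rewrite !adde_ge0// lee_fin sqr_ge0.
apply: ge0_le_integral => //.
- exact: sq0.
- exact: measurable_sqE.
- by apply: emeasurable_funM => //; exact: measurable_cst.
Qed.

Lemma mass0 S : (mass S (fun=> 0%R) = 0)%E.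
Proof. by rewrite /mass; apply: integral0_eq => y _; rewrite expr0n. Qed.

Lemma mass_le2 S f a b (c : R) : 0 <= c -> measurable S ->
  measurable_fun S f -> measurable_fun S a -> measurable_fun S b ->
  (forall y, S y -> f y ^+ 2 <= c * (a y ^+ 2 + b y ^+ 2)) ->
  (mass S f <= c%:E * (mass S a + mass S b))%E.
Proof.
move=> c0 mS mf ma mb fa.
have m0 : measurable_fun S (fun _ : 'rV[R]_d => 0 : R) by exact: measurable_cst.
have := @mass_le4 S f a b _ _ c c0 mS mf ma mb m0 m0.
rewrite !mass0 !adde0; apply => y Sy.
by rewrite expr0n/= !addr0 fa.
Qed.

Lemma mass_cst S (c : R) : measurable S -> (mass S (fun=> c)%R = (c ^+ 2)%:E * mu S)%E.
Proof. by move=> mS; rewrite /mass integral_cst. Qed.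

Lemma massZ S f (c : R) : measurable S -> measurable_fun S f ->
  (mass S (fun y => c * f y)%R = (c ^+ 2)%:E * mass S f)%E.
Proof.
move=> mS mf; rewrite /mass -ge0_integralZl_EFin ?sqr_ge0//.
- by apply: eq_integral => y _; rewrite exprMn EFinM.
- by move=> y _; rewrite lee_fin sqr_ge0.
- exact: measurable_sqE.
Qed.

Lemma rtest_mass_lty U F f : measurable U -> rtest F f -> (mass U f < +oo)%E.
Proof.
move=> mU tf; have [M MP] := rtest_bounded tf; have [_ cK _] := tf.
have mK := measurable_compact_rV cK.
have mf := continuous_measurable_rV (rtest_continuous tf).
apply: (@le_lt_trans _ _ (mass setT f)).
  by apply: mass_subset => //; exact: measurableT.
rewrite /mass (@integral_vanish _ _ _ (supp f)) => //; last first.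
  by move=> y _ /supp_out ->; rewrite expr0n.
apply: (@le_lt_trans _ _ (mass (supp f) (fun=> M))).
  apply: mass_mono => //; first exact: measurable_funTS.
  move=> y _; rewrite -(real_normK (num_real (f y))).
  by rewrite lerXn2r ?nnegrE// (le_trans _ (MP y)).
rewrite mass_cst// lte_mul_pinfty ?lee_fin ?sqr_ge0//.
exact: compact_fin.
Qed.

End mass_inequalities.

(** * Stability of weak gradients and of the form space under limits *)

Section approximation.
Context {R : realType} {d : nat}.
Implicit Types (S U F K : set 'rV[R]_d) (u v f phi w : 'rV[R]_d -> R)
  (g G : 'I_d -> 'rV[R]_d -> R).

Local Notation mu := (lebesgue_rV R d).

(** Integrate [|w| <= e + w ^ 2 / e] over the set of finite measure [K]. *)
Lemma Rintegral_small K w phi (M e : R) : compact K -> measurable_fun K w ->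
  continuous phi -> 0 <= M -> (forall y, `|phi y| <= M) -> 0 < e ->
  (mass K w < (e ^+ 2)%:E)%E ->
  `|\int[mu]_(y in K) (w y * phi y)| <= M * e * (fine (mu K) + 1).
Proof.
move=> cK mw cphi M0 phiM e0 we; have mK := measurable_compact_rV cK.
have Kfin : mu K \is a fin_num by rewrite ge0_fin_numE// compact_fin.
have mphi : measurable_fun K phi.
  by apply: measurable_funTS; exact: continuous_measurable_rV.
have mwphi : measurable_fun K (fun y => w y * phi y) by exact: measurable_funM.
have key : (\int[mu]_(y in K) `|w y * phi y|%:E <= (M * e * (fine (mu K) + 1))%:E)%E.
  apply: (@le_trans _ _ (\int[mu]_(y in K) ((M * e)%:E + (M / e)%:E * (w y ^+ 2)%:E))%E).
    apply: ge0_le_integral => //.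
    - by apply/measurable_EFinP; exact: measurableT_comp.
    - apply/measurable_EFinP; apply: measurable_funD => //.
      by apply: measurable_funM => //; exact: measurable_funX.
    - move=> y _; rewrite -EFinM -EFinD lee_fin normrM.
      apply: (@le_trans _ _ (`|w y| * M)); first by rewrite ler_wpM2l.
      have -> : M * e + M / e * w y ^+ 2 = M * (e + w y ^+ 2 / e) by ring.
      rewrite mulrC ler_wpM2l// -lerBlDl ler_pdivlMr//.
      rewrite -(real_normK (num_real (w y))).
      have := sqr_ge0 (`|w y| - e); have := normr_ge0 (w y); nra.
  rewrite ge0_integralD//; last 3 first.
  - by move=> y _; rewrite lee_fin mulr_ge0// ltW.
  - move=> y _; rewrite -EFinM lee_fin; apply: mulr_ge0; last exact: sqr_ge0.
    by apply: divr_ge0 => //; exact: ltW.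
  - apply/measurable_EFinP; apply: measurable_funM => //; exact: measurable_funX.
  rewrite integral_cst// ge0_integralZl_EFin//; last 3 first.
  - by move=> y _; rewrite lee_fin sqr_ge0.
  - exact: measurable_sqE.
  - by rewrite divr_ge0// ltW.
  have -> : ((M * e)%:E * mu K = (M * e * fine (mu K))%:E)%E by rewrite [RHS]EFinM fineK.
  apply: (@le_trans _ _ ((M * e * fine (mu K))%:E + (M / e)%:E * (e ^+ 2)%:E)%E).
    rewrite leeD2l// lee_wpmul2l ?lee_fin ?divr_ge0// ?ltW//.
  rewrite -EFinM -EFinD lee_fin mulrDr mulr1 lerD2l.
  by rewrite expr2 mulrA divfK// gt_eqF.
have iw : mu.-integrable K (EFin \o (fun y => w y * phi y)).
  apply/integrableP; split; first exact/measurable_EFinP.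
  by apply: le_lt_trans key _; rewrite ltry.
apply: (le_trans (le_normr_Rintegral mK iw)).
rewrite -lee_fin; apply: le_trans key; rewrite /Rintegral fineK//.
have /integrableP[_ iw2] := iw.
rewrite ge0_fin_numE//.
by apply: integral_ge0.
Qed.

(** A test function sees only its compact support, so approximation on compact sets is enough, and
    the approximants may change with the compact set and the precision. *)
Lemma wgrad_limit U u g : open U -> lint U u -> (forall j, lint U (g j)) ->
  (forall K, compact K -> K `<=` U -> forall e : R, 0 < e -> exists f G,
     [/\ wgrad U f G, (mass K (fun y => u y - f y)%R < e%:E)%E &
      forall j, (mass K (fun y => g j y - G j y)%R < e%:E)%E]) ->
  wgrad U u g.
Proof.
move=> oU lu lg H; have mU := open_measurable_rV oU; split => // phi j tphi.
have tp := rtest_partial j tphi.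
have [M1 M1P] := rtest_bounded tphi; have [M2 M2P] := rtest_bounded tp.
have [_ cK KU] := tphi; set K := supp phi in cK KU.
have mK := measurable_compact_rV cK.
pose M : R := `|M1| + `|M2|.
have M0 : 0 <= M by rewrite addr_ge0.
have phiM y : `|phi y| <= M.
  by rewrite (le_trans (M1P y))// (le_trans (ler_norm _))// lerDl.
have pM y : `|partial j phi y| <= M.
  by rewrite (le_trans (M2P y))// (le_trans (ler_norm _))// lerDr.
have pK y : ~ K y -> partial j phi y = 0.
  by apply: partial_vanish; [exact: closed_closure|exact: supp_out].
apply/eqP; rewrite -subr_eq0 opprK -normr_eq0 eq_le normr_ge0 andbT.
apply/ler_addgt0Pr => e e0; rewrite add0r.
set m := fine (mu K) + 1.
have m0 : 0 < m by rewrite ltr_pwDr// fine_ge0.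
(* Each of the two errors is at most [M * e' * m], and together they make [M / (M + 1) * e]. *)
pose e' := e / (2 * (M + 1) * m).
have M10 : 0 < M + 1 by rewrite ltr_pwDr.
have e'0 : 0 < e' by rewrite divr_gt0// !mulr_gt0.
have [f [G [[lf lG wfG] Hf HG]]] := H K cK KU _ (exprn_gt0 2 e'0).
have E1 : \int[mu]_(y in U) (u y * partial j phi y) + \int[mu]_(y in U) (g j y * phi y) =
  \int[mu]_(y in K) ((u y - f y) * partial j phi y) +
  \int[mu]_(y in K) ((g j y - G j y) * phi y).
  have EU : \int[mu]_(y in K) ((u y - f y) * partial j phi y) =
      \int[mu]_(y in U) (u y * partial j phi y) - \int[mu]_(y in U) (f y * partial j phi y).
    rewrite -(@Rintegral_vanish _ _ U K _ KU); last by move=> y _ /pK ->; rewrite mulr0.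
    under eq_Rintegral do rewrite mulrBl.
    by rewrite RintegralB//; exact: lintM_integrable.
  have EG : \int[mu]_(y in K) ((g j y - G j y) * phi y) =
      \int[mu]_(y in U) (g j y * phi y) - \int[mu]_(y in U) (G j y * phi y).
    rewrite -(@Rintegral_vanish _ _ U K _ KU); last by move=> y _ /supp_out ->; rewrite mulr0.
    under eq_Rintegral do rewrite mulrBl.
    by rewrite RintegralB//; exact: (lintM_integrable mU).
  by rewrite EU EG (wfG phi j tphi); ring.
rewrite E1 (le_trans (ler_normD _ _))//.
have mS (a b : 'rV[R]_d -> R) : lint U a -> lint U b -> measurable_fun K (fun y => a y - b y).
  move=> [ma _] [mb _].
  by apply: measurable_funB; [exact: measurable_funS ma|exact: measurable_funS mb].
have h1 := Rintegral_small cK (mS _ _ lu lf) (rtest_continuous tp) M0 pM e'0 Hf.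
have h2 := Rintegral_small cK (mS _ _ (lg j) (lG j)) (rtest_continuous tphi) M0 phiM e'0 (HG j).
apply: (le_trans (lerD h1 h2)); rewrite -/m.
rewrite (_ : M * e' * m + M * e' * m = M / (M + 1) * e).
  by rewrite (ler_piMl (ltW e0))// ler_pdivrMr// mul1r lerDl.
by rewrite /e'; field; rewrite !gt_eqF.
Qed.

(** Approximability implies the rest: square integrability by comparison with a single test function
    at distance less than 1, and the weak gradient by [wgrad_limit]. *)
Lemma HD_intro F U v g : open U -> measurable_fun U v ->
  (forall j, measurable_fun U (g j)) ->
  (forall e : R, 0 < e -> exists phi, [/\ rtest (~` F) phi,
     (mass U (fun y => v y - phi y)%R < e%:E)%E &
     forall j, (mass U (fun y => g j y - partial j phi y)%R < e%:E)%E]) ->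
  HD F U v g.
Proof.
move=> oU mv mg H; have mU := open_measurable_rV oU.
have fin (a b : 'rV[R]_d -> R) : measurable_fun U a -> rtest (~` F) b ->
    (mass U (fun y => a y - b y)%R < 1)%E -> (mass U a < +oo)%E.
  move=> ma tb ab.
  have mb : measurable_fun U b.
    by apply: measurable_funTS; apply: continuous_measurable_rV; exact: rtest_continuous tb.
  have mab : measurable_fun U (fun y => a y - b y) by exact: measurable_funB.
  apply: (@le_lt_trans _ _ (2%:E * (mass U (fun y => a y - b y)%R + mass U b))%E).
    apply: mass_le2 => // y _.
    by have := sqr_ge0 (a y - b y - b y); nra.
  rewrite lte_mul_pinfty// lte_add_pinfty//; first by rewrite (lt_trans ab)// ltry.
  exact: rtest_mass_lty tb.
have [phi0 [t0 H0 H1]] := H 1 ltr01.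
have fv : (mass U v < +oo)%E by exact: fin t0 H0.
have fg j : (mass U (g j) < +oo)%E by exact: fin (rtest_partial j t0) (H1 j).
split => //; apply: wgrad_limit => //; first exact: lint_L2.
  by move=> j; exact: lint_L2.
move=> K cK KU e e0; have [phi [tphi Hf Hg]] := H e e0.
have mK := measurable_compact_rV cK.
have mphi : measurable_fun U phi.
  by apply: measurable_funTS; apply: continuous_measurable_rV; exact: rtest_continuous tphi.
have mpj j : measurable_fun U (partial j phi).
  apply: measurable_funTS; apply: continuous_measurable_rV.
  exact: rtest_continuous (rtest_partial j tphi).
exists phi, (fun j => partial j phi); split.
- by apply: wgrad_smooth => //; have [] := tphi.
- by apply: le_lt_trans Hf; apply: mass_subset => //; exact: measurable_funB.
- by move=> j; apply: le_lt_trans (Hg j); apply: mass_subset => //; exact: measurable_funB.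
Qed.

End approximation.

Section truncation.
Context {R : realType} {d : nat}.
Implicit Types (S U F K O D : set 'rV[R]_d) (u v f phi eta : 'rV[R]_d -> R)
  (g : 'I_d -> 'rV[R]_d -> R).

Local Notation mu := (lebesgue_rV R d).
Local Notation e_ j := (delta_mx ord0 j : 'rV[R]_d).

Definition upos u (h : R) : 'rV[R]_d -> R := ((u \- cst h)^\+)%R.

Definition gpos u g (h : R) : 'I_d -> 'rV[R]_d -> R :=
  fun j y => if h < u y then g j y else 0.

Lemma uposE u h y : upos u h y = Num.max (u y - h) 0.
Proof. by []. Qed.

Lemma upos_ge0 u h y : 0 <= upos u h y.
Proof. by rewrite uposE le_max lexx orbT. Qed.

Lemma upos_le_norm u h y : upos u h y <= `|u y| + `|h|.
Proof.
rewrite uposE ge_max addr_ge0// andbT (le_trans (ler_norm _))//.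
by rewrite (le_trans (ler_normB _ _)).
Qed.

Lemma measurable_upos U u h : measurable_fun U u -> measurable_fun U (upos u h).
Proof.
move=> mu0; apply: measurable_funrpos; apply: measurable_funB => //; exact: measurable_cst.
Qed.

Lemma measurable_gpos U u g h j : measurable U -> measurable_fun U u ->
  measurable_fun U (g j) -> measurable_fun U (gpos u g h j).
Proof.
move=> mU mu0 mg; apply: measurable_fun_if => //.
- by apply: measurable_fun_ltr => //; exact: measurable_cst.
- by apply: measurable_funS mg => //; exact: subIsetl.
Qed.

Lemma gpos_le u g h j y : `|gpos u g h j y| <= `|g j y|.
Proof. by rewrite /gpos; case: ifP => //; rewrite normr0. Qed.

Lemma smooth_trunc n phi h : smooth phi -> smooth (fun y => trunc n (phi y - h)).
Proof.
move=> sphi; have sB : smooth (fun y => phi y - h) by apply: smoothB => //; exact: smooth_cst.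
by apply: smoothM => //; apply: smooth_psi; exact: smoothZ.
Qed.

Lemma partial_trunc n phi h j y : smooth phi ->
  partial j (fun y => trunc n (phi y - h)) y = dtrunc n (phi y - h) * partial j phi y.
Proof.
move=> /smoothP[_ dphi _].
have dB : derivable (fun y => phi y - h) y (e_ j).
  by apply: derivableB => //; exact: derivable_cst.
have [_] := is_derive_comp_R (is_derive_trunc n (phi y - h)) dB.
rewrite /partial => ->; congr (_ * _).
have dc : derivable (fun _ : 'rV[R]_d => h) y (e_ j) by exact: derivable_cst.
by have := deriveB (dphi j y) dc; rewrite derive_cst subr0.
Qed.

Lemma lint_bounded U f f' (c : R) : measurable U -> measurable_fun U f' -> 0 <= c ->
  (forall y, `|f' y| <= `|f y| + c) -> lint U f -> lint U f'.
Proof.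
move=> mU mf' c0 ff' [mf fK]; split => // K cK KU; have mK := measurable_compact_rV cK.
have mfK : measurable_fun K (fun y => `|f y|%:E).
  by apply/measurable_EFinP; apply: measurableT_comp => //; exact: measurable_funS mf.
apply: (@le_lt_trans _ _ (\int[mu]_(y in K) (`|f y|%:E + c%:E))%E).
  apply: ge0_le_integral => //.
  - by apply/measurable_EFinP; apply: measurableT_comp => //; exact: measurable_funS mf'.
  - by apply: emeasurable_funD => //; exact: measurable_cst.
  - by move=> y _; rewrite -EFinD lee_fin.
rewrite ge0_integralD//; last first.
by rewrite integral_cst// lte_add_pinfty ?fK// lte_mul_pinfty// compact_fin.
Qed.

Lemma near_lt_ereal (f : nat -> \bar R) (e : R) : f n @[n --> \oo] --> 0%E -> 0 < e ->
  \forall n \near \oo, (f n < e%:E)%E.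
Proof.
move=> f0 e0; apply: (f0 [set x | (x < e%:E)%E]).
apply: open_nbhs_nbhs; split; first exact: open_ereal_lt_ereal.
by rewrite /= lte_fin.
Qed.

(** Dominated convergence: [dtrunc] takes values between 0 and 1, so the square of [g j]
    dominates. *)
Lemma cvg_mass_dtrunc U u g h j : measurable U -> measurable_fun U u ->
  measurable_fun U (g j) -> (mass U (g j) < +oo)%E ->
  (mass U (fun y => gpos u g h j y - dtrunc n (u y - h) * g j y)%R) @[n --> \oo] --> 0%E.
Proof.
move=> mU mu0 mg fg.
have mdt n : measurable_fun U (fun y => dtrunc n (u y - h)).
  apply: (measurableT_comp (f := dtrunc n)).
    apply: continuous_measurable_fun => t.
    apply: differentiable_continuous; apply/derivable1_diffP.
    by have [] := is_derive_dtrunc n t.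
  by apply: measurable_funB => //; exact: measurable_cst.
have mgp := measurable_gpos h mU mu0 mg.
have mF n : measurable_fun U
    (fun y => ((gpos u g h j y - dtrunc n (u y - h) * g j y) ^+ 2)%:E).
  by apply: measurable_sqE; apply: measurable_funB => //; exact: measurable_funM.
have ig : mu.-integrable U (fun y => (g j y ^+ 2)%:E).
  apply/integrableP; split; first exact: measurable_sqE.
  apply: le_lt_trans fg; apply: ge0_le_integral => //.
  - by apply: measurableT_comp => //; exact: measurable_sqE.
  - exact: measurable_sqE.
  - by move=> y _; rewrite gee0_abs// lee_fin sqr_ge0.
have bnd n y : U y ->
  (`|((gpos u g h j y - dtrunc n (u y - h) * g j y) ^+ 2)%:E| <= (g j y ^+ 2)%:E)%E.
  move=> _; rewrite lee_fin ger0_norm ?sqr_ge0// /gpos.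
  have := @dtrunc_ge0 R n (u y - h); have := @dtrunc_le1 R n (u y - h).
  set t := dtrunc _ _ => t1 t0.
  have g2 := sqr_ge0 (g j y).
  case: ifP => _.
    rewrite -{1}[g j y]mul1r -mulrBl exprMn ler_piMl// exprn_ile1// ?subr_ge0//.
    by rewrite gerBl.
  by rewrite sub0r sqrrN exprMn ler_piMl// exprn_ile1.
have cvg0 y : U y -> ((gpos u g h j y - dtrunc n (u y - h) * g j y) ^+ 2)%:E
    @[n --> \oo] --> 0%E.
  move=> _; apply: cvg_EFin; first exact: nearW.
  have Hd := @cvg_dtrunc R (u y - h).
  have : (gpos u g h j y - dtrunc n (u y - h) * g j y) @[n --> \oo] -->
      gpos u g h j y - (0 < u y - h)%R%:R * g j y.
    by apply: cvgB; [exact: cvg_cst|apply: cvgMl].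
  have -> : gpos u g h j y - (0 < u y - h)%R%:R * g j y = 0.
    by rewrite /gpos subr_gt0; case: ifP => _; rewrite ?mul1r ?mul0r subrr.
  move=> H0; have H2 := cvgM H0 H0; rewrite mulr0 in H2.
  rewrite (_ : fine \o _ = (fun n => gpos u g h j y - dtrunc n (u y - h) * g j y) \*
    (fun n => gpos u g h j y - dtrunc n (u y - h) * g j y)); first exact: H2.
  by apply/funext => n /=; rewrite expr2.
have fing y : U y -> (g j y ^+ 2)%:E \is a fin_num by [].
have := dominated_cvg mU mF cvg0 fing ig bnd.
by rewrite integral0.
Qed.

(** The order of the choices matters. The smoothing index [n] comes first, and the finite measure of
    [S] makes its uniform error small in the mean. A test function [phi0] with gradient close to [g]
    is fixed next, because its gradient is bounded. Last comes [phi], close to [u] relative to that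
    bound and to the Lipschitz constant of [dtrunc n], which grows with [n]. *)
Lemma trunc_approx O D S u g h : open O -> HD D O u g -> measurable S -> S `<=` O ->
  (mu S < +oo)%E -> forall e : R, 0 < e -> exists n phi, [/\ rtest (~` D) phi,
    (mass S (fun y => upos u h y - trunc n (phi y - h))%R < e%:E)%E &
    forall j, (mass S (fun y => gpos u g h j y -
      dtrunc n (phi y - h) * partial j phi y)%R < e%:E)%E].
Proof.
move=> oO [[lu lg _] fu fg Ha] mS SO Sfin e e0; have mO := open_measurable_rV oO.
have mu0 := lu.1; have mg j := (lg j).1.
(* The gradient error is at most 4 times the sum of four errors of size [e1], and 16/20 is less than
   1. *)
pose e1 : R := e / 20.
have e10 : 0 < e1 by rewrite divr_gt0.
have Sf : mu S \is a fin_num by rewrite ge0_fin_numE.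
pose m : R := fine (mu S).
have m0 : 0 <= m by rewrite fine_ge0.
have : exists n : nat, n.+1%:R^-1 ^+ 2 * m < e1 /\ forall j,
   (mass O (fun y => gpos u g h j y - dtrunc n (u y - h) * g j y)%R < e1%:E)%E.
  have N1 : \forall n \near \oo, forall j,
      (mass O (fun y => gpos u g h j y - dtrunc n (u y - h) * g j y)%R < e1%:E)%E.
    by apply: filter_forall => j; apply: near_lt_ereal => //; exact: cvg_mass_dtrunc.
  have N2 : \forall n \near \oo, (n.+1%:R^-1 : R) < e1 / (m + 1).
    have : 0 < e1 / (m + 1) by rewrite divr_gt0// ltr_pwDr.
    by move=> em0; exact: near_infty_natSinv_lt (PosNum em0).
  near \oo => n; exists n; split; last by near: n.
  have n1 : n.+1%:R^-1 < e1 / (m + 1) by near: n.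
  have n0 : 0 < n.+1%:R^-1 :> R by rewrite invr_gt0.
  have nl1 : n.+1%:R^-1 <= 1 :> R by rewrite invf_le1// ler1n.
  apply: (@le_lt_trans _ _ (n.+1%:R^-1 * m)).
    by rewrite ler_wpM2r// expr2 ler_piMr// ltW.
  apply: (@le_lt_trans _ _ (n.+1%:R^-1 * (m + 1))).
    by rewrite ler_wpM2l ?(ltW n0)// lerDl.
  by rewrite -ltr_pdivlMr// ltr_pwDr.
move=> [n [Hn1 Hn2]].
have [phi0 [t0 _ H0]] := Ha e1 e10.
have : exists M : R, 0 <= M /\ forall j y, `|partial j phi0 y| <= M.
  have /choice[M MP] : forall j, exists M, forall y, `|partial j phi0 y| <= M.
    by move=> j; exact: rtest_bounded (rtest_partial j t0).
  exists (\sum_j `|M j|); split; first by apply: sumr_ge0.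
  move=> j y; rewrite (le_trans (MP j y))// (le_trans (ler_norm _))//.
  by rewrite (bigD1 j)//= lerDl sumr_ge0.
move=> [M [M0 MP]].
(* [L] bounds the Lipschitz constant of [dtrunc n] times the gradient of [phi0]; [e2] is such that
   [L ^+ 2 * e2 <= e1]. *)
pose L : R := dtrunc_lip n * M.
have L0 : 0 <= L by rewrite mulr_ge0// ltW// dtrunc_lip_gt0.
pose e2 : R := e1 / (L ^+ 2 + 1).
have L20 : 0 < L ^+ 2 + 1 by rewrite ltr_wpDl// sqr_ge0.
have e20 : 0 < e2 by rewrite divr_gt0.
have e21 : e2 <= e1 by rewrite ler_pdivrMr// ler_peMr ?(ltW e10)// lerDr sqr_ge0.
have [phi [tphi Hf Hg]] := Ha e2 e20.
have [sphi0 _ _] := t0; have [sphi _ _] := tphi.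
have mcont f : continuous f -> measurable_fun S f.
  by move=> cf; apply: measurable_funTS; exact: continuous_measurable_rV.
have mphi := mcont _ (rtest_continuous tphi).
have mp0 j := mcont _ (rtest_continuous (rtest_partial j t0)).
have mp j := mcont _ (rtest_continuous (rtest_partial j tphi)).
have muS := measurable_funS mO SO mu0.
have mgS j := measurable_funS mO SO (mg j).
have mT (f : 'rV[R]_d -> R) : measurable_fun S f -> measurable_fun S (fun y => trunc n (f y - h)).
  move=> mf; apply: (measurableT_comp (f := trunc n)).
    apply: continuous_measurable_fun => t.
    apply: differentiable_continuous; apply/derivable1_diffP.
    by have [] := is_derive_trunc n t.
  by apply: measurable_funB => //; exact: measurable_cst.
have mdT (f : 'rV[R]_d -> R) : measurable_fun S f -> measurable_fun S (fun y => dtrunc n (f y - h)).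
  move=> mf; apply: (measurableT_comp (f := dtrunc n)).
    apply: continuous_measurable_fun => t.
    apply: differentiable_continuous; apply/derivable1_diffP.
    by have [] := is_derive_dtrunc n t.
  by apply: measurable_funB => //; exact: measurable_cst.
have mup := measurable_upos h muS.
have mgp j := measurable_gpos h mS muS (mgS j).
have muphi : measurable_fun S (fun y => u y - phi y) by exact: measurable_funB.
have mguphi : (mass S (fun y => u y - phi y)%R < e2%:E)%E.
  apply: le_lt_trans Hf; apply: mass_subset => //.
  apply: measurable_funB => //; apply: measurable_funTS.
  exact: continuous_measurable_rV (rtest_continuous tphi).
have massO j (f : 'rV[R]_d -> R) : continuous f ->
    (mass S (fun y => g j y - f y)%R <= mass O (fun y => g j y - f y)%R)%E.
  move=> cf; apply: mass_subset => //; apply: measurable_funB => //.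
  by apply: measurable_funTS; exact: continuous_measurable_rV.
exists n, phi; split => //.
- apply: (@le_lt_trans _ _ (2%:E *
    (mass S (fun=> n.+1%:R^-1)%R + mass S (fun y => u y - phi y)%R))%E).
    apply: mass_le2 => //.
    + by apply: measurable_funB => //; exact: mT.
    + move=> y _; have h1 := @trunc_approx_max R n (u y - h).
      have h2 := @lipschitz_trunc R n (u y - h) (phi y - h).
      rewrite opprB addrA subrK in h2.
      have -> : upos u h y - trunc n (phi y - h) = (upos u h y - trunc n (u y - h))
          + (trunc n (u y - h) - trunc n (phi y - h)) by rewrite addrA subrK.
      have h1' : (upos u h y - trunc n (u y - h)) ^+ 2 <= n.+1%:R^-1 ^+ 2.
        by rewrite -real_normK ?num_real// lerXn2r// nnegrE// invr_ge0.
      have h2' : (trunc n (u y - h) - trunc n (phi y - h)) ^+ 2 <= (u y - phi y) ^+ 2.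
        rewrite -real_normK ?num_real// -[leRHS]real_normK ?num_real//.
        by rewrite lerXn2r// nnegrE.
      by apply: (le_trans (sqrrD_le2 _ _)); rewrite ler_pM2l// lerD.
  rewrite mass_cst// -(fineK Sf) -EFinM -/m.
  have : (mass S (fun y => (u y - phi y)%R) <= e1%:E)%E.
    by rewrite (le_trans (ltW mguphi))// lee_fin.
  move=> /(leeD2l (n.+1%:R^-1 ^+ 2 * m)%:E) /(lee_EFinM2l (ler0n R 2)).
  move/le_lt_trans; apply; rewrite -EFinD -EFinM lte_fin.
  by move: (_ ^+ 2 * m) Hn1 => X; rewrite /e1; lra.
- move=> j.
  apply: (@le_lt_trans _ _ (4%:E * (
    mass S (fun y => gpos u g h j y - dtrunc n (u y - h) * g j y)%R +
    mass S (fun y => g j y - partial j phi0 y)%R +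
    mass S (fun y => L * (u y - phi y))%R +
    mass S (fun y => g j y - partial j phi y)%R))%E).
    apply: mass_le4 => //.
    + apply: measurable_funB => //; apply: measurable_funM => //; exact: mdT.
    + apply: measurable_funB => //; apply: measurable_funM => //; exact: mdT.
    + exact: measurable_funB.
    + by apply: measurable_funM => //; exact: measurable_cst.
    + exact: measurable_funB.
    + move=> y _.
      have := @lipschitz_dtrunc R n (u y - h) (phi y - h).
      rewrite opprB addrA subrK => h2.
      have := MP j y.
      have := @dtrunc_ge0 R n (u y - h); have := @dtrunc_le1 R n (u y - h).
      have := @dtrunc_ge0 R n (phi y - h); have := @dtrunc_le1 R n (phi y - h).
      move: h2; set a := dtrunc n (u y - h); set b := dtrunc n (phi y - h).
      set p0 := partial j phi0 y; set p := partial j phi y.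
      move=> hL b1 b0 a1 a0 pM.
      have h3 : ((a - b) * (g j y - p0)) ^+ 2 <= (g j y - p0) ^+ 2.
        rewrite exprMn ler_piMl ?sqr_ge0// -real_normK ?num_real// exprn_ile1//.
        by rewrite ler_norml; apply/andP; split; lra.
      have h4 : (b * (g j y - p)) ^+ 2 <= (g j y - p) ^+ 2.
        by rewrite exprMn ler_piMl ?sqr_ge0// exprn_ile1.
      have h5 : ((a - b) * p0) ^+ 2 <= (L * (u y - phi y)) ^+ 2.
        rewrite -real_normK ?num_real// -[leRHS]real_normK ?num_real//.
        rewrite lerXn2r ?nnegrE// normrM (normrM L) (ger0_norm L0).
        by rewrite /L mulrAC ler_pM.
      (* In the second term [a - b] is only known to be at most 1 in modulus, but [g j y - p0] is
         small in the mean; in the third [p0] is bounded and the Lipschitz estimate controls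
         [a - b]. *)
      have -> : gpos u g h j y - b * p = (gpos u g h j y - a * g j y) +
         (a - b) * (g j y - p0) + (a - b) * p0 + b * (g j y - p) by ring.
      move: h3 h4 h5.
      set X1 := gpos u g h j y - _; set X2 := (a - b) * (g j y - p0).
      set X3 := (a - b) * p0; set X4 := b * _ => h3 h4 h5.
      apply: (@le_trans _ _ (4 * (X1 ^+ 2 + X2 ^+ 2 + X3 ^+ 2 + X4 ^+ 2))).
        have := sqr_ge0 (X1 - X2); have := sqr_ge0 (X1 - X3); have := sqr_ge0 (X1 - X4).
        have := sqr_ge0 (X2 - X3); have := sqr_ge0 (X2 - X4); have := sqr_ge0 (X3 - X4).
        nra.
      by rewrite ler_pM2l//; apply: lerD => //; apply: lerD => //; apply: lerD.
  have K1 : (mass S (fun y => gpos u g h j y - dtrunc n (u y - h) * g j y)%R <= e1%:E)%E.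
    apply: ltW; apply: le_lt_trans (Hn2 j); apply: mass_subset => //.
    apply: measurable_funB; first exact: measurable_gpos.
    apply: measurable_funM => //; apply: (measurableT_comp (f := dtrunc n)).
      apply: continuous_measurable_fun => t.
      apply: differentiable_continuous; apply/derivable1_diffP.
      by have [] := is_derive_dtrunc n t.
    by apply: measurable_funB => //; exact: measurable_cst.
  have K2 : (mass S (fun y => g j y - partial j phi0 y)%R <= e1%:E)%E.
    apply: ltW; apply: le_lt_trans (H0 j); apply: massO.
    exact: rtest_continuous (rtest_partial j t0).
  have K3 : (mass S (fun y => L * (u y - phi y))%R <= e1%:E)%E.
    rewrite massZ//; apply: (@le_trans _ _ ((L ^+ 2)%:E * e2%:E)%E).
      by rewrite lee_wpmul2l ?lee_fin ?sqr_ge0//; exact: ltW.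
    rewrite -EFinM lee_fin /e2 mulrA ler_pdivrMr// mulrC ler_wpM2l ?(ltW e10)//.
    by rewrite lerDl.
  have K4 : (mass S (fun y => g j y - partial j phi y)%R <= e1%:E)%E.
    apply: (@le_trans _ _ e2%:E); last by rewrite lee_fin.
    apply: ltW; apply: le_lt_trans (Hg j); apply: massO.
    exact: rtest_continuous (rtest_partial j tphi).
  have := leeD (leeD (leeD K1 K2) K3) K4.
  move=> /(lee_EFinM2l (ler0n R 4)).
  move/le_lt_trans; apply; rewrite -!EFinD -EFinM lte_fin /e1.
  lra.
Unshelve. all: by end_near. Qed.

(** At a negative level the truncation need not be square integrable on an unbounded [O], so the
    argument stays local: approximation on compact sets and [wgrad_limit]. *)
Lemma wgrad_pos O D u g h : open O -> HD D O u g -> wgrad O (upos u h) (gpos u g h).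
Proof.
move=> oO Hu; have mO := open_measurable_rV oO.
have [[lu lg _] _ _ _] := Hu.
have lup : lint O (upos u h).
  apply: (lint_bounded (c := `|h|) mO _ _ _ lu) => //.
    by apply: measurable_upos; exact: lu.1.
  by move=> y; rewrite ger0_norm ?upos_ge0// upos_le_norm.
have lgp j : lint O (gpos u g h j).
  apply: (lint_bounded (c := 0) mO _ _ _ (lg j)) => //.
    by apply: measurable_gpos => //; [exact: lu.1|exact: (lg j).1].
  by move=> y; rewrite addr0 gpos_le.
apply: wgrad_limit => // K cK KO e e0.
have [n [phi [[sphi _ _] H0 H1]]] :=
  trunc_approx h oO Hu (measurable_compact_rV cK) KO (compact_fin cK) e0.
exists (fun y => trunc n (phi y - h)), (fun j y => dtrunc n (phi y - h) * partial j phi y).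
split => //.
apply: (eq_wgrad _ _ (wgrad_smooth oO (smooth_trunc n h sphi))) => // j y.
exact: partial_trunc.
Qed.

(* A truncation at a negative level need not vanish near [D], hence the last
   hypothesis. The Dirichlet part [F] of the boundary of [U] matters only inside
   the ball that supports [eta]. *)
Lemma HD_cut O D U F (x : 'rV[R]_d) (s : R) u g h eta : open O -> open U -> U `<=` O ->
  HD D O u g -> F `&` eball x s `<=` D ->
  rtest (eball x s) eta -> (0 <= h \/ eball x s `&` D = set0) ->
  HD F U (fun y => eta y * upos u h y)
    (fun j y => eta y * gpos u g h j y + upos u h y * partial j eta y).
Proof.
move=> oO oU UO Hu FD teta hD.
have mO := open_measurable_rV oO; have mU := open_measurable_rV oU.
have [[lu lg _] _ _ _] := Hu.
have [seta cK KB] := teta; set K := supp eta in cK KB.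
have mK := measurable_compact_rV cK.
have muU := measurable_funS mO UO lu.1.
have mgU j := measurable_funS mO UO (lg j).1.
have mcont (V : set 'rV[R]_d) f : continuous f -> measurable_fun V f.
  by move=> cf; apply: measurable_funTS; exact: continuous_measurable_rV.
have ceta := rtest_continuous teta.
have cpeta j := rtest_continuous (rtest_partial j teta).
have mup := measurable_upos h muU.
have mgp j := measurable_gpos h mU muU (mgU j).
apply: HD_intro => //.
- by apply: measurable_funM => //; exact: mcont.
- move=> j; apply: measurable_funD; apply: measurable_funM => //; exact: mcont.
move=> e e0.
have : exists M : R, [/\ 0 <= M, forall y, `|eta y| <= M &
    forall j y, `|partial j eta y| <= M].
  have [M0 M0P] := rtest_bounded teta.
  have /choice[M MP] : forall j, exists M, forall y, `|partial j eta y| <= M.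
    by move=> j; exact: rtest_bounded (rtest_partial j teta).
  exists (`|M0| + \sum_j `|M j|); split; first by rewrite addr_ge0// sumr_ge0.
    move=> y; rewrite (le_trans (M0P y))// (le_trans (ler_norm _))// lerDl.
    by rewrite sumr_ge0.
  move=> j y; rewrite (le_trans (MP j y))// (le_trans (ler_norm _))//.
  by rewrite (bigD1 j)//= addrCA lerDl addr_ge0// sumr_ge0.
move=> [M [M0 etaM petaM]].
(* The gradient of the product has two errors of at most [M ^+ 2 * e1] each, doubled by the square
   of a sum; the added 1 makes the total strictly smaller than [e]. *)
pose e1 : R := e / (4 * M ^+ 2 + 1).
have M20 : 0 < 4 * M ^+ 2 + 1 by rewrite ltr_wpDl// mulr_ge0// sqr_ge0.
have e10 : 0 < e1 by rewrite divr_gt0.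
have e1E : e1 * (4 * M ^+ 2 + 1) = e by rewrite divfK// gt_eqF.
pose S := U `&` K.
have mS : measurable S by exact: measurableI.
have SO : S `<=` O by move=> y [/UO].
have Sfin : (mu S < +oo)%E.
  apply: le_lt_trans (compact_fin cK); apply: le_measure; rewrite ?inE//.
  exact: subIsetr.
have [n [phi [tphi H0 H1]]] := trunc_approx h oO Hu mS SO Sfin e10.
have [sphi cphi sphiD] := tphi.
have sT := smooth_trunc n h sphi.
have sTeta := smoothM seta sT.
have peta_out j y : ~ K y -> partial j eta y = 0.
  by apply: partial_vanish; [exact: closed_closure|exact: supp_out].
have /smoothP[cT dT _] := sT; have /smoothP[_ deta _] := seta.
have SU : S `<=` U by exact: subIsetl.
have massS (f : 'rV[R]_d -> R) : (forall y, ~ K y -> f y = 0) -> mass U f = mass S f.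
  move=> f0; rewrite /mass (integral_vanish SU)// => y Uy Sy.
  by rewrite f0 ?expr0n// => Ky; apply: Sy.
exists (fun y => eta y * trunc n (phi y - h)); split.
(* For [0 <= h] the smooth truncation vanishes wherever [phi] does, so the product inherits a
   support away from [D]. Otherwise the ball misses [D], hence also [F], and the support of [eta]
   suffices. *)
- have [h0|BD] := hD; last first.
    apply: (rtest_supp cK) => //; last by move=> y /supp_out ->; rewrite mul0r.
    move=> y /KB By Fy; suff : set0 y by [].
    by rewrite -BD; split => //; apply: FD.
  have cKK : compact (K `&` supp phi).
    by apply: (subclosed_compact _ cK) => //; apply: closedI; exact: closed_closure.
  apply: (rtest_supp cKK) => //.
    by move=> y [/KB By /sphiD Dy] Fy; apply: Dy; apply: FD.
  move=> y /not_andP[/supp_out ->|/supp_out ->]; first by rewrite mul0r.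
  by rewrite sub0r trunc_le0 ?mulr0// oppr_le0.
- rewrite massS; last by move=> y /supp_out ->; rewrite !mul0r subr0.
  have mf0 : measurable_fun S (fun y => upos u h y - trunc n (phi y - h)).
    apply: measurable_funB; last exact: mcont.
    exact: measurable_funS mup.
  apply: (@le_lt_trans _ _ (mass S (fun y => M * (upos u h y - trunc n (phi y - h)))%R)).
    apply: mass_mono => //.
    + apply: measurable_funB; apply: measurable_funM; try exact: mcont.
      exact: measurable_funS mup.
    + by apply: measurable_funM => //; exact: measurable_cst.
    + move=> y _; rewrite -mulrBr !exprMn ler_wpM2r ?sqr_ge0//.
      by rewrite -real_normK ?num_real// lerXn2r ?nnegrE.
  rewrite massZ//.
  apply: (@le_lt_trans _ _ ((M ^+ 2)%:E * e1%:E)%E).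
    by rewrite lee_wpmul2l ?lee_fin ?sqr_ge0//; exact: ltW.
  by rewrite -EFinM lte_fin -e1E; have := sqr_ge0 M; nra.
- move=> j.
  have E y : partial j (fun y => eta y * trunc n (phi y - h)) y =
      eta y * (dtrunc n (phi y - h) * partial j phi y) + trunc n (phi y - h) * partial j eta y.
    by rewrite partialM// partial_trunc.
  rewrite massS; last first.
    by move=> y Ky; rewrite E (supp_out Ky) peta_out// !mul0r !mulr0 addr0 subr0.
  have mf0 : measurable_fun S (fun y => upos u h y - trunc n (phi y - h)).
    apply: measurable_funB; last exact: mcont.
    exact: measurable_funS mup.
  have cdT : continuous (fun y => dtrunc n (phi y - h) * partial j phi y).
    have EpT : partial j (fun y => trunc n (phi y - h)) =
        (fun y => dtrunc n (phi y - h) * partial j phi y).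
      by apply/funext => y; rewrite partial_trunc.
    by rewrite -EpT; have /smoothP[_ _ /(_ j)/smoothP[]] := sT.
  have mf1 : measurable_fun S (fun y => gpos u g h j y - dtrunc n (phi y - h) * partial j phi y).
    apply: measurable_funB; last exact: mcont.
    exact: measurable_funS (mgp j).
  apply: (@le_lt_trans _ _ (2%:E * (
    mass S (fun y => M * (gpos u g h j y - dtrunc n (phi y - h) * partial j phi y))%R +
    mass S (fun y => M * (upos u h y - trunc n (phi y - h)))%R))%E).
    apply: mass_le2 => //.
    + apply: measurable_funB.
        apply: measurable_funD; apply: measurable_funM; try exact: mcont.
          exact: measurable_funS (mgp j).
        exact: measurable_funS mup.
      apply: mcont; have /smoothP[_ _ /(_ j)/smoothP[]] := sTeta.
      by [].
    + by apply: measurable_funM => //; exact: measurable_cst.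
    + by apply: measurable_funM => //; exact: measurable_cst.
    + move=> y _; rewrite E.
      set A := gpos u g h j y; set B := dtrunc n (phi y - h) * _.
      set P := upos u h y; set T := trunc n _.
      have -> : eta y * A + P * partial j eta y - (eta y * B + T * partial j eta y) =
         eta y * (A - B) + partial j eta y * (P - T) by ring.
      have q1 : (eta y * (A - B)) ^+ 2 <= (M * (A - B)) ^+ 2.
        rewrite !exprMn ler_wpM2r ?sqr_ge0//.
        by rewrite -real_normK ?num_real// lerXn2r ?nnegrE.
      have q2 : (partial j eta y * (P - T)) ^+ 2 <= (M * (P - T)) ^+ 2.
        rewrite !exprMn ler_wpM2r ?sqr_ge0//.
        by rewrite -real_normK ?num_real// lerXn2r ?nnegrE.
      by apply: (le_trans (sqrrD_le2 _ _)); rewrite ler_pM2l// lerD.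
  rewrite !massZ//.
  have J0 := lee_EFinM2l (sqr_ge0 M) (ltW H0).
  have J1 := lee_EFinM2l (sqr_ge0 M) (ltW (H1 j)).
  have := leeD J1 J0.
  move=> /(lee_EFinM2l (ler0n R 2)).
  move/le_lt_trans; apply; rewrite -!(EFinM, EFinD) lte_fin -e1E.
  by have := sqr_ge0 M; nra.
Qed.

End truncation.

(** * De Giorgi iteration *)

Section iteration.
Context {R : realType}.
Implicit Types (theta K : R) (phi m : R -> R -> R).

(** Growth per step: halving the gap of the radii multiplies [(rho - r)^-2] by 4, and halving the
    gap of the levels multiplies the power [-2 * (theta - 1)] of it by the other factor. *)
Definition iteration_base theta : R := 4 * 4 `^ (theta - 1).
(** Its power [theta - 1] is the inverse of the base, so geometric decay at this rate reproduces
    itself under the superlinear recursion. *)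
Definition iteration_ratio theta : R := iteration_base theta `^ (- (theta - 1)^-1).
(** The cost of the first step, where the radii differ by 1/4 and the levels by [H / 2]; the power
    of [H] is kept apart. *)
Definition iteration_factor theta K : R := 16 * K * 4 `^ (theta - 1).

(** Solves [iteration_const_powR], the smallness condition that starts the decay; the added 1 keeps
    it positive for [K = 0]. *)
Definition iteration_const theta K : R :=
  Num.sqrt (((iteration_factor theta K + 1) / iteration_ratio theta) `^ (theta - 1)^-1).

Lemma ler_powRl (a x y : R) : 0 <= a -> 0 <= x -> x <= y -> x `^ a <= y `^ a.
Proof.
by move=> a0 x0 xy; apply: (ge0_ler_powR a0) => //; rewrite nnegrE// (le_trans x0).
Qed.

Lemma one_powR (a : R) : 1 `^ a = 1 :> R.
Proof. by rewrite powR1. Qed.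

Lemma iteration_base_gt1 theta : 1 < theta -> 1 < iteration_base theta.
Proof.
move=> th1; have : 1 <= 4 `^ (theta - 1) :> R.
  rewrite -{1}(one_powR (theta - 1)); apply: ler_powRl => //.
    by rewrite subr_ge0 ltW.
  by rewrite ler1n.
by rewrite /iteration_base; lra.
Qed.

Lemma iteration_ratio_gt0 theta : 0 < iteration_ratio theta.
Proof. by rewrite powR_gt0// mulr_gt0// powR_gt0. Qed.

Lemma iteration_ratio_lt1 theta : 1 < theta -> iteration_ratio theta < 1.
Proof.
move=> th1; have b1 := iteration_base_gt1 th1.
have b0 : 0 < iteration_base theta by rewrite (lt_trans _ b1).
rewrite /iteration_ratio powRN invf_lt1 ?powR_gt0//.
rewrite -{1}(one_powR (theta - 1)^-1).
by apply: gt0_ltr_powR => //; rewrite ?invr_gt0 ?subr_gt0// nnegrE ltW.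
Qed.

Lemma iteration_factor_ge0 theta K : 0 <= K -> 0 <= iteration_factor theta K.
Proof. by move=> K0; rewrite !mulr_ge0// powR_ge0. Qed.

Lemma iteration_const_arg_gt0 theta K : 0 <= K ->
  0 < (iteration_factor theta K + 1) / iteration_ratio theta.
Proof.
move=> K0; rewrite divr_gt0 ?iteration_ratio_gt0//.
by rewrite ltr_wpDl// iteration_factor_ge0.
Qed.

Lemma iteration_const_gt0 theta K : 0 <= K -> 0 < iteration_const theta K.
Proof. by move=> K0; rewrite sqrtr_gt0 powR_gt0// iteration_const_arg_gt0. Qed.

Lemma iteration_const_powR theta K : 1 < theta -> 0 <= K ->
  (iteration_const theta K ^+ 2) `^ (theta - 1) =
  (iteration_factor theta K + 1) / iteration_ratio theta.
Proof.
move=> th1 K0; rewrite sqr_sqrtr ?powR_ge0// -powRrM mulVf ?powRr1//.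
  by rewrite ltW// iteration_const_arg_gt0.
by rewrite subr_eq0 gt_eqF.
Qed.

Lemma geometric_le0 (a C mu : R) : 0 <= mu < 1 ->
  (forall j : nat, a <= C * mu ^+ j) -> a <= 0.
Proof.
move=> /andP[mu0 mu1] H.
have cv : C * mu ^+ j @[j --> \oo] --> (C * 0 : R).
  by apply: cvgMr; apply: cvg_expr; rewrite ger0_norm.
rewrite mulr0 in cv; rewrite -(cvg_lim _ cv)//.
by apply: limr_ge; [apply/cvg_ex; exists 0|exact: nearW].
Qed.

Lemma powR_exprn (x a : R) (n : nat) : 0 <= x -> (x ^+ n) `^ a = (x `^ a) ^+ n.
Proof.
by move=> x0; rewrite -powR_mulrn// -powRrM mulrC powRrM powR_mulrn// powR_ge0.
Qed.

(** At the limit level [k0 + H] the product vanishes, so one of its factors does. A vanishing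
    measure persists at higher levels; a vanishing integral forces measure 0 only at strictly higher
    levels, by Chebyshev's inequality. Hence the strict inequality before the conclusion. *)
Lemma degiorgi_iteration theta K phi m k0 (H : R) : 1 < theta -> 0 <= K ->
  (forall h r, 0 <= phi h r) -> (forall h r, 0 <= m h r) ->
  (forall h r rho, k0 <= h -> 2^-1 <= r -> r < rho -> rho <= 1 ->
     phi h r <= K * (rho - r)^-1 ^+ 2 * m h rho `^ (theta * (theta - 1)) * phi h rho) ->
  (forall h h' r, h' <= h -> phi h r <= phi h' r) ->
  (forall h h' r, h' <= h -> m h r <= m h' r) ->
  (forall h r rho, r <= rho -> phi h r <= phi h rho) ->
  (forall h r rho, r <= rho -> m h r <= m h rho) ->
  (forall h h' r, h' < h -> m h r <= (h - h')^-1 ^+ 2 * phi h' r) ->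
  0 < H -> iteration_const theta K ^+ 2 * (phi k0 1 * m k0 1 `^ (theta - 1)) <= H ^+ 2 ->
  forall h, k0 + H < h -> m h 2^-1 = 0.
Proof.
move=> th1 K0 phi0 m0 Hphi phih mh phir mr Hm H0 HH h hH.
have t0 : 0 < theta - 1 by rewrite subr_gt0.
have th0 : 0 < theta by rewrite (lt_trans _ th1).
pose Psi h r := phi h r * m h r `^ (theta - 1).
have Psi0 h' r : 0 <= Psi h' r by rewrite mulr_ge0// powR_ge0.
(* Chebyshev's inequality to the power [theta - 1] raises the exponent of [phi] from 1 to [theta],
   and the exponent [theta * (theta - 1)] of [m] completes the [theta]-th power of the product at
   the lower level. *)
have step h1 h2 r rho : k0 <= h1 -> h1 < h2 -> 2^-1 <= r -> r < rho -> rho <= 1 ->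
    Psi h2 r <= K * (rho - r)^-1 ^+ 2 * ((h2 - h1)^-1 ^+ 2) `^ (theta - 1) * Psi h1 rho `^ theta.
  move=> kh1 h12 r2 rrho rho1.
  have e1 : phi h2 r <= K * (rho - r)^-1 ^+ 2 * m h1 rho `^ (theta * (theta - 1)) * phi h1 rho.
    apply: (le_trans (Hphi _ _ _ (le_trans kh1 (ltW h12)) r2 rrho rho1)).
    apply: ler_pM => //; last exact: phih (ltW h12).
      by rewrite mulr_ge0 ?powR_ge0// mulr_ge0// sqr_ge0.
    rewrite ler_wpM2l//; first by apply: mulr_ge0 => //; exact: sqr_ge0.
    apply: ler_powRl => //; last exact: mh (ltW h12).
    by apply: mulr_ge0; exact: ltW.
  have e2 : m h2 r `^ (theta - 1) <=
      ((h2 - h1)^-1 ^+ 2) `^ (theta - 1) * phi h1 rho `^ (theta - 1).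
    rewrite -powRM ?sqr_ge0//; apply: ler_powRl => //; first exact: ltW.
    apply: (le_trans (Hm _ _ _ h12)).
    by rewrite ler_wpM2l ?sqr_ge0//; exact: phir (ltW rrho).
  apply: (le_trans (ler_pM (phi0 _ _) (powR_ge0 _ _) e1 e2)).
  rewrite /Psi powRM ?powR_ge0// -powRrM [(theta - 1) * theta]mulrC.
  rewrite -(mulr_powRB1 (phi0 h1 rho) th0).
  by rewrite le_eqVlt; apply/orP; left; apply/eqP; ring.
(* [Psi] decays geometrically along these levels and radii: [step] gains the
   power [theta] and loses only a factor [b ^+ j]. *)
pose kk (j : nat) := k0 + H * (1 - 2^-1 ^+ j).
pose rr (j : nat) : R := 2^-1 * (1 + 2^-1 ^+ j).
pose P j := Psi (kk j) (rr j).
set b := iteration_base theta; set mu := iteration_ratio theta.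
set A := iteration_factor theta K.
have b1 : 1 < b by exact: iteration_base_gt1.
have b0 : 0 < b by rewrite (lt_trans _ b1).
have mu0 : 0 < mu by exact: iteration_ratio_gt0.
have mub : mu `^ (theta - 1) = b^-1.
  by rewrite /mu /iteration_ratio -/b -powRrM mulNr mulVf ?gt_eqF// powR_inv1// ltW.
have half0 j : 0 < 2^-1 ^+ j :> R by rewrite exprn_gt0// invr_gt0.
have half1 j : 2^-1 ^+ j <= 1 :> R by rewrite exprn_ile1// ?invr_ge0// invf_le1// ler1n.
have halfS j : 2^-1 ^+ j.+1 < 2^-1 ^+ j :> R.
  by rewrite exprS gtr_pMl// invf_lt1// ltr1n.
have Hn : 0 <= (H^-1) ^+ 2 by exact: sqr_ge0.
have stepj j : P j.+1 <= A * b ^+ j * ((H^-1) ^+ 2) `^ (theta - 1) * P j `^ theta.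
  have kj : k0 <= kk j by rewrite lerDl mulr_ge0 ?(ltW H0)// subr_ge0.
  have kjS : kk j < kk j.+1 by rewrite ltrD2l ltr_pM2l// ltrD2l ltrN2.
  have rj : 2^-1 <= rr j.+1 by rewrite ler_peMr ?invr_ge0// lerDl ltW.
  have rjS : rr j.+1 < rr j by rewrite ltr_pM2l ?invr_gt0// ltrD2l.
  have rj1 : rr j <= 1 by rewrite /rr; have := half1 j; lra.
  apply: (le_trans (step _ _ _ _ kj kjS rj rjS rj1)).
  have E4 : 4 = 2 ^+ 2 :> R by rewrite -natrX.
  have E16 : 16 = 4 ^+ 2 :> R by rewrite -natrX.
  have -> : (rr j - rr j.+1)^-1 ^+ 2 = 16 * 4 ^+ j.
    have -> : rr j - rr j.+1 = 4^-1 * 2^-1 ^+ j.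
      by rewrite /rr exprS; move: (2^-1 ^+ j) => p; field.
    by rewrite invfM invrK -exprVn invrK exprMn -exprM mulnC exprM -E16 -E4.
  have -> : (kk j.+1 - kk j)^-1 ^+ 2 = (H^-1) ^+ 2 * (4 * 4 ^+ j).
    have -> : kk j.+1 - kk j = H * (2^-1 * 2^-1 ^+ j).
      by rewrite /kk exprS; move: (2^-1 ^+ j) => p; field.
    by rewrite !invfM invrK -exprVn invrK !exprMn -exprM mulnC exprM -E4.
  have j40 : 0 <= 4 ^+ j :> R by rewrite exprn_ge0.
  rewrite (powRM _ Hn (mulr_ge0 (ler0n R 4) j40)) (powRM _ (ler0n R 4) j40) powR_exprn//.
  rewrite /A /b /iteration_factor /iteration_base exprMn.
  by rewrite le_eqVlt; apply/orP; left; apply/eqP; ring.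
have HP0 : P 0%N = phi k0 1 * m k0 1 `^ (theta - 1).
  rewrite /P /Psi /kk /rr !expr0 subrr mulr0 addr0.
  by rewrite (_ : 2^-1 * (1 + 1) = 1)//; field.
have P00 : 0 <= P 0%N by exact: Psi0.
(* The hypothesis on [H] in the form in which the induction below consumes it, one factor [mu] per
   step. *)
have key : A * ((H^-1) ^+ 2 * P 0%N) `^ (theta - 1) <= mu.
  have A0 : 0 <= A by exact: iteration_factor_ge0.
  have A1 : 0 < A + 1 by rewrite ltr_wpDl.
  have : iteration_const theta K ^+ 2 * ((H^-1) ^+ 2 * P 0%N) <= 1.
    rewrite mulrCA HP0 exprVn mulrC ler_pdivrMr ?mul1r// exprn_gt0//.
  have c0 : 0 <= iteration_const theta K ^+ 2 * ((H^-1) ^+ 2 * P 0%N).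
    by apply: mulr_ge0; [exact: sqr_ge0|exact: mulr_ge0].
  move=> cle; have : (iteration_const theta K ^+ 2 * ((H^-1) ^+ 2 * P 0%N)) `^ (theta - 1) <= 1.
    by have := ler_powRl (ltW t0) c0 cle; rewrite one_powR.
  rewrite (powRM _ (sqr_ge0 _) (mulr_ge0 Hn P00)) iteration_const_powR// -/A -/mu.
  rewrite mulrAC ler_pdivrMr// mul1r; apply: le_trans.
  by rewrite ler_wpM2r ?powR_ge0// lerDl.
(* By [mub], raising [mu ^+ j] to the power [theta - 1] gives exactly what cancels the growth
   [b ^+ j]. *)
have indj j : P j <= P 0%N * mu ^+ j.
  elim: j => [|j IH]; first by rewrite mulr1.
  apply: (le_trans (stepj j)).
  have Pj : P j `^ theta <= P 0%N * mu ^+ j * (P 0%N `^ (theta - 1) * b^-1 ^+ j).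
    apply: (@le_trans _ _ ((P 0%N * mu ^+ j) `^ theta)).
      exact: (ler_powRl (ltW th0) (Psi0 _ _) IH).
    have X0 : 0 <= P 0%N * mu ^+ j by rewrite mulr_ge0// exprn_ge0// ltW.
    rewrite -(mulr_powRB1 X0 th0) powRM ?exprn_ge0 ?(ltW mu0)//.
    by rewrite (powR_exprn _ _ (ltW mu0)) mub.
  have A0 : 0 <= A * b ^+ j * ((H^-1) ^+ 2) `^ (theta - 1).
    by rewrite !mulr_ge0 ?powR_ge0 ?exprn_ge0 ?(ltW b0)// iteration_factor_ge0.
  apply: (le_trans (ler_wpM2l A0 Pj)).
  have bj : b ^+ j * b^-1 ^+ j = 1 by rewrite -exprMn divff ?gt_eqF// expr1n.
  apply: (@le_trans _ _ ((A * ((H^-1) ^+ 2 * P 0%N) `^ (theta - 1)) * (P 0%N * mu ^+ j))).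
    have E X : X = X * (b ^+ j * b^-1 ^+ j) by rewrite bj mulr1.
    rewrite (powRM _ Hn P00) [leRHS]E le_eqVlt; apply/orP; left; apply/eqP.
    move: (b ^+ j) (b^-1 ^+ j) (mu ^+ j) => ? ? ?; ring.
  rewrite (exprS mu) [leRHS]mulrCA ler_wpM2r//; apply: mulr_ge0 => //.
  by apply: exprn_ge0; exact: ltW.
have PH : Psi (k0 + H) 2^-1 = 0.
  apply/eqP; rewrite eq_le Psi0 andbT.
  apply: (@geometric_le0 _ (P 0%N) mu); first by rewrite ltW//= iteration_ratio_lt1.
  move=> j; apply: le_trans (indj j).
  have kj : kk j <= k0 + H.
    by rewrite lerD2l ler_piMr ?(ltW H0)// gerBl ltW.
  have rj : 2^-1 <= rr j by rewrite ler_peMr ?invr_ge0// lerDl ltW.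
  apply: ler_pM => //; first exact: powR_ge0.
    by apply: (le_trans (phih _ _ _ kj)); exact: phir.
  apply: ler_powRl => //; first exact: ltW.
  by apply: (le_trans (mh _ _ _ kj)); exact: mr.
have : phi (k0 + H) 2^-1 = 0 \/ m (k0 + H) 2^-1 = 0.
  move/eqP: PH; rewrite mulf_eq0 => /orP[/eqP|]; first by left.
  by rewrite powR_eq0// => /andP[/eqP]; right.
move=> [E|E]; apply/eqP; rewrite eq_le m0 andbT.
  by have := Hm _ _ 2^-1 hH; rewrite E mulr0.
by rewrite -E; exact: mh (ltW hH).
Qed.

End iteration.

(** * Hoelder's inequality for integrals of squares *)

Section hoelder_mass.
Context {R : realType} {d : nat}.
Implicit Types (S U : set 'rV[R]_d) (v : 'rV[R]_d -> R).

Local Notation mu := (lebesgue_rV R d).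

Lemma poweR_sqr_inv (p : R) (x : \bar R) : 0 < p -> (0 <= x)%E ->
  ((x `^ p^-1) ^+ 2 = x `^ (p / 2)^-1)%E.
Proof.
move=> p0; case: x => [r| |] // => [r0|_].
  rewrite !poweR_EFin -EFin_expe -powR_mulrn ?powR_ge0// -powRrM.
  by congr ((_ `^ _)%:E); field; rewrite gt_eqF.
by rewrite !poweRyr// ?invr_eq0 ?gt_eqF// divr_gt0.
Qed.

(** Hoelder's inequality for [v ^+ 2] and the indicator of [S], with the conjugate exponents [p / 2]
    and [p / (p - 2)]. *)
Lemma mass_hoelder S U v (p : R) : 2 < p -> measurable S -> measurable U -> S `<=` U ->
  measurable_fun U v ->
  (mass S v <= Lpnorm U p%:E v ^+ 2 * mu S `^ (1 - 2 / p))%E.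
Proof.
move=> p2 mS mU SU mv.
have p0 : 0 < p by rewrite (lt_trans _ p2).
have pn0 : p != 0 by rewrite gt_eqF.
have mvS := measurable_funS mU SU mv.
pose f := (fun y => v y ^+ 2) \_ S.
have mf : measurable_fun setT f.
  by apply/(measurable_restrictT _ mS); exact: measurable_funX.
have mg : measurable_fun setT (\1_S : 'rV[R]_d -> R) by exact: measurable_indic.
have pq : (p / 2)^-1 + (p / (p - 2))^-1 = 1.
  by field; rewrite pn0 subr_eq0 gt_eqF.
have q0 : 0 < p / (p - 2) by rewrite divr_gt0// subr_gt0.
have := hoelder mu mf mg (divr_gt0 p0 (ltr0n _ 2)) q0 pq.
rewrite Lnorm1.
have -> : (\int[mu]_x `|(EFin \o (f \* \1_S)%R) x| = mass S v)%E.
  rewrite /mass [RHS]integral_mkcond; apply: eq_integral => y _ /=.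
  rewrite /f !patchE indicE; case: ifPn => yS; last by rewrite mul0r normr0.
  by rewrite mulr1 ger0_norm ?sqr_ge0.
move/le_trans; apply; apply: lee_pmul; rewrite ?Lnorm_ge0//.
- rewrite LpnormE// unlock.
  have -> : (\int[mu]_x `|(EFin \o f) x| `^ (p / 2) = \int[mu]_(x in S) (`|v x| `^ p)%:E)%E.
    rewrite [RHS]integral_mkcond; apply: eq_integral => y _ /=.
    rewrite /f !patchE; case: ifPn => yS; last by rewrite normr0 powR0// gt_eqF// divr_gt0.
    rewrite ger0_norm ?sqr_ge0// -real_normK ?num_real// -(powR_mulrn 2)// -powRrM.
    by rewrite mulrCA divff// mulr1.
  have I0 V : (0 <= \int[mu]_(x in V) (`|v x| `^ p)%:E)%E.
    by apply: integral_ge0 => y _; rewrite lee_fin powR_ge0.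
  rewrite poweR_sqr_inv//.
  apply: gt0_ler_poweR.
  + by rewrite invr_ge0 divr_ge0// ltW.
  + by rewrite in_itv/= I0 leey.
  + by rewrite in_itv/= I0 leey.
  apply: ge0_subset_integral => //.
  + apply/measurable_EFinP; apply: (@measurableT_comp _ _ _ _ _ _ (@powR R ^~ p)) => //.
    exact: measurableT_comp.
- rewrite unlock.
  have -> : (\int[mu]_x `|(EFin \o \1_S) x| `^ (p / (p - 2)) = mu S)%E.
    rewrite -[in RHS](setIT S) -integral_indic//; apply: eq_integral => y _ /=.
    rewrite indicE; case: (y \in S) => /=; first by rewrite normr1 powR1.
    by rewrite normr0 powR0// gt_eqF.
  by rewrite (_ : (p / (p - 2))^-1 = 1 - 2 / p)//; field; rewrite pn0 subr_eq0 gt_eqF.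
Qed.

End hoelder_mass.

(** * The Sobolev exponent and [theta] *)

Section exponents.
Context {R : realType}.

Definition sobolev_exp (d : nat) (q : R) : R :=
  if d == 2%N then q else (2 * d%:R) / (d%:R - 2).

Lemma sobolev_exp_gt2 d q : (2 <= d)%N -> (d = 2%N -> 2 < q) -> 2 < sobolev_exp d q.
Proof.
move=> d2; rewrite /sobolev_exp; case: eqP => [d2' q2|dn2 _]; first exact: q2.
have d3 : (2 < d%:R :> R) by rewrite ltr_nat ltn_neqAle d2 andbT eq_sym; apply/eqP.
by rewrite ltr_pdivlMr ?subr_gt0//; lra.
Qed.

(* The identity makes the exponent of the measure of the level set in Hoelder's
   inequality match the one of [degiorgi_iteration]. *)
Lemma theta_sqr (d : nat) q : (2 <= d)%N -> (d = 2%N -> 2 < q) ->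
  1 < theta d q /\ theta d q * (theta d q - 1) = 1 - 2 / sobolev_exp d q.
Proof.
move=> d2 q2; have := sobolev_exp_gt2 d2 q2; rewrite /theta.
(* [theta] is the positive root of [t ^ 2 - t = 2 / delta]; this identity removes the distinction of
   dimensions. *)
have E : 2 / (if d == 2%N then 2 * q / (q - 2) else d%:R) = 1 - 2 / sobolev_exp d q.
  rewrite /sobolev_exp; case: eqP => [/q2 q20|dn2].
    have q0 : q != 0 by rewrite gt_eqF// (lt_trans _ q20).
    have q1 : q - 2 != 0 by rewrite gt_eqF// subr_gt0.
    by field; rewrite ?q0 ?q1.
  have d3 : (2 < d%:R :> R) by rewrite ltr_nat ltn_neqAle d2 andbT eq_sym; apply/eqP.
  have d0 : (d%:R : R) != 0 by rewrite gt_eqF// (lt_trans _ d3).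
  have d1 : (d%:R - 2 : R) != 0 by rewrite gt_eqF// subr_gt0.
  by field; rewrite ?d0 ?d1.
rewrite E; set p := sobolev_exp d q => p2.
have k0 : 0 < 1 - 2 / p by rewrite subr_gt0 ltr_pdivrMr; lra.
have S0 : 0 <= 4^-1 + (1 - 2 / p) by lra.
set S := Num.sqrt _.
have SE : S ^+ 2 = 4^-1 + (1 - 2 / p) by rewrite sqr_sqrtr.
have S00 : 0 <= S by exact: sqrtr_ge0.
have S2 : 2^-1 < S.
  rewrite -(ltr_pXn2r (n := 2)) ?nnegrE ?invr_ge0// SE.
  by rewrite exprVn -natrX ltrDl.
split; first lra.
have -> : (2^-1 + S) * (2^-1 + S - 1) = S ^+ 2 - 4^-1 by field.
by rewrite SE; ring.
Qed.

End exponents.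

(** * Integrals over level sets and the squared embedding *)

Section level_sets.
Context {R : realType} {d : nat}.
Implicit Types (O D S : set 'rV[R]_d) (u v : 'rV[R]_d -> R) (x : 'rV[R]_d)
  (g : 'I_d -> 'rV[R]_d -> R) (h r s : R).

Local Notation mu := (lebesgue_rV R d).

Definition super O u h : set 'rV[R]_d := [set y | O y /\ (h < u y)%R].

Definition level_mass O x u h r : R := fine (mass (O `&` eball x r) (upos u h)).

Definition level_measure O x u h r : R := fine (mu (super O u h `&` eball x r)).

Lemma measurable_eball x r : measurable (eball x r).
Proof. by apply: open_measurable_rV; exact: eball_open. Qed.

Lemma measurable_super O u h : measurable O -> measurable_fun O u -> measurable (super O u h).
Proof.
move=> mO mu0.
have := @measurable_fun_ltr _ _ R O (cst h) u (measurable_cst h) mu0 mO [set true] I.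
by rewrite (_ : _ `&` _ = super O u h)//; apply/seteqP; split.
Qed.

Lemma eball_fin x r : (mu (eball x r) < +oo)%E.
Proof.
have cB := @cball_compact _ _ x `|r| (normr_ge0 r).
apply: le_lt_trans (compact_fin cB); apply: le_measure; rewrite ?inE.
- exact: measurable_eball.
- exact: measurable_compact_rV.
- by apply: subset_trans (@subset_eball_cball _ _ x `|r|); apply: subset_eball; exact: ler_norm.
Qed.

Lemma super_fin O x u h r : measurable O -> measurable_fun O u ->
  mu (super O u h `&` eball x r) \is a fin_num.
Proof.
move=> mO mu0; rewrite ge0_fin_numE//; apply: le_lt_trans (eball_fin x r).
apply: le_measure; rewrite ?inE; last exact: subIsetr.
  by apply: measurableI; [exact: measurable_super|exact: measurable_eball].
exact: measurable_eball.
Qed.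

Lemma upos_fin O x u h r : measurable O -> measurable_fun O u -> (mass O u < +oo)%E ->
  mass (O `&` eball x r) (upos u h) \is a fin_num.
Proof.
move=> mO mu0 fu; rewrite ge0_fin_numE ?mass_ge0//.
have mS : measurable (O `&` eball x r) by apply: measurableI => //; exact: measurable_eball.
have muS : measurable_fun (O `&` eball x r) u by apply: measurable_funS mu0 => //; exact: subIsetl.
apply: (@le_lt_trans _ _ (2%:E * (mass (O `&` eball x r) u + mass (O `&` eball x r) (fun=> h)))%E).
  apply: mass_le2 => //; first exact: measurable_upos.
  move=> y _; have h1 := @upos_ge0 _ _ u h y.
  apply: (@le_trans _ _ ((u y - h) ^+ 2)).
    rewrite uposE; case: (leP (u y - h) 0) => h0; last by [].
    by rewrite expr0n sqr_ge0.
  by rewrite -[h ^+ 2]sqrrN; exact: sqrrD_le2.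
rewrite lte_mul_pinfty// lte_add_pinfty//.
  by apply: le_lt_trans fu; apply: mass_subset => //; exact: subIsetl.
rewrite mass_cst// lte_mul_pinfty ?lee_fin ?sqr_ge0//.
apply: le_lt_trans (eball_fin x r); apply: le_measure; rewrite ?inE//.
  exact: measurable_eball.
Qed.

Section fixed_function.
Variables (O : set 'rV[R]_d) (u : 'rV[R]_d -> R) (x : 'rV[R]_d).
Hypotheses (oO : open O) (mu0 : measurable_fun O u) (fu : (mass O u < +oo)%E).

Let mO : measurable O. Proof. exact: open_measurable_rV. Qed.

Let mS r : measurable (O `&` eball x r).
Proof. by apply: measurableI => //; exact: measurable_eball. Qed.

Let muS r : measurable_fun (O `&` eball x r) u.
Proof. by apply: measurable_funS mu0 => //; exact: subIsetl. Qed.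

Let mT h r : measurable (super O u h `&` eball x r).
Proof. by apply: measurableI; [exact: measurable_super|exact: measurable_eball]. Qed.

Lemma level_massE h r : mass (O `&` eball x r) (upos u h) = (level_mass O x u h r)%:E.
Proof. by rewrite fineK// upos_fin. Qed.

Lemma level_measureE h r : mu (super O u h `&` eball x r) = (level_measure O x u h r)%:E.
Proof. by rewrite fineK// super_fin. Qed.

Lemma level_mass_ge0 h r : 0 <= level_mass O x u h r.
Proof. by rewrite fine_ge0// mass_ge0. Qed.

Lemma level_measure_ge0 h r : 0 <= level_measure O x u h r.
Proof. by rewrite fine_ge0. Qed.

Lemma level_mass_le h h' r : h' <= h -> level_mass O x u h r <= level_mass O x u h' r.
Proof.
move=> hh; rewrite -lee_fin -!level_massE; apply: mass_mono => //; try exact: measurable_upos.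
move=> y _; rewrite lerXn2r ?nnegrE ?upos_ge0// !uposE.
by rewrite ge_max !le_max lexx orbT andbT lerD2l lerN2 hh.
Qed.

Lemma level_measure_le h h' r : h' <= h -> level_measure O x u h r <= level_measure O x u h' r.
Proof.
move=> hh; rewrite -lee_fin -!level_measureE; apply: le_measure; rewrite ?inE//.
by apply: setSI => y [Oy hy]; split => //; exact: le_lt_trans hy.
Qed.

Lemma level_mass_le_r h r r' : r <= r' -> level_mass O x u h r <= level_mass O x u h r'.
Proof.
move=> rr; rewrite -lee_fin -!level_massE; apply: mass_subset => //.
  by apply: setIS; exact: subset_eball.
exact: measurable_upos.
Qed.

Lemma level_measure_le_r h r r' : r <= r' ->
  level_measure O x u h r <= level_measure O x u h r'.
Proof.
move=> rr; rewrite -lee_fin -!level_measureE; apply: le_measure; rewrite ?inE//.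
by apply: setIS; exact: subset_eball.
Qed.

Lemma level_chebyshev h h' r : h' < h ->
  level_measure O x u h r <= (h - h')^-1 ^+ 2 * level_mass O x u h' r.
Proof.
move=> hh; have hh0 : 0 < h - h' by rewrite subr_gt0.
rewrite exprVn -ler_pdivrMl ?invr_gt0 ?exprn_gt0// invrK -lee_fin EFinM.
rewrite -level_massE -level_measureE -mass_cst//.
have TS : super O u h `&` eball x r `<=` O `&` eball x r by move=> y [[Oy _] By].
have mup : measurable_fun (O `&` eball x r) (upos u h') by exact: measurable_upos.
apply: (@le_trans _ _ (mass (super O u h `&` eball x r) (upos u h'))).
  apply: mass_mono => //; first exact: measurable_funS mup.
  move=> y [[_ hy] _]; rewrite lerXn2r ?nnegrE ?upos_ge0 ?(ltW hh0)// uposE.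
  by rewrite le_max lerD2r ltW.
exact: mass_subset.
Qed.

End fixed_function.

Lemma lee_pmul3 (c X Y : R) (a b : \bar R) : 0 <= c -> (0 <= a)%E -> (0 <= b)%E ->
  (a <= X%:E)%E -> (b <= Y%:E)%E -> (c%:E * a * b <= (c * X * Y)%:E)%E.
Proof.
move=> c0 a0 b0 aX bY; rewrite (EFinM (c * X) Y) (EFinM c X).
apply: lee_pmul => //; first by rewrite mule_ge0 ?lee_fin.
by apply: lee_pmul; rewrite ?lee_fin.
Qed.

Lemma le_poweR_EFin (a : \bar R) (X e : R) : 0 <= e -> 0 <= X -> (0 <= a)%E -> (a <= X%:E)%E ->
  (a `^ e <= (X `^ e)%:E)%E.
Proof.
move=> e0 X0 a0 aX; rewrite -poweR_EFin; apply: gt0_ler_poweR => //.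
  by rewrite in_itv/= leey a0.
by rewrite in_itv/= leey lee_fin X0.
Qed.

(** The bound [b] on the L^2 part is kept apart from the bound [a] on the full norm because the
    embedding in dimension two interpolates between them. *)
Lemma embedding_HD D O (q cE : R) v G (a b : R) : open O -> embedding D O q cE -> HD D O v G ->
  0 <= a -> 0 <= b -> (mass O v + \sum_j mass O (G j) <= a%:E)%E -> (mass O v <= b%:E)%E ->
  (Lpnorm O (sobolev_exp d q)%:E v ^+ 2 <= (cE ^+ 2 *
    (if d == 2%N then a `^ (1 - 2 / q) * b `^ (2 / q) else a))%:E)%E.
Proof.
move=> oO [cE0 HE] Hv a0 b0 Ha Hb; have [wv _ _ _] := Hv.
have [Hv1 Hv2] : H1_ D O (fun y => (v y)%:C%C) by exact: HD_H1real Hv.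
have EL p : Lpnorm O p%:E (fun y => normc (v y)%:C%C) = Lpnorm O p%:E v.
  rewrite /Lpnorm; apply/esym; rewrite -Lnorm_abse; congr Lnorm.
  apply/funext => y /=; rewrite !patchE; case: ifPn => _; last by rewrite abse0.
  by rewrite /= expr0n/= addr0 sqrtr_sqr.
have H1b : (H1norm O (fun y => (v y)%:C%C) <= (a `^ 2^-1)%:E)%E.
  rewrite H1normE (H1sq_real oO wv) -poweR_EFin; apply: gt0_ler_poweR.
  - by rewrite invr_ge0.
  - rewrite in_itv/= leey andbT adde_ge0 ?mass_ge0//.
    by apply: sume_ge0 => j _; exact: mass_ge0.
  - by rewrite in_itv/= lee_fin a0 leey.
  - exact: Ha.
have L2b : (L2norm O (fun y => (v y)%:C%C) <= (b `^ 2^-1)%:E)%E.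
  rewrite /L2norm EL -(@lee_sqr _) ?lee_fin ?powR_ge0//; last exact: Lnorm_ge0.
  rewrite Lpnorm2_sqr -EFin_expe -powR_mulrn ?powR_ge0// -powRrM mulVf// powRr1//.
have L0 : (0 <= Lpnorm O (sobolev_exp d q)%:E v)%E by exact: Lnorm_ge0.
have sqh (t e : R) : 0 <= t -> ((t `^ 2^-1) `^ e) ^+ 2 = t `^ e.
  move=> t0; rewrite -powR_mulrn ?powR_ge0// -!powRrM; congr (_ `^ _).
  by field.
move: HE L0; rewrite /sobolev_exp; case: eqP => [d2|d2].
  move=> [q2 HE] L0; have := HE _ (conj Hv1 Hv2); rewrite EL => HL.
  have q0 : 0 < q by rewrite (lt_trans _ q2).
  have e1 : 0 <= 1 - 2 / q by rewrite subr_ge0 ler_pdivrMr// mul1r ltW.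
  have e2 : 0 <= 2 / q by rewrite divr_ge0// ltW.
  have : (Lpnorm O q%:E v <= (cE * (a `^ 2^-1) `^ (1 - 2 / q) * (b `^ 2^-1) `^ (2 / q))%:E)%E.
    apply: (le_trans HL); apply: lee_pmul3; rewrite ?poweR_ge0 ?(ltW cE0)//.
      by apply: le_poweR_EFin; rewrite ?powR_ge0 ?H1norm_ge0.
    by apply: le_poweR_EFin; rewrite ?powR_ge0//; exact: Lnorm_ge0.
  move=> HL2; apply: (@le_trans _ _
    ((cE * (a `^ 2^-1) `^ (1 - 2 / q) * (b `^ 2^-1) `^ (2 / q))%:E ^+ 2)%E).
    by rewrite lee_sqr// lee_fin !mulr_ge0 ?powR_ge0// ltW.
  rewrite -(sqh a (1 - 2 / q) a0) -(sqh b (2 / q) b0).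
  move: (_ `^ (1 - 2 / q)) (_ `^ (2 / q)) => X Y.
  by rewrite -EFin_expe lee_fin !exprMn mulrA.
move=> HE L0; have := HE _ (conj Hv1 Hv2); rewrite EL => HL.
have HL2 : (Lpnorm O (2 * d%:R / (d%:R - 2))%:E v <= (cE * a `^ 2^-1)%:E)%E.
  apply: (le_trans HL); rewrite (EFinM cE (a `^ 2^-1)).
  apply: lee_pmul; rewrite ?lee_fin ?(ltW cE0)//.
  exact: H1norm_ge0.
apply: (@le_trans _ _ ((cE * a `^ 2^-1)%:E ^+ 2)%E).
  by rewrite lee_sqr// lee_fin mulr_ge0 ?powR_ge0// ltW.
have E : a `^ 2^-1 ^+ 2 = a.
  by rewrite -(powR_mulrn 2 (powR_ge0 _ _)) -powRrM mulVf// powRr1.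
by rewrite -EFin_expe lee_fin exprMn E.
Qed.

End level_sets.

(** * Gain of integrability on level sets *)

Section level_estimates.
Context {R : realType} {d : nat}.
Implicit Types (O D S : set 'rV[R]_d) (u v : 'rV[R]_d -> R) (x : 'rV[R]_d)
  (g : 'I_d -> 'rV[R]_d -> R) (h r s c : R).

Local Notation mu := (lebesgue_rV R d).

(* The truncation of [u] at level [h] has weak gradient [gpos u g h]. *)
Definition level_caccioppoli O x u g s c h : Prop := forall r rho, 0 < r < rho -> rho <= s ->
  (\sum_j mass (O `&` eball x r) (gpos u g h j) <=
   (c / (rho - r) ^+ 2)%:E * mass (O `&` eball x rho) (upos u h))%E.

Lemma embedding_q D O (q cE : R) : embedding D O q cE -> d = 2%N -> 2 < q.
Proof. by move=> [_]; case: eqP => // _ []. Qed.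

Lemma mass_vanish O S f : S `<=` O -> (forall y, O y -> ~ S y -> f y = 0) ->
  mass O f = mass S f.
Proof.
move=> SO f0; apply: integral_vanish => // y Oy Sy.
by rewrite f0// expr0n.
Qed.

(** What the embedding makes of a squared H^1 norm of at most [X * Phi] and a squared L^2 norm of at
    most [Phi]: in both cases the result is linear in [Phi]. *)
Definition sobolev_gain (q X : R) : R := if d == 2%N then X `^ (1 - 2 / q) else X.

(** The first term pays for the L^2 part, as [1 <= s ^ 2 / (rho - r) ^ 2]. Each 8 is a factor 2 from
    the square of a sum and a factor 4 from using only half of the gap [rho - r]. *)
Definition gradient_const c s : R := s ^+ 2 + 8 * c + 8 * d%:R * cutoff_const ^+ 2.

Lemma level_estimate D O x u g (q cE : R) s c h r rho : (2 <= d)%N -> open O ->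
  embedding D O q cE -> HD D O u g -> 0 <= c -> 0 < r < rho -> rho <= s ->
  (0 <= h \/ eball x s `&` D = set0) -> level_caccioppoli O x u g s c h ->
  level_mass O x u h r <= cE ^+ 2 * sobolev_gain q (gradient_const c s / (rho - r) ^+ 2) *
    level_measure O x u h rho `^ (1 - 2 / sobolev_exp d q) * level_mass O x u h rho.
Proof.
move=> d2 oO Hemb Hu c0 /andP[r0 rr] rs Hh cacc.
have mO := open_measurable_rV oO.
have [[lu lg _] fu fg _] := Hu; have [mu0 _] := lu.
have mg j : measurable_fun O (g j) by have [] := lg j.
have rho0 : 0 < rho by exact: lt_trans rr.
(* Half of the gap serves the cut-off function, the other half the Caccioppoli inequality. *)
pose r' := (r + rho) / 2.
have r1 : r < r' by rewrite /r'; lra.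
have r2 : r' < rho by rewrite /r'; lra.
have r'0 : 0 < r' by exact: lt_trans r1.
set eta := cutoff x r r'.
have teta : rtest (eball x s) eta by apply: rtest_cutoff => //; exact: lt_le_trans rs.
have Fs : D `&` eball x s `<=` D by exact: subIsetl.
set v := fun y => eta y * upos u h y.
set G := fun j y => eta y * gpos u g h j y + upos u h y * partial j eta y.
have Hv : HD D O v G by apply: (HD_cut oO oO _ Hu Fs teta Hh); exact: subset_refl.
set S := O `&` eball x r'.
have mS : measurable S by apply: measurableI => //; exact: measurable_eball.
have SO : S `<=` O by exact: subIsetl.
have out y : O y -> ~ S y -> r' ^+ 2 <= sqdist x y.
  move=> Oy Sy; rewrite leNgt; apply/negP => h0; apply: Sy; split => //.
  by rewrite eballE.
have mup : measurable_fun O (upos u h) by exact: measurable_upos.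
have mgp j : measurable_fun O (gpos u g h j) by exact: measurable_gpos.
have meta : measurable_fun O eta.
  by apply: measurable_funTS; apply: continuous_measurable_rV; exact: rtest_continuous teta.
have mpeta j : measurable_fun O (partial j eta).
  apply: measurable_funTS; apply: continuous_measurable_rV.
  exact: rtest_continuous (rtest_partial j teta).
have mv : measurable_fun O v by exact: measurable_funM.
have mG j : measurable_fun O (G j) by apply: measurable_funD; exact: measurable_funM.
set Phi := level_mass O x u h rho.
have Phi0 : 0 <= Phi by exact: level_mass_ge0.
have SPhi : (mass S (upos u h) <= Phi%:E)%E.
  rewrite /S level_massE// lee_fin; apply: level_mass_le_r => //; exact: ltW.
have vPhi : (mass O v <= Phi%:E)%E.
  rewrite (mass_vanish SO); last by move=> y Oy Sy; rewrite /v /eta cutoff_eq0 ?mul0r// out.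
  apply: le_trans SPhi; apply: mass_mono => //;
    [exact: measurable_funS mv|exact: measurable_funS mup|].
  move=> y _; rewrite exprMn ler_piMl ?sqr_ge0//.
  by rewrite exprn_ile1 ?cutoff_ge0 ?cutoff_le1.
pose k := cutoff_const / (r' - r).
have kP j y : partial j eta y ^+ 2 <= k ^+ 2 by exact: sqr_partial_cutoff_le.
have GPhi j : (mass O (G j) <= 2%:E * (mass S (gpos u g h j) + (k ^+ 2 * Phi)%:E))%E.
  rewrite (mass_vanish SO); last first.
    by move=> y Oy Sy; rewrite /G /eta cutoff_eq0 ?partial_cutoff_eq0 ?mul0r ?mulr0 ?addr0// out.
  apply: (@le_trans _ _ (2%:E * (mass S (gpos u g h j) + mass S (fun y => k * upos u h y)%R))%E).
    apply: mass_le2 => //.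
    - exact: measurable_funS (mG j).
    - exact: measurable_funS (mgp j).
    - apply: measurable_funM; [exact: measurable_cst|exact: measurable_funS mup].
    - move=> y _; apply: le_trans (sqrrD_le2 _ _) _; rewrite ler_wpM2l// lerD//.
        rewrite exprMn ler_piMl ?sqr_ge0//.
        by rewrite exprn_ile1 ?cutoff_ge0 ?cutoff_le1.
      by rewrite (exprMn 2 (upos u h y)) (exprMn 2 k) mulrC ler_wpM2r ?sqr_ge0.
  apply: lee_EFinM2l => //; apply: leeD2l.
  rewrite massZ//; last exact: measurable_funS mup.
  by rewrite (EFinM (k ^+ 2) Phi); apply: lee_EFinM2l SPhi; exact: sqr_ge0.
have gfin j : mass S (gpos u g h j) \is a fin_num.
  rewrite ge0_fin_numE ?mass_ge0//; apply: le_lt_trans (fg j).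
  apply: (@le_trans _ _ (mass O (gpos u g h j))); first exact: mass_subset.
  apply: mass_mono => // y _; rewrite -(real_normK (num_real (gpos u g h j y))).
  rewrite -(real_normK (num_real (g j y))).
  by rewrite lerXn2r ?nnegrE// gpos_le.
pose gm j := fine (mass S (gpos u g h j)).
have gmE j : mass S (gpos u g h j) = (gm j)%:E by rewrite fineK.
have sumgm : \sum_j gm j <= c / (rho - r') ^+ 2 * Phi.
  have := cacc r' rho; rewrite r'0 r2 => /(_ isT rs).
  rewrite -/S level_massE// -/Phi.
  by under eq_bigr do rewrite gmE; rewrite sumEFin -EFinM lee_fin.
have sumG : (\sum_j mass O (G j) <= (2 * (c / (rho - r') ^+ 2 * Phi + d%:R * (k ^+ 2 * Phi)))%:E)%E.
  apply: (@le_trans _ _ (\sum_j (2 * (gm j + k ^+ 2 * Phi))%:E)%E).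
    by apply: lee_sum => j _; apply: le_trans (GPhi j) _; rewrite gmE -EFinD -EFinM.
  rewrite sumEFin lee_fin -mulr_sumr ler_wpM2l// big_split/= sumr_const card_ord.
  by rewrite -[X in _ + X <= _]mulr_natl lerD2r.
set X := gradient_const c s / (rho - r) ^+ 2.
have dr : 0 < rho - r by rewrite subr_gt0.
have HX : (mass O v + \sum_j mass O (G j) <= (X * Phi)%:E)%E.
  apply: le_trans (leeD vPhi sumG) _; rewrite -EFinD lee_fin.
  have -> : X = (s ^+ 2) / (rho - r) ^+ 2 +
      (2 * (c / (rho - r') ^+ 2 + d%:R * k ^+ 2)).
    by rewrite /X /gradient_const /k /r'; field; rewrite ?gt_eqF// ?subr_gt0; lra.
  have -> : 2 * (c / (rho - r') ^+ 2 * Phi + d%:R * (k ^+ 2 * Phi)) =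
    2 * (c / (rho - r') ^+ 2 + d%:R * k ^+ 2) * Phi by ring.
  rewrite [leRHS]mulrDl lerD2r ler_peMl// ler_pdivlMr ?exprn_gt0// mul1r.
  by rewrite lerXn2r ?nnegrE ?(ltW dr)//; lra.
have X0 : 0 <= X.
  rewrite divr_ge0 ?sqr_ge0// /gradient_const !addr_ge0 ?sqr_ge0 ?mulr_ge0//.
have H := embedding_HD oO Hemb Hv (mulr_ge0 X0 Phi0) Phi0 HX vPhi.
have E : (if d == 2%N then (X * Phi) `^ (1 - 2 / q) * Phi `^ (2 / q) else X * Phi) =
    sobolev_gain q X * Phi.
  rewrite /sobolev_gain; case: ifP => // _.
  rewrite powRM// -mulrA -powRD ?subrK ?powRr1//.
  by rewrite oner_eq0.
rewrite E in H.
have p2 : 2 < sobolev_exp d q.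
  by apply: sobolev_exp_gt2 => //; exact: embedding_q Hemb.
set T := super O u h `&` eball x rho.
have mT : measurable T by apply: measurableI; [exact: measurable_super|exact: measurable_eball].
have TO : T `<=` O by move=> y [[]].
have Hoel := mass_hoelder p2 mT mO TO mv.
have rO : O `&` eball x r `<=` O `&` eball x rho by apply: setIS; apply: subset_eball; exact: ltW.
(* In the inner ball the truncation lives on the superlevel set and agrees with [v]; so Hoelder's
   inequality is needed only on [T]. *)
have Hr : (mass (O `&` eball x r) (upos u h) <= mass T v)%E.
  have mr : measurable (O `&` eball x r) by apply: measurableI => //; exact: measurable_eball.
  have mTr : measurable (T `&` eball x r) by apply: measurableI => //; exact: measurable_eball.
  rewrite (@mass_vanish _ (T `&` eball x r)); last first.
    move=> y [Oy By] nT; rewrite uposE; apply/max_idPr; rewrite leNgt; apply/negP => uy.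
    apply: nT; split => //; split; last by apply: subset_eball By; exact: ltW.
    by split => //; rewrite -subr_gt0.
    by move=> y [[[Oy _] _] By].
  apply: (@le_trans _ _ (mass (T `&` eball x r) v)).
    have TrO : T `&` eball x r `<=` O by move=> y [/TO].
    apply: mass_mono => //; [exact: measurable_funS mup|exact: measurable_funS mv|].
    by move=> y [_ By]; rewrite /v /eta cutoff_eq1 ?mul1r.
  by apply: mass_subset => //; exact: measurable_funS mv.
have := le_trans Hr (le_trans Hoel (lee_wpmul2r _ H)).
rewrite level_massE// [mu T]level_measureE// poweR_EFin -EFinM !lee_fin.
move=> /(_ (powR_ge0 _ _))/le_trans; apply.
by rewrite le_eqVlt; apply/orP; left; apply/eqP; rewrite -/Phi; ring.
Qed.

End level_estimates.

(** * Rescaling to the unit ball and local bounds *)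

Section local_boundedness.
Context {R : realType} {d : nat}.
Implicit Types (O D S : set 'rV[R]_d) (u v : 'rV[R]_d -> R) (x : 'rV[R]_d)
  (g : 'I_d -> 'rV[R]_d -> R) (h r s c : R).

Local Notation mu := (lebesgue_rV R d).

(** The power of [s ^+ d] cancels the radius in the gain, in every dimension. For [d = 2] a power
    less than 1 of [M * t^-1 ^+ 2] remains, which is at most the full quantity since that is at
    least 1. *)
Lemma gain_scaling (q C M s t : R) : (2 <= d)%N -> (d = 2%N -> 2 < q) ->
  0 <= C <= M -> 1 <= M -> 0 < s -> 0 < t <= 1 ->
  @sobolev_gain _ d q (C / (t * s) ^+ 2) * (s ^+ d) `^ (1 - 2 / sobolev_exp d q) <=
  M * t^-1 ^+ 2.
Proof.
move=> d2 q2 /andP[C0 CM] M1 s0 /andP[t0 t1].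
have M0 : 0 <= M by exact: le_trans CM.
have CM' : C / t ^+ 2 <= M * t^-1 ^+ 2 by rewrite exprVn ler_wpM2r ?invr_ge0 ?sqr_ge0.
have Ct0 : 0 <= C / t ^+ 2 by rewrite divr_ge0 ?sqr_ge0.
have CE : C / (t * s) ^+ 2 * s ^+ 2 = C / t ^+ 2 by field; rewrite ?gt_eqF.
rewrite /sobolev_gain /sobolev_exp; case: eqP => [d2'|dn2].
  have q0 : 0 < q by rewrite (lt_trans _ (q2 d2')).
  rewrite d2' -powRM ?sqr_ge0//; last by rewrite divr_ge0 ?sqr_ge0.
  rewrite CE; apply: (@le_trans _ _ ((M * t^-1 ^+ 2) `^ (1 - 2 / q))).
    apply: ler_powRl => //.
    by rewrite subr_ge0 ler_pdivrMr// mul1r ltW// q2.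
  have M2 : 1 <= M * t^-1 ^+ 2.
    rewrite -[leLHS]mul1r; apply: ler_pM => //.
    by rewrite exprn_ege1// invf_ge1.
  rewrite -[leRHS]powRr1 ?(le_trans _ M2)//; apply: ler_powR => //.
  by rewrite gerBl divr_ge0// ltW.
have d3 : (2 < d%:R :> R) by rewrite ltr_nat ltn_neqAle d2 andbT eq_sym; apply/eqP.
have -> : 1 - 2 / (2 * d%:R / (d%:R - 2)) = 2 / d%:R :> R.
  have d0 : (d%:R : R) != 0 by rewrite gt_eqF// (lt_trans _ d3).
  have d1 : (d%:R - 2 : R) != 0 by rewrite gt_eqF// subr_gt0.
  by field; rewrite ?d0 ?d1.
rewrite -(powR_mulrn d (ltW s0)) -powRrM.
have -> : d%:R * (2 / d%:R) = 2 :> R by rewrite mulrCA divff ?mulr1// gt_eqF// (lt_trans _ d3).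
by rewrite powR_mulrn ?(ltW s0)// CE.
Qed.

(** Evaluating [gradient_const] at [r0] covers all radii up to [r0]; the maximum with 1 is for
    [gain_scaling]. *)
Definition sup_const (q cE c r0 : R) : R :=
  iteration_const (theta d q) (cE ^+ 2 * Num.max (@gradient_const _ d c r0) 1).

Lemma sup_const_gt0 q cE c r0 : 0 < sup_const q cE c r0.
Proof. by apply: iteration_const_gt0; rewrite mulr_ge0 ?sqr_ge0// le_max ler01 orbT. Qed.

Section bounds.
Variables (O D : set 'rV[R]_d) (x : 'rV[R]_d) (u : 'rV[R]_d -> R)
  (g : 'I_d -> 'rV[R]_d -> R) (q cE s r0 c : R).
Hypotheses (d2 : (2 <= d)%N) (oO : open O) (Hemb : embedding D O q cE) (Hu : HD D O u g)
  (c0 : 0 <= c) (s0 : 0 < s) (sr : s <= r0).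

Let mO : measurable O. Proof. exact: open_measurable_rV. Qed.

Let mu0 : measurable_fun O u. Proof. by have [[[]]] := Hu. Qed.

Let fu : (mass O u < +oo)%E. Proof. by have [] := Hu. Qed.

(** Scaled to radius 1 and normalised as in the claimed bound, so that the constant of the iteration
    does not see [s]. *)
Let phi h t := s ^- d * level_mass O x u h (t * s).

Let m h t := s ^- d * level_measure O x u h (t * s).

Let sd0 : 0 < s ^- d. Proof. by rewrite invr_gt0 exprn_gt0. Qed.

Let phi0 h t : 0 <= phi h t.
Proof. by rewrite mulr_ge0 ?level_mass_ge0// ltW. Qed.

Let m0 h t : 0 <= m h t.
Proof. by rewrite mulr_ge0 ?level_measure_ge0// ltW. Qed.

Let B k := k + sup_const q cE c r0 * phi k 1 `^ 2^-1 * m k 1 `^ ((theta d q - 1) / 2).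

Lemma bound_rhsE k : bound_rhs O x s q (sup_const q cE c r0) u k = (B k)%:E.
Proof.
rewrite /bound_rhs level_massE// -/(super O u k) level_measureE//.
have E (a b e : R) : ((a%:E * b%:E) `^ e = ((a * b) `^ e)%:E)%E by rewrite -EFinM poweR_EFin.
by rewrite !E -!EFinM -EFinD /B /phi /m mul1r.
Qed.

Lemma level_measure_eq0 (k : R) : 0 <= k \/ (s%:E < dist_to D x)%E ->
  (forall h, 0 <= h \/ (s%:E < dist_to D x)%E -> level_caccioppoli O x u g s c h) ->
  forall h, B k < h -> level_measure O x u h (s / 2) = 0.
Proof.
move=> Hk cacc h Bh; have q2 := embedding_q Hemb.
have [th1 thE] := theta_sqr d2 q2.
set M := Num.max (@gradient_const _ d c r0) 1.
have M1 : 1 <= M by rewrite le_max lexx orbT.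
have K0 : 0 <= cE ^+ 2 * M by rewrite mulr_ge0 ?sqr_ge0// (le_trans _ M1).
set C := iteration_const (theta d q) (cE ^+ 2 * M).
have C0 : 0 < C by exact: iteration_const_gt0.
have sn0 : s ^- d != 0 by rewrite gt_eqF.
set P := phi k 1 * m k 1 `^ (theta d q - 1).
have P0 : 0 <= P by rewrite mulr_ge0// powR_ge0.
have BE : B k = k + C * Num.sqrt P.
  rewrite /B -/C -mulrA; congr (_ + C * _).
  rewrite -(powR12_sqrt P0) /P (powRM _ (phi0 k 1) (powR_ge0 _ _)).
  by rewrite -(powRrM (m k 1)).
(* The iteration wants a positive [H], but [P] may vanish; [H] is raised by half of the room between
   [B k] and [h]. *)
pose e := (h - B k) / 2.
have e0 : 0 < e by rewrite divr_gt0// subr_gt0.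
pose H := C * Num.sqrt P + e.
have CS : 0 <= C * Num.sqrt P by rewrite mulr_ge0 ?sqrtr_ge0// ltW.
have H0 : 0 < H by rewrite ltr_wpDl.
have HH : C ^+ 2 * P <= H ^+ 2.
  rewrite -[X in _ * X]sqr_sqrtr// -exprMn lerXn2r ?nnegrE// ?(ltW H0)//.
  by rewrite lerDl ltW.
have kH : k + H < h by rewrite /H /e addrA -BE; lra.
have : m h 2^-1 = 0.
  apply: (degiorgi_iteration th1 K0 phi0 m0 _ _ _ _ _ _ H0 HH kH).
  - move=> h' t t' kh t2 tt t1.
    have t0 : 0 < t by rewrite (lt_le_trans _ t2)// invr_gt0.
    have h'ok : 0 <= h' \/ (s%:E < dist_to D x)%E.
      by case: Hk => [k0|]; [left; exact: le_trans kh|right].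
    have ts : 0 < t * s < t' * s by rewrite mulr_gt0//= ltr_pM2r.
    have t's : t' * s <= s by rewrite -[leRHS]mul1r ler_pM2r.
    have h'D : 0 <= h' \/ eball x s `&` D = set0.
      by case: h'ok => [|/dist_to_eball]; [left|right].
    have L := level_estimate d2 oO Hemb Hu c0 ts t's h'D (cacc _ h'ok).
    rewrite -mulrBl in L.
    set kp := 1 - 2 / sobolev_exp d q in L thE *.
    have mE : level_measure O x u h' (t' * s) = s ^+ d * m h' t'.
      by rewrite /m mulrA divff ?mul1r// expf_neq0// gt_eqF.
    rewrite {}mE (powRM kp (exprn_ge0 d (ltW s0)) (m0 _ _)) in L.
    have GS : @sobolev_gain _ d q (@gradient_const _ d c s / ((t' - t) * s) ^+ 2) *
        (s ^+ d) `^ kp <= M * (t' - t)^-1 ^+ 2.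
      apply: gain_scaling => //; last by rewrite subr_gt0 tt/=; lra.
      rewrite /gradient_const !addr_ge0 ?sqr_ge0 ?mulr_ge0//= ?sqr_ge0//.
      by rewrite le_max lerD2r lerD2r lerXn2r ?nnegrE ?(ltW s0)// ltW// (lt_le_trans s0).
    rewrite /phi [leRHS]mulrCA ler_pM2l// thE; apply: (le_trans L).
    apply: ler_wpM2r; first exact: level_mass_ge0.
    rewrite mulrA; apply: ler_wpM2r; first exact: powR_ge0.
    by rewrite -2!(mulrA (cE ^+ 2)); apply: ler_wpM2l; [exact: sqr_ge0|exact: GS].
  - by move=> h1 h2 t h12; rewrite ler_pM2l//; exact: level_mass_le.
  - by move=> h1 h2 t h12; rewrite ler_pM2l//; exact: level_measure_le.
  - by move=> h' t t' tt; rewrite ler_pM2l// level_mass_le_r// ler_pM2r.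
  - by move=> h' t t' tt; rewrite ler_pM2l// level_measure_le_r// ler_pM2r.
  - move=> h1 h2 t h12; rewrite [leRHS]mulrCA ler_pM2l//.
    exact: level_chebyshev.
by move/eqP; rewrite /m mulf_eq0 (negbTE sn0)/= mulrC => /eqP.
Qed.

Lemma ess_sup_super S (w : 'rV[R]_d -> R) (b : R) :
  (forall h, b < h -> mu [set y | S y /\ h < w y] = 0%E) ->
  (forall h, b < h -> measurable [set y | S y /\ h < w y]) ->
  (ess_sup_on S w <= b%:E)%E.
Proof.
move=> H mH; apply/lee_addgt0Pr => e e0; apply/ess_supP.
exists [set y | S y /\ b + e < w y]; split.
- by apply: mH; rewrite ltrDl.
- by apply: H; rewrite ltrDl.
move=> y /=; rewrite /patch; case: ifPn => [/set_mem Sy|_]; last by rewrite leNye.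
by rewrite -EFinD lee_fin => /negP; rewrite -ltNge.
Qed.

Lemma caccioppoli_local_bounds :
  (forall h, 0 <= h \/ (s%:E < dist_to D x)%E -> level_caccioppoli O x u g s c h) ->
  local_bounds D O x s q (sup_const q cE c r0) u.
Proof.
move=> cacc.
have main k : 0 <= k \/ (s%:E < dist_to D x)%E ->
    forall h, B k < h -> mu (super O u h `&` eball x (s / 2)) = 0%E.
  by move=> Hk h Bh; rewrite level_measureE// (@level_measure_eq0 k).
have mT h : measurable (super O u h `&` eball x (s / 2)).
  by apply: measurableI; [exact: measurable_super|exact: measurable_eball].
have TE h : [set y | (O `&` eball x (s / 2)) y /\ h < u y] = super O u h `&` eball x (s / 2).
  by apply/seteqP; split => y [[]].
split => [k k0|Dx k]; rewrite bound_rhsE; apply: ess_sup_super => h Bh; last first.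
- by rewrite TE.
- by rewrite TE; apply: (main k) => //; right.
(* For [0 <= k] the bound is nonnegative, and at nonnegative levels [u] and its positive part have
   the same superlevel sets. *)
all: have h0 : 0 <= h by rewrite (le_trans _ (ltW Bh))// addr_ge0//
  !mulr_ge0 ?powR_ge0// ltW// sup_const_gt0.
all: have -> : [set y | (O `&` eball x (s / 2)) y /\ h < (u^\+)%R y] =
  super O u h `&` eball x (s / 2)
  by rewrite -TE; apply/seteqP; split => y [Sy];
    rewrite /funrpos/= lt_max ?(ltNge h 0) ?h0 ?orbF// => ->.
  by [].
by apply: (main k) => //; left.
Qed.

End bounds.

End local_boundedness.

(** * Caccioppoli inequalities *)

Section energies.
Context {R : realType} {d : nat}.
Implicit Types (O D S U : set 'rV[R]_d) (u v w : 'rV[R]_d -> R) (x : 'rV[R]_d)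
  (g : 'I_d -> 'rV[R]_d -> R) (h r s c : R).

Local Notation mu := (lebesgue_rV R d).

Lemma energyE O U w g : open O -> measurable U -> U `<=` O -> wgrad O w g ->
  energy O U w = (\sum_j mass U (g j))%E.
Proof.
move=> oO mU UO wg; have mO := open_measurable_rV oO.
have wG := real_weak_gradient oO wg.
have [_ lg _] := wg.
have mg j : measurable_fun U (g j) by apply: measurable_funS mO UO _; exact: (lg j).1.
rewrite /energy (@ge0_ae_eq_integral _ _ _ mu U
  (fun y => (cvnorm (grad O (fun z => (w z)%:C%C) y) ^+ 2)%:E)
  (fun y => (\sum_j g j y ^+ 2)%:E) mU).
- rewrite (eq_integral (fun y => \sum_j (g j y ^+ 2)%:E)%E); last first.
    by move=> y _; rewrite sumEFin.
  rewrite ge0_integral_sum// => j; first exact: measurable_sqE.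
  by move=> y _; rewrite lee_fin sqr_ge0.
- apply/measurable_EFinP; apply: measurable_sqr_cvnorm => // j.
  have [mr mi] := measurable_grad j wG.
  by split; [exact: measurable_funS mr|exact: measurable_funS mi].
- apply/measurable_EFinP; apply: measurable_sum => j; exact: measurable_funX.
- by move=> y _; rewrite lee_fin sqr_ge0.
- by move=> y _; rewrite lee_fin sumr_ge0// => j _; rewrite sqr_ge0.
- have := grad_ae oO wG; apply: filterS => y E Uy.
  by rewrite (E (UO _ Uy)) sqr_cvnorm_cgrad.
Qed.

(** The defining inequality is used with [rho] as its outer radius, hence at every radius up to [s];
    the condition on the distance to [D] passes from [s] to the smaller [rho]. *)
Lemma DG_level_caccioppoli D O x u g r0 s c : open O -> HD D O u g -> s <= r0 ->
  (forall s, 0 < s <= r0 -> caccioppoli D O x s c u) ->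
  forall h, 0 <= h \/ (s%:E < dist_to D x)%E -> level_caccioppoli O x u g s c h.
Proof.
move=> oO Hu sr H h Hh r rho /andP[r0' rr] rs.
have rho0 : 0 < rho by exact: lt_trans rr.
have [||| + _] := H rho _ r h.
- by rewrite rho0 (le_trans rs).
- by rewrite r0' rr.
- by case: Hh => [|sD]; [left|right; apply: le_lt_trans sD; rewrite lee_fin].
rewrite (energyE oO _ _ (wgrad_pos h oO Hu))//.
apply: measurableI; [exact: open_measurable_rV|exact: measurable_eball].
Qed.

End energies.

(** * Absorption for non-symmetric bilinear forms *)

Section bilinear_forms.
Context {R : realType} {d : nat}.
Implicit Types (a : 'I_d -> 'I_d -> R) (xi zeta p e : 'I_d -> R) (M t lambda : R).

Definition sqnorm xi : R := \sum_i xi i ^+ 2.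

Definition bilin a xi zeta : R := \sum_i (\sum_j a i j * xi j) * zeta i.

(** [M] bounds the square of the operator norm. *)
Definition bounded_form a M : Prop :=
  forall xi, \sum_i (\sum_j a i j * xi j) ^+ 2 <= M * sqnorm xi.

Lemma sqnorm_ge0 xi : 0 <= sqnorm xi.
Proof. by apply: sumr_ge0 => i _; exact: sqr_ge0. Qed.

(** Young's inequality with weight [t] in each coordinate. *)
Lemma norm_bilin_le a M xi zeta t : bounded_form a M -> 0 < t ->
  2 * `|bilin a xi zeta| <= t * M * sqnorm xi + t^-1 * sqnorm zeta.
Proof.
move=> aM t0; rewrite -mulrA.
have young (b z : R) : 2 * `|b * z| <= t * b ^+ 2 + t^-1 * z ^+ 2.
  rewrite normrM -(real_normK (num_real b)) -(real_normK (num_real z)) -subr_ge0.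
  have -> : t * `|b| ^+ 2 + t^-1 * `|z| ^+ 2 - 2 * (`|b| * `|z|) =
    t * (`|b| - t^-1 * `|z|) ^+ 2 by field; rewrite gt_eqF.
  by apply: mulr_ge0; [exact: ltW|exact: sqr_ge0].
apply: (@le_trans _ _ (t * \sum_i (\sum_j a i j * xi j) ^+ 2 + t^-1 * sqnorm zeta)); last first.
  by rewrite lerD2r ler_wpM2l ?(ltW t0)//; exact: aM.
rewrite /sqnorm !mulr_sumr -big_split/=.
apply: (@le_trans _ _ (2 * \sum_i `|(\sum_j a i j * xi j) * zeta i|)).
  by rewrite ler_wpM2l//; exact: ler_norm_sum.
by rewrite mulr_sumr; apply: ler_sum => i _; exact: young.
Qed.

(* The part quadratic in [p] cancels: for a non-symmetric [a] what remains is a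
   commutator with at least one factor [W] in each term. *)
Lemma bilin_commutator a p W (eta : R) :
  let V i := eta * p i + W i in
  let psi i := eta ^+ 2 * p i + 2 * eta * W i in
  bilin a V V - bilin a p psi = bilin a W V - bilin a V W + bilin a W W.
Proof.
move=> V psi; rewrite /bilin -!sumrB -big_split/=; apply: eq_bigr => i _.
have -> : \sum_j a i j * V j = eta * \sum_j a i j * p j + \sum_j a i j * W j.
  by rewrite mulr_sumr -big_split/=; apply: eq_bigr => j _; rewrite /V; ring.
by rewrite /V /psi; ring.
Qed.

(** The two mixed terms of the commutator, with Young weights that leave [lambda / 4] of the square
    of [V] each, cost [M / lambda] each; the pure term with weight 1 costs [(M + 1) / 2]. *)
Definition form_const lambda M : R := 2 * M / lambda + (M + 1) / 2.

Lemma form_const_ge0 lambda M : 0 < lambda -> 0 < M -> 0 <= form_const lambda M.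
Proof. by move=> l0 M0; rewrite addr_ge0// divr_ge0 ?mulr_ge0 ?addr_ge0// ltW. Qed.

Lemma bilin_absorb a M lambda W V : bounded_form a M -> 0 < lambda -> 0 < M ->
  bilin a W V - bilin a V W + bilin a W W <=
  lambda / 2 * sqnorm V + form_const lambda M * sqnorm W.
Proof.
move=> aM l0 M0.
have t1 : 0 < 2 / lambda by rewrite divr_gt0.
have t2 : 0 < lambda / (2 * M) by rewrite divr_gt0// mulr_gt0.
have B1 := norm_bilin_le W V aM t1.
have B2 := norm_bilin_le V W aM t2.
have B3 := norm_bilin_le W W aM ltr01.
have E1 : 2 / lambda * M = 2 * (M / lambda) by field; rewrite gt_eqF.
have E2 : (2 / lambda)^-1 = lambda / 2 by field; rewrite gt_eqF.
have E3 : lambda / (2 * M) * M = lambda / 2 by field; rewrite gt_eqF.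
have E4 : (lambda / (2 * M))^-1 = 2 * (M / lambda) by field; rewrite !gt_eqF.
rewrite {}E1 {}E2 in B1; rewrite {}E3 {}E4 in B2.
rewrite invr1 mul1r in B3.
have N1 := ler_norm (bilin a W V).
have N2 := ler_norm (- bilin a V W); rewrite normrN in N2.
have N3 := ler_norm (bilin a W W).
have -> : form_const lambda M = 2 * (M / lambda) + (M + 1) / 2 by rewrite /form_const mulrA.
move: (sqnorm V) (sqnorm W) (M / lambda) B1 B2 B3 N1 N2 N3 => v w k.
by lra.
Qed.

End bilinear_forms.

(** * The Caccioppoli inequality from integrated coercivity *)

Section caccioppoli_form.
Context {R : realType} {d : nat}.
Implicit Types (O D S U : set 'rV[R]_d) (u v w : 'rV[R]_d -> R) (x : 'rV[R]_d)
  (g xi zeta : 'I_d -> 'rV[R]_d -> R) (h r s c M lambda : R)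
  (a : 'I_d -> 'I_d -> 'rV[R]_d -> R).

Local Notation mu := (lebesgue_rV R d).

Definition bilin_at a xi zeta (y : 'rV[R]_d) : R :=
  bilin (fun i j => a i j y) (xi^~ y) (zeta^~ y).

Definition sqnorm_at xi (y : 'rV[R]_d) : R := sqnorm (xi^~ y).

Lemma measurable_bilin_at U a xi zeta : (forall i j, measurable_fun U (a i j)) ->
  (forall j, measurable_fun U (xi j)) -> (forall j, measurable_fun U (zeta j)) ->
  measurable_fun U (bilin_at a xi zeta).
Proof.
move=> ma mx mz; apply: measurable_sum => i; apply: measurable_funM => //.
by apply: measurable_sum => j; apply: measurable_funM.
Qed.

Lemma integrable_sqnorm_at U xi : (forall j, measurable_fun U (xi j)) ->
  (forall j, (mass U (xi j) < +oo)%E) -> measurable U ->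
  mu.-integrable U (EFin \o sqnorm_at xi).
Proof.
move=> mx fx mU.
rewrite (_ : EFin \o sqnorm_at xi = fun y => (\sum_j (xi j y ^+ 2)%:E)%E); last first.
  by apply/funext => y /=; rewrite sumEFin.
apply: integrable_sum => // j _; apply/integrableP; split; first exact: measurable_sqE.
rewrite (eq_integral (fun y => (xi j y ^+ 2)%:E)); first exact: fx.
by move=> y _; rewrite gee0_abs// lee_fin sqr_ge0.
Qed.

Lemma integrable_bilin_at U a xi zeta M : measurable U ->
  (forall i j, measurable_fun U (a i j)) ->
  (forall y, U y -> bounded_form (fun i j => a i j y) M) -> 0 <= M ->
  (forall j, measurable_fun U (xi j)) -> (forall j, measurable_fun U (zeta j)) ->
  (forall j, (mass U (xi j) < +oo)%E) -> (forall j, (mass U (zeta j) < +oo)%E) ->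
  mu.-integrable U (EFin \o bilin_at a xi zeta).
Proof.
move=> mU ma aM M0 mx mz fx fz.
have ix := integrable_sqnorm_at mx fx mU; have iz := integrable_sqnorm_at mz fz mU.
apply: (@le_integrable _ _ _ mu U mU _
  (fun y => M%:E * (EFin \o sqnorm_at xi) y + (EFin \o sqnorm_at zeta) y)%E).
- by apply/measurable_EFinP; exact: measurable_bilin_at.
- move=> y Uy /=; rewrite lee_fin [leRHS]ger0_norm ?addr_ge0 ?mulr_ge0 ?sqnorm_ge0//.
  have := norm_bilin_le (xi^~ y) (zeta^~ y) (aM y Uy) ltr01.
  rewrite invr1 !mul1r => B; apply: le_trans B.
  by rewrite ler_peMl// ler1n.
- by apply: integrableD => //; exact: integrableZl.
Qed.

Lemma Rintegral_sqnorm_at U xi : measurable U -> (forall j, measurable_fun U (xi j)) ->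
  (forall j, (mass U (xi j) < +oo)%E) ->
  (\sum_j mass U (xi j) = (\int[mu]_(y in U) sqnorm_at xi y)%:E)%E.
Proof.
move=> mU mx fx; have ix := integrable_sqnorm_at mx fx mU.
rewrite /Rintegral fineK; last exact: integrable_fin_num.
rewrite -ge0_integral_sum//.
- by apply: eq_integral => y _; rewrite sumEFin.
- by move=> j; exact: measurable_sqE.
- by move=> j y _; rewrite lee_fin sqr_ge0.
Qed.

(** The first factor comes from [p = V - W] on the inner ball and the bound of the integral of [V]
    by that of [W]; the second sums the cut-off estimate over [d] coordinates, with a 4 for using
    half of the gap. *)
Definition caccioppoli_const lambda M : R :=
  (4 * form_const lambda M / lambda + 2) * (4 * d%:R * cutoff_const ^+ 2).

Lemma caccioppoli_const_ge0 lambda M : 0 < lambda -> 0 < M -> 0 <= caccioppoli_const lambda M.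
Proof.
move=> l0 M0; apply: mulr_ge0; last by apply: mulr_ge0 => //; exact: sqr_ge0.
apply: addr_ge0 => //; apply: divr_ge0; last exact: ltW.
by apply: mulr_ge0 => //; exact: form_const_ge0.
Qed.

(** Coercivity is integrated over [O], the equation over the part in the ball. Since the cut-off
    function and its gradient vanish off that part, both integrals can be taken there, and only then
    are the integrands compared pointwise. *)
Lemma form_caccioppoli O D F x u g a lambda M s h : open O -> HD D O u g ->
  F `&` eball x s `<=` D -> 0 < lambda -> 0 < M ->
  (forall i j, measurable_fun O (a i j)) ->
  (forall y, O y -> bounded_form (fun i j => a i j y) M) ->
  (forall v V, HD D O v V ->
     lambda * \int[mu]_(y in O) sqnorm_at V y <= \int[mu]_(y in O) bilin_at a V V y) ->
  (forall v V, HD F (O `&` eball x s) v V ->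
     \int[mu]_(y in O `&` eball x s) bilin_at a g V y = 0) ->
  0 <= h \/ eball x s `&` D = set0 ->
  level_caccioppoli O x u g s (caccioppoli_const lambda M) h.
Proof.
move=> oO Hu FD l0 M0 ma aM coer weak Hh r rho /andP[r0 rr] rs.
have mO := open_measurable_rV oO.
have [[lu lg _] fu fg _] := Hu; have [mu0 _] := lu.
have mg j : measurable_fun O (g j) by have [] := lg j.
have rho0 : 0 < rho by exact: lt_trans rr.
have s0 : 0 < s by exact: lt_le_trans rs.
pose r' := (r + rho) / 2.
have r1 : r < r' by rewrite /r'; lra.
have r2 : r' < rho by rewrite /r'; lra.
have r'0 : 0 < r' by exact: lt_trans r1.
have r's : r' <= s by rewrite ltW// (lt_le_trans r2).
set eta := cutoff x r r'.
have seta : smooth eta by exact: smooth_cutoff.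
have teta : rtest (eball x s) eta by apply: rtest_cutoff => //; exact: lt_le_trans rs.
have teta2 : rtest (eball x s) (fun y => eta y * eta y) by exact: rtestMl.
set U := O `&` eball x s.
have oU : open U by apply: openI => //; exact: eball_open.
have UO : U `<=` O by exact: subIsetl.
have mU := open_measurable_rV oU.
have Fs : D `&` eball x s `<=` D by exact: subIsetl.
set w := upos u h; set p := gpos u g h.
set W := fun j y => w y * partial j eta y.
set V := fun j y => eta y * p j y + W j y.
set psi := fun j y => eta y * eta y * p j y + w y * partial j (fun y => eta y * eta y) y.
have Hv : HD D O (fun y => eta y * w y) V.
  by apply: (HD_cut oO oO _ Hu Fs teta Hh); exact: subset_refl.
have Hpsi : HD F U (fun y => eta y * eta y * w y) psi.
  exact: (HD_cut oO oU UO Hu FD teta2 Hh).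
have := coer _ _ Hv; have := weak _ _ Hpsi; rewrite -/U => wk co.
have [[_ lV _] _ fV _] := Hv; have [[_ lpsi _] _ fpsi _] := Hpsi.
have mV j : measurable_fun O (V j) by have [] := lV j.
have mpsi j : measurable_fun U (psi j) by have [] := lpsi j.
have mw : measurable_fun O w by exact: measurable_upos.
have mp j : measurable_fun O (p j) by exact: measurable_gpos.
have mpeta j : measurable_fun O (partial j eta).
  apply: measurable_funTS; apply: continuous_measurable_rV.
  exact: rtest_continuous (rtest_partial j teta).
have mW j : measurable_fun O (W j) by exact: measurable_funM.
have sub (f : 'rV[R]_d -> R) : measurable_fun O f -> measurable_fun U f.
  by move=> mf; exact: measurable_funS mf.
set T := O `&` eball x r'.
have mT : measurable T by apply: measurableI => //; exact: measurable_eball.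
have TU : T `<=` U by apply: setIS; exact: subset_eball.
have out y : O y -> ~ T y -> r' ^+ 2 <= sqdist x y.
  move=> Oy Ty; rewrite leNgt; apply/negP => h0; apply: Ty; split => //.
  by rewrite eballE.
set Phi := level_mass O x u h rho.
have Phi0 : 0 <= Phi by exact: level_mass_ge0.
have TPhi : (mass T w <= Phi%:E)%E.
  rewrite /T level_massE// lee_fin; apply: level_mass_le_r => //; exact: ltW.
pose k := cutoff_const / (r' - r).
have kP j y : partial j eta y ^+ 2 <= k ^+ 2 by exact: sqr_partial_cutoff_le.
have WPhi j : (mass U (W j) <= (k ^+ 2 * Phi)%:E)%E.
  rewrite (mass_vanish TU); last first.
    by move=> y [Oy _] Ty; rewrite /W /eta partial_cutoff_eq0 ?mulr0// out.
  apply: (@le_trans _ _ (mass T (fun y => k * w y)%R)).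
    apply: mass_mono => //.
    - apply: measurable_funS (mW j) => //; exact: subIsetl.
    - apply: measurable_funM; [exact: measurable_cst|].
      by apply: measurable_funS mw => //; exact: subIsetl.
    - by move=> y _; rewrite (exprMn 2 (w y)) (exprMn 2 k) mulrC ler_wpM2r ?sqr_ge0.
  rewrite massZ//; last by apply: measurable_funS mw => //; exact: subIsetl.
  by rewrite (EFinM (k ^+ 2) Phi); apply: lee_EFinM2l TPhi; exact: sqr_ge0.
have fW j : (mass U (W j) < +oo)%E by apply: le_lt_trans (WPhi j) _; exact: ltry.
have fVU j : (mass U (V j) < +oo)%E.
  by apply: le_lt_trans (fV j); apply: mass_subset.
have fgU j : (mass U (g j) < +oo)%E.
  by apply: le_lt_trans (fg j); apply: mass_subset.
have V0 y : O y -> ~ U y -> forall j, V j y = 0.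
  move=> Oy Uy j; have h0 : r' ^+ 2 <= sqdist x y by apply: out => // /TU.
  by rewrite /V /W /eta cutoff_eq0 ?partial_cutoff_eq0 ?mul0r ?mulr0 ?addr0.
have EV : \int[mu]_(y in O) sqnorm_at V y = \int[mu]_(y in U) sqnorm_at V y.
  apply: Rintegral_vanish => // y Oy Uy; apply: big1 => j _.
  by rewrite V0// expr0n.
have EB : \int[mu]_(y in O) bilin_at a V V y = \int[mu]_(y in U) bilin_at a V V y.
  apply: Rintegral_vanish => // y Oy Uy; apply: big1 => j _.
  by rewrite V0// mulr0.
rewrite {}EV {}EB in co.
have maU i j : measurable_fun U (a i j) by apply: sub.
have aMU y : U y -> bounded_form (fun i j => a i j y) M by move=> /UO; exact: aM.
have mVU j := sub _ (mV j); have mWU j := sub _ (mW j); have mgU j := sub _ (mg j).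
have iB := integrable_bilin_at mU maU aMU (ltW M0) mVU mVU fVU fVU.
have iG := integrable_bilin_at mU maU aMU (ltW M0) mgU mpsi fgU fpsi.
have iV := integrable_sqnorm_at mVU fVU mU.
have iW := integrable_sqnorm_at mWU fW mU.
(* Where [u] exceeds [h], [g] is the gradient of the truncation and the commutator identity applies;
   elsewhere [V], [W] and [psi] vanish, so [g] may stand in the tested form everywhere. *)
have ptw y : U y -> bilin_at a V V y - bilin_at a g psi y <=
    lambda / 2 * sqnorm_at V y + form_const lambda M * sqnorm_at W y.
  move=> Uy.
  apply: le_trans (bilin_absorb (W^~ y) (V^~ y) (aMU y Uy) l0 M0).
  have dE j : partial j (fun y => eta y * eta y) y = 2 * eta y * partial j eta y.
    have /smoothP[_ deta _] := seta.
    by rewrite (partialM (deta j y) (deta j y)); ring.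
  have [hu|hu] := ltP h (u y).
    have VE : V^~ y = fun i => eta y * g i y + W i y.
      by apply/funext => i; rewrite /V /p /gpos hu.
    have psiE : psi^~ y = fun i => eta y ^+ 2 * g i y + 2 * eta y * W i y.
      by apply/funext => i; rewrite /psi /p /gpos hu dE /W; ring.
    by rewrite /bilin_at VE psiE (bilin_commutator _ (g^~ y) (W^~ y)).
  have w0 : w y = 0 by rewrite /w uposE; apply/max_idPr; rewrite subr_le0.
  have p0 j : p j y = 0 by rewrite /p /gpos ltNge hu.
  have W0 : W^~ y = fun=> 0 by apply/funext => j; rewrite /W w0 mul0r.
  have VE : V^~ y = fun=> 0 by apply/funext => j; rewrite /V /W w0 p0 mul0r mulr0 addr0.
  have psiE : psi^~ y = fun=> 0 by apply/funext => j; rewrite /psi w0 p0 mul0r mulr0 addr0.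
  have b0 z : bilin (fun i j => a i j y) z (fun=> 0) = 0 by apply: big1 => i _; rewrite mulr0.
  by rewrite /bilin_at W0 VE psiE !b0 !subrr addr0.
have int_le : \int[mu]_(y in U) (bilin_at a V V y - bilin_at a g psi y) <=
    \int[mu]_(y in U) (lambda / 2 * sqnorm_at V y + form_const lambda M * sqnorm_at W y).
  apply: le_Rintegral => //.
    by have := integrableB mU iB iG.
  have := integrableD mU (integrableZl mU (lambda / 2) iV)
    (integrableZl mU (form_const lambda M) iW).
  by [].
have iV' : mu.-integrable U (EFin \o (fun y => lambda / 2 * sqnorm_at V y)).
  by have := integrableZl mU (lambda / 2) iV.
have iW' : mu.-integrable U (EFin \o (fun y => form_const lambda M * sqnorm_at W y)).
  by have := integrableZl mU (form_const lambda M) iW.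
rewrite RintegralB// wk subr0 RintegralD// RintegralZl// RintegralZl// in int_le.
(* The commutator consumes half of the coercivity; the other half controls the integral of [V]. *)
have VW : \int[mu]_(y in U) sqnorm_at V y <=
    2 * form_const lambda M / lambda * \int[mu]_(y in U) sqnorm_at W y.
  have {int_le co} := le_trans co int_le.
  move: (\int[mu]_(y in U) sqnorm_at V y) (\int[mu]_(y in U) sqnorm_at W y) => I J IJ.
  rewrite -(ler_pM2l l0).
  have -> : lambda * (2 * form_const lambda M / lambda * J) = 2 * (form_const lambda M * J).
    by field; rewrite gt_eqF.
  have -> : lambda * I = 2 * (lambda * I - lambda / 2 * I) by field.
  by rewrite ler_pM2l// lerBlDl.
set Sr := O `&` eball x r.
have mSr : measurable Sr by apply: measurableI => //; exact: measurable_eball.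
have SrU : Sr `<=` U.
  by apply: setIS; apply: subset_eball; rewrite ltW// (lt_trans r1)// (lt_le_trans r2).
have subS (f : 'rV[R]_d -> R) : measurable_fun U f -> measurable_fun Sr f.
  by move=> mf; exact: measurable_funS mf.
have pVW j : (mass Sr (p j) <= 2%:E * (mass U (V j) + mass U (W j)))%E.
  apply: (@le_trans _ _ (2%:E * (mass Sr (V j) + mass Sr (W j)))%E).
    apply: mass_le2 => //; [by apply: subS; exact: sub|exact: subS|exact: subS|].
    move=> y [Oy By]; have -> : p j y = V j y + - W j y.
      by rewrite /V addrK /eta cutoff_eq1 ?mul1r.
    by rewrite -[W j y ^+ 2]sqrrN; exact: sqrrD_le2.
  by apply: lee_EFinM2l => //; apply: leeD; exact: mass_subset.
apply: (@le_trans _ _ (\sum_j 2%:E * (mass U (V j) + mass U (W j)))%E).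
  by apply: lee_sum => j _; exact: pVW.
rewrite -ge0_sume_distrr; last by move=> j _; rewrite adde_ge0 ?mass_ge0.
rewrite big_split/= Rintegral_sqnorm_at//.
have sumW : (\sum_j mass U (W j) <= (d%:R * (k ^+ 2 * Phi))%:E)%E.
  apply: (@le_trans _ _ (\sum_(j < d) (k ^+ 2 * Phi)%:E)%E); first by apply: lee_sum => j _.
  by rewrite sumEFin lee_fin sumr_const card_ord mulr_natl.
rewrite Rintegral_sqnorm_at// lee_fin in sumW.
rewrite Rintegral_sqnorm_at// -EFinD -EFinM level_massE// -EFinM lee_fin -/Phi.
move: (\int[mu]_(y in U) sqnorm_at V y) (\int[mu]_(y in U) sqnorm_at W y) VW sumW => I J IJ JP.
apply: (@le_trans _ _ ((4 * form_const lambda M / lambda + 2) * J)).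
  apply: (@le_trans _ _ (2 * (2 * form_const lambda M / lambda * J + J))).
    by rewrite ler_wpM2l// lerD2r.
  by rewrite le_eqVlt; apply/orP; left; apply/eqP; field; rewrite gt_eqF.
have c0 : 0 <= 4 * form_const lambda M / lambda + 2.
  by rewrite addr_ge0// divr_ge0 ?(ltW l0)// mulr_ge0// form_const_ge0.
apply: le_trans (ler_wpM2l c0 JP) _.
rewrite le_eqVlt; apply/orP; left; apply/eqP.
rewrite /k /r' /caccioppoli_const; field.
by rewrite !gt_eqF ?subr_gt0//; lra.
Qed.

End caccioppoli_form.

(** * From complex coefficients to real forms *)

Section complex_forms.
Context {R : realType} {d : nat}.

Local Notation mu := (lebesgue_rV R d).
Local Notation Re := complex.Re.
Local Notation Im := complex.Im.

Lemma Re_sum (I : finType) (f : I -> R[i]) : Re (\sum_i f i) = \sum_i Re (f i).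
Proof. by apply: (big_morph (@complex.Re R)) => // -[a b] []. Qed.

Lemma Im_sum (I : finType) (f : I -> R[i]) : Im (\sum_i f i) = \sum_i Im (f i).
Proof. by apply: (big_morph (@complex.Im R)) => // -[a b] []. Qed.

Lemma normc_sum (I : finType) (f : I -> R[i]) : normc (\sum_i f i) <= \sum_i normc (f i).
Proof.
elim/big_rec2: _ => [|i a z _ IH]; first by rewrite ComplexField.Normc.normc0.
by apply: le_trans (le_normcD _ _) _; rewrite lerD2l.
Qed.

Lemma Re_cvdot_real (M : 'M[R[i]]_d) (xi zeta : 'I_d -> R) :
  Re (cvdot (M *m (\col_j (xi j)%:C%C)) (\col_j (zeta j)%:C%C)) =
  bilin (fun i j => Re (M i j)) xi zeta.
Proof.
rewrite /cvdot Re_sum; apply: eq_bigr => i _; rewrite !mxE Re_mulc /= oppr0 mulr0 subr0.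
rewrite Re_sum; congr (_ * _); apply: eq_bigr => j _.
by rewrite !mxE Re_mulc /= mulr0 subr0.
Qed.

Lemma normc_le_cvnorm (v : 'cV[R[i]]_d) j : normc (v j ord0) <= cvnorm v.
Proof.
rewrite -[leLHS]ger0_norm ?normc_ge0// -sqrtr_sqr ler_wsqrtr//.
rewrite (bigD1 j)//= lerDl; apply: sumr_ge0 => i _; exact: sqr_ge0.
Qed.

(* Needed because [sup] is 0 on unbounded sets. *)
Lemma opnorm_has_ubound (M : 'M[R[i]]_d) :
  has_ubound [set cvnorm (M *m v) | v in [set v | cvnorm v <= 1]].
Proof.
exists (Num.sqrt (\sum_i (\sum_j normc (M i j)) ^+ 2)) => _ [v v1 <-].
rewrite ler_wsqrtr//; apply: ler_sum => i _.
rewrite lerXn2r ?nnegrE ?normc_ge0//.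
  by apply: sumr_ge0 => j _; exact: normc_ge0.
rewrite mxE; apply: le_trans (normc_sum _) _; apply: ler_sum => j _.
rewrite ComplexField.Normc.normcM ler_piMr ?normc_ge0//.
exact: le_trans (normc_le_cvnorm _ _) v1.
Qed.

(** Real vectors are among the complex ones in the supremum, and taking real parts does not increase
    the norm of the image. The zero vector is set apart because the others are normalised. *)
Lemma opnorm_bounded_form (M : 'M[R[i]]_d) (L : R) : opnorm M <= L ->
  bounded_form (fun i j => Re (M i j)) (L ^+ 2).
Proof.
move=> ML xi.
have [X0|X0] := eqVneq (sqnorm xi) 0.
  have xi0 j : xi j = 0.
    apply/eqP; rewrite -sqrf_eq0; apply/eqP.
    exact: (psumr_eq0P (fun i _ => sqr_ge0 (xi i)) X0).
  rewrite X0 mulr0 big1// => i _; rewrite big1 ?expr0n// => j _.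
  by rewrite xi0 mulr0.
have Xp : 0 < sqnorm xi by rewrite lt_def X0 sqnorm_ge0.
set n := Num.sqrt (sqnorm xi); have n0 : 0 < n by rewrite sqrtr_gt0.
have nE : n ^+ 2 = sqnorm xi by rewrite sqr_sqrtr// ltW.
pose v : 'cV[R[i]]_d := \col_j (xi j / n)%:C%C.
have v1 : cvnorm v = 1.
  rewrite /cvnorm (eq_bigr (fun j => n ^- 2 * xi j ^+ 2)).
    by rewrite -mulr_sumr -/(sqnorm xi) nE mulVf// sqrtr1.
  by move=> j _; rewrite mxE normcR real_normK ?num_real// exprMn exprVn mulrC.
have vL : cvnorm (M *m v) <= L.
  apply: le_trans ML; apply: ub_le_sup; first exact: opnorm_has_ubound.
  by exists v => //=; rewrite v1.
have L0 : 0 <= L by apply: le_trans vL; exact: sqrtr_ge0.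
have : cvnorm (M *m v) ^+ 2 <= L ^+ 2 by rewrite lerXn2r ?nnegrE ?sqrtr_ge0.
rewrite sqr_cvnorm -nE -(ler_pM2r (exprn_gt0 2 n0)) mulr_suml => H; apply: le_trans H.
apply: ler_sum => i _.
have -> : \sum_j Re (M i j) * xi j = Re ((M *m v) i ord0) * n.
  rewrite mxE Re_sum mulr_suml; apply: eq_bigr => j _.
  by rewrite mxE Re_mulc /= mulr0 subr0 -!mulrA mulVf ?mulr1// gt_eqF.
rewrite exprMn ler_wpM2r ?sqr_ge0// sqr_normc lerDl; exact: sqr_ge0.
Qed.

Lemma cmeasurable_sum (I : finType) (U : set 'rV[R]_d) (f : I -> 'rV[R]_d -> R[i]) :
  (forall i, cmeasurable_fun U (f i)) -> cmeasurable_fun U (fun y => \sum_i f i y).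
Proof.
move=> mf; split.
  rewrite (_ : (fun y => _) = fun y => \sum_i Re (f i y)); last first.
    by apply/funext => y; rewrite Re_sum.
  by apply: measurable_sum => i; have [] := mf i.
rewrite (_ : (fun y => _) = fun y => \sum_i Im (f i y)); last first.
  by apply/funext => y; rewrite Im_sum.
by apply: measurable_sum => i; have [] := mf i.
Qed.

Lemma cmeasurableM (U : set 'rV[R]_d) (f f' : 'rV[R]_d -> R[i]) :
  cmeasurable_fun U f -> cmeasurable_fun U f' -> cmeasurable_fun U (fun y => f y * f' y).
Proof.
move=> [mr mi] [mr' mi']; split.
  rewrite (_ : (fun y => _) = fun y => Re (f y) * Re (f' y) - Im (f y) * Im (f' y)).
    by apply: measurable_funB; exact: measurable_funM.
  by apply/funext => y; rewrite Re_mulc.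
rewrite (_ : (fun y => _) = fun y => Re (f y) * Im (f' y) + Im (f y) * Re (f' y)).
  by apply: measurable_funD; exact: measurable_funM.
by apply/funext => y; rewrite Im_mulc.
Qed.

Lemma cmeasurable_conj (U : set 'rV[R]_d) (f : 'rV[R]_d -> R[i]) :
  cmeasurable_fun U f -> cmeasurable_fun U (fun y => conjc (f y)).
Proof.
move=> [mr mi]; split.
  by rewrite (_ : (fun y => _) = fun y => Re (f y))//; apply/funext => y; case: (f y).
rewrite (_ : (fun y => _) = fun y => - Im (f y)); first exact: measurableT_comp.
by apply/funext => y; case: (f y).
Qed.

Lemma cmeasurable_cvdot (U : set 'rV[R]_d) (A : 'rV[R]_d -> 'M[R[i]]_d)
    (G H : 'rV[R]_d -> 'cV[R[i]]_d) :
  (forall i j, cmeasurable_fun U (fun y => A y i j)) ->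
  (forall j, cmeasurable_fun U (fun y => G y j ord0)) ->
  (forall j, cmeasurable_fun U (fun y => H y j ord0)) ->
  cmeasurable_fun U (fun y => cvdot (A y *m G y) (H y)).
Proof.
move=> mA mG mH; apply: cmeasurable_sum => i; apply: cmeasurableM; last exact: cmeasurable_conj.
rewrite (_ : (fun y => _) = fun y => \sum_j A y i j * G y j ord0).
  by apply: cmeasurable_sum => j; exact: cmeasurableM.
by apply/funext => y; rewrite mxE.
Qed.

(** The identifications hold almost everywhere only, as [grad] is known up to null sets and the
    coefficients may be altered on one. *)
Lemma Re_cintegral_form (U : set 'rV[R]_d) (A : 'rV[R]_d -> 'M[R[i]]_d)
    (G H : 'rV[R]_d -> 'cV[R[i]]_d) (a : 'I_d -> 'I_d -> 'rV[R]_d -> R)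
    (xi zeta : 'I_d -> 'rV[R]_d -> R) : measurable U ->
  (forall i j, cmeasurable_fun U (fun y => A y i j)) ->
  (forall j, cmeasurable_fun U (fun y => G y j ord0)) ->
  (forall j, cmeasurable_fun U (fun y => H y j ord0)) ->
  (forall i j, measurable_fun U (a i j)) ->
  (forall j, measurable_fun U (xi j)) -> (forall j, measurable_fun U (zeta j)) ->
  {ae mu, forall y, U y -> forall i j, a i j y = Re (A y i j)} ->
  {ae mu, forall y, U y -> G y = cgrad xi y} ->
  {ae mu, forall y, U y -> H y = cgrad zeta y} ->
  Re (cintegral U (fun y => cvdot (A y *m G y) (H y))) =
  \int[mu]_(y in U) bilin_at a xi zeta y.
Proof.
move=> mU mA mG mH ma mx mz aA GE HE; rewrite /cintegral /= /Rintegral; congr fine.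
apply: ae_eq_integral => //.
- by apply/measurable_EFinP; have [] := cmeasurable_cvdot mA mG mH.
- by apply/measurable_EFinP; exact: measurable_bilin_at.
move: aA GE HE; apply: filterS3 => y aA GE HE Uy.
rewrite (GE Uy) (HE Uy) /= Re_cvdot_real /bilin_at; congr (bilin _ _ _)%:E.
by apply/funext => i; apply/funext => j; rewrite aA.
Qed.

Lemma integral_cvnorm_grad (U : set 'rV[R]_d) (v : 'rV[R]_d -> R) V : open U -> wgrad U v V ->
  \int[mu]_(y in U) (cvnorm (grad U (fun z => (v z)%:C%C) y) ^+ 2) =
  \int[mu]_(y in U) sqnorm_at V y.
Proof.
move=> oU wV; have mU := open_measurable_rV oU; have wG := real_weak_gradient oU wV.
rewrite /Rintegral; congr fine; apply: ae_eq_integral => //.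
- apply/measurable_EFinP; apply: measurable_sqr_cvnorm => // j; exact: measurable_grad wG.
- apply/measurable_EFinP; apply: measurable_sum => j; apply: measurable_funX.
  by have [_ /(_ j)[]] := wV.
- move: (grad_ae oU wG); apply: filterS => y E Uy /=.
  by rewrite (E Uy) sqr_cvnorm_cgrad.
Qed.

(** Inside the open ball the boundary of the intersection is that of [O]; so the Dirichlet part of
    the local form space meets the ball in points of [D] only, as [HD_cut] requires. *)
Lemma boundary_cap_eball (O D : set 'rV[R]_d) x s : open O ->
  (boundary (O `&` eball x s) `\` ((boundary O `\` D) `&` eball x s)) `&` eball x s `<=` D.
Proof.
move=> oO y [[[cy niy] nN] By].
have cOy : closure O y by apply: closure_subset cy => z [].
apply: contrapT => nD; apply: nN; split => //; split => //; split => // iO.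
apply: niy; apply: filterI => //.
by apply: open_nbhs_nbhs; split => //; exact: eball_open.
Qed.

(** Taking real parts turns coercivity and the equation, tested with real functions, into statements
    on the form with coefficients [Re (A y i j)]. The added 1 keeps the bound positive for
    [Lambda = 0], since a Young weight in [bilin_absorb] divides by it. *)
Lemma weak_solution_level_caccioppoli (O D : set 'rV[R]_d) A x (s lambda Lambda : R) u g :
  open O -> 0 < lambda -> bounded_coefficients O A Lambda -> coercive D O A lambda ->
  HD D O u g -> weak_solution D O A x s (fun y => (u y)%:C%C) ->
  forall h, 0 <= h \/ (s%:E < dist_to D x)%E ->
  level_caccioppoli O x u g s (caccioppoli_const (d := d) lambda (Lambda ^+ 2 + 1)) h.
Proof.
move=> oO l0 [mA AL] coer Hu weak h Hh; have mO := open_measurable_rV oO.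
set U := O `&` eball x s.
have oU : open U by apply: openI => //; exact: eball_open.
have UO : U `<=` O by exact: subIsetl.
have mU := open_measurable_rV oU.
have [[lu lg Hg] _ _ _] := Hu.
have wGu := real_weak_gradient oO (And3 lu lg Hg).
have /ess_supP[N [mN N0 HN]] : (ess_sup_on O (fun y => opnorm (A y)) <= Lambda%:E)%E by rewrite AL.
(* The coefficients are set to 0 on a null set, so that the bound on them holds
   at every point. *)
pose a i j (y : 'rV[R]_d) := \1_(~` N) y * Re (A y i j).
have ma i j : measurable_fun O (a i j).
  apply: measurable_funM; last by have [] := mA i j.
  by apply: measurable_indic; exact: measurableC.
have aA : {ae mu, forall y, forall i j, a i j y = Re (A y i j)}.
  exists N; split => // y; apply: contra_notP => nNy i j.
  by rewrite /a indicE mem_set// mul1r.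
have aM y : O y -> bounded_form (fun i j => a i j y) (Lambda ^+ 2 + 1).
  move=> Oy xi; have X0 := sqnorm_ge0 xi.
  have [yN|yN] := pselect (N y).
    rewrite big1 ?mulr_ge0 ?addr_ge0 ?sqr_ge0// => i _.
    by rewrite big1 ?expr0n// => j _; rewrite /a indicE memNset ?mul0r//; exact.
  have AyL : opnorm (A y) <= Lambda.
    apply: contrapT => h0; apply: yN; by apply: HN; rewrite /= /patch mem_set.
  apply: (@le_trans _ _ (Lambda ^+ 2 * sqnorm xi)); last by rewrite ler_wpM2r// lerDl.
  have := opnorm_bounded_form AyL xi; apply: le_trans.
  rewrite le_eqVlt; apply/orP; left; apply/eqP.
  apply: eq_bigr => i _; congr (_ ^+ 2); apply: eq_bigr => j _.
  by rewrite /a indicE mem_set// mul1r.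
have cmg V (W : set 'rV[R]_d) (v : 'rV[R]_d -> R) j : open W -> wgrad W v V ->
    cmeasurable_fun W (fun y => grad W (fun z => (v z)%:C%C) y j ord0).
  by move=> oW wV; apply: measurable_grad; exact: real_weak_gradient wV.
apply: (form_caccioppoli oO Hu (@boundary_cap_eball O D x s oO) l0 _ ma aM).
- by rewrite ltr_wpDl ?sqr_ge0.
- move=> v V Hv; have [wV _ _ _] := Hv.
  have := coer _ (HD_H1real oO Hv); rewrite (integral_cvnorm_grad oO wV).
  have wG := real_weak_gradient oO wV; have [_ lV _] := wV.
  have mV j : measurable_fun O (V j) by have [] := lV j.
  rewrite (Re_cintegral_form (a := a) (xi := V) (zeta := V))//.
  + by move=> j; exact: cmg wV.
  + by move=> j; exact: cmg wV.
  + by move: aA; apply: filterS.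
  + exact: grad_ae.
  + exact: grad_ae.
- move=> v V Hv; have [wV _ _ _] := Hv.
  have := weak _ (HD_H1real oU Hv) => /(congr1 (@complex.Re R)); rewrite [RHS]/=.
  have wG := real_weak_gradient oU wV; have [_ lV _] := wV.
  have mV j : measurable_fun U (V j) by have [] := lV j.
  rewrite (Re_cintegral_form (a := a) (xi := g) (zeta := V))//.
  + move=> i j; have [m1 m2] := mA i j.
    by split; [exact: measurable_funS m1|exact: measurable_funS m2].
  + move=> j; have [m1 m2] := cmg _ _ _ j oO (And3 lu lg Hg).
    by split; [exact: measurable_funS m1|exact: measurable_funS m2].
  + by move=> j; exact: cmg wV.
  + by move=> i j; exact: measurable_funS (ma i j).
  + by move=> j; have [m1 _] := lg j; exact: measurable_funS m1.
  + by move: aA; apply: filterS.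
  + by move: (grad_ae oO wGu); apply: filterS => y E /UO.
  + exact: grad_ae.
- by case: Hh => [|/dist_to_eball]; [left|right].
Qed.

End complex_forms.

Theorem theorem8p4 (R : realType) (d : nat) (hd : (2 <= d)%N) :
  (forall (O D : set 'rV[R]_d) (q cE : R) (x : 'rV[R]_d) (r0 : R)
          (u : 'rV[R]_d -> R),
     open O -> closed D -> D `<=` boundary O -> embedding D O q cE ->
     closure O x -> 0 < r0 -> DG D O x r0 u ->
     exists2 c : R, 0 < c &
       forall s : R, 0 < s <= r0 -> local_bounds D O x s q c u)
  /\
  (forall lambda Lambda r0 q cE : R, 0 < lambda -> 0 < r0 ->
     exists2 c : R, 0 < c &
       forall (O D : set 'rV[R]_d) (A : 'rV[R]_d -> 'M[R[i]]_d)
              (x : 'rV[R]_d) (s : R) (u : 'rV[R]_d -> R),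
         open O -> closed D -> D `<=` boundary O -> embedding D O q cE ->
         bounded_coefficients O A Lambda -> coercive D O A lambda ->
         real_coefficients O A ->
         closure O x -> 0 < s <= r0 -> H1real_ D O u ->
         weak_solution D O A x s (fun y => (u y)%:C%C) ->
         local_bounds D O x s q c u).
Proof.
split.
  move=> O D q cE x r0 u oO _ _ Hemb _ _ [/(H1real_HD oO)[g Hu] [c c0 Hc]].
  exists (@sup_const R d q cE c r0); first exact: sup_const_gt0.
  move=> s /andP[s0 sr].
  apply: (caccioppoli_local_bounds hd oO Hemb Hu (ltW c0) s0 sr).
  exact: (DG_level_caccioppoli oO Hu sr Hc).
move=> lambda Lambda r0 q cE l0 _.
have M0 : 0 < Lambda ^+ 2 + 1 by rewrite ltr_wpDl ?sqr_ge0.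
(* Only the dimension, ellipticity, [r0] and the constants of the embedding enter, so the witness
   precedes the domain and the solution. *)
exists (@sup_const R d q cE (caccioppoli_const (d := d) lambda (Lambda ^+ 2 + 1)) r0).
  exact: sup_const_gt0.
move=> O D A x s u oO _ _ Hemb AL coer _ _ /andP[s0 sr] /(H1real_HD oO)[g Hu] weak.
apply: (caccioppoli_local_bounds hd oO Hemb Hu (@caccioppoli_const_ge0 _ d _ _ l0 M0) s0 sr).
exact: weak_solution_level_caccioppoli weak.
Qed.
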